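(* For any $1$-reduced simplicial set $X$ there is a strong deformation retract of chain complexes, natural in $X$, of $CGX$ onto $\Omega CX$. That is, there are chain maps $\phi:\Omega CX\to CGX$ and $\psi: CGX\to\Omega CX$ and a linear map $\Phi:CGX\to CGX$ of degree $+1$, all natural with respect to simplicial maps between $1$-reduced simplicial sets, such that $\psi\phi=\mathrm{Id}_{\Omega CX}$ and $\partial\Phi+\Phi\partial=\phi\psi-\mathrm{Id}_{CGX}$. Furthermore, both $\phi$ and $\psi$ are homomorphisms of differential graded algebras.
   Context: A simplicial set $X$ is $n$-reduced if $X_k$ is a single point for all $k\le n$. For $x\in X_n$ and a monotone map $f:\{0,\dots,m\}\to\{0,\dots,n\}$, $x_{(f(0),\dots,f(m))}\in X_m$ denotes the corresponding simplex. Normalised chains: $C_nX$ is the free abelian group on the nondegenerate $n$-simplices of $X$ (degenerate simplices are identified with $0$), with $\partial=\sum(-1)^id_i$ and the Alexander-Whitney comultiplication $\Delta(x)=x_{(0)}\otimes x+\sum_{i=1}^{n-1}x_{(0,\dots,i)}\otimes x_{(i,\dots,n)}+x\otimes x_{(n)}$. Cobar construction: for $X$ $1$-reduced, $\Omega CX$ is the free graded associative $\mathbb Z$-algebra $T(s^{-1}C_{\ge 2}X)$ ($s^{-1}$ lowers degree by $1$; multiplication written $\otimes$) with differential the derivation determined, for $x\in X_{n+1}$ nondegenerate, by $$\partial^\Omega s^{-1}x=\sum_{r=0}^{n+1}(-1)^{r+1}s^{-1}d_rx+\sum_{r=1}^n(-1)^r s^{-1}x_{(0,\dots,r)}\otimes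 s^{-1}x_{(r,\dots,n+1)},$$ where $s^{-1}y=0$ if $y$ is degenerate or $\dim y\leq 1$. Kan loop group: $GX$ is the simplicial group with $(GX)_n=\mathbf F(X_{n+1})/\mathbf F(s_0X_n)$ ($\mathbf F$ = free group); writing $\tau x\in (GX)_n$ for the class of $x\in X_{n+1}$ (so $\tau s_0x=1$), the simplicial structure is determined by $s_i\tau x=\tau s_{i+1}x$ for $i\ge 0$, $d_0\tau x=(\tau d_0x)^{-1}\cdot\tau d_1x$, and $d_i\tau x=\tau d_{i+1}x$ for $i\ge1$. Multiplication on $CGX$: for $g\in (GX)_p$, $h\in (GX)_q$, $$m(g\otimes h)=\sum(-1)^{\mathrm{sgn}(\mu,\nu)}s_{\mu(q)}\cdots s_{\mu(1)}g\cdot s_{\nu(p)}\cdots s_{\nu(1)}h,$$ the sum being over all $(p,q)$-shuffles, i.e. partitions of $\{0,\dots,p+q-1\}$ into $\nu(1)<\dots<\nu(p)$ and $\mu(1)<\dots<\mu(q)$, with $\mathrm{sgn}(\mu,\nu)$ the parity of the permutation $(\nu(1),\dots,\nu(p),\mu(1),\dots,\mu(q))$. This makes $CGX$ a differential graded algebra. *)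

(* Defs.v *)
From HB Require Import structures.
From mathcomp Require Import all_boot all_order all_algebra perm.
From mathcomp Require Import boolp.
From mathcomp Require Import finmap.
From mathcomp Require Import monalg.

Set Implicit Arguments.
Unset Strict Implicit.
Unset Printing Implicit Defensive.

Import GRing.Theory.
Local Open Scope quotient_scope.
Local Open Scope ring_scope.

Record sset_data : Type := SSetData {
  sset_ob :> nat -> Type;
  sset_face : forall n, 'I_n.+2 -> sset_ob n.+1 -> sset_ob n;
  sset_dgn : forall n, 'I_n.+1 -> sset_ob n -> sset_ob n.+1 }.

(* [face i] and [dgn i] take a natural number as index.  They are only used
   for indices in range, where [inord i] is the ordinal of value [i]. *)
Definition face (X : sset_data) (n i : nat) (x : X n.+1) : X n :=
  sset_face (inord i) x.
Definition dgn (X : sset_data) (n i : nat) (x : X n) : X n.+1 :=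
  sset_dgn (inord i) x.

Record sset_axioms (X : sset_data) : Prop := SSetAxioms {
  face_face : forall n i j (x : X n.+2), (i <= j <= n.+1)%N ->
    face i (face j.+1 x) = face j (face i x);
  dgn_dgn : forall n i j (x : X n), (i <= j <= n)%N ->
    dgn i (dgn j x) = dgn j.+1 (dgn i x);
  face_dgn_lt : forall n i j (x : X n.+1), (i <= j <= n)%N ->
    face i (dgn j.+1 x) = dgn j (face i x);
  face_dgn_eq : forall n j (x : X n), (j <= n)%N -> face j (dgn j x) = x;
  face_dgn_eqS : forall n j (x : X n), (j <= n)%N -> face j.+1 (dgn j x) = x;
  face_dgn_gt : forall n i j (x : X n.+1), (j < i <= n.+1)%N ->
    face i.+1 (dgn j x) = dgn j (face i x) }.

Record sset : Type := SSet {
  sset_carrier :> sset_data;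
  sset_ax : sset_axioms sset_carrier }.

Record sset_map (X Y : sset) : Type := SSetMap {
  smap_fun :> forall n, X n -> Y n;
  smap_face : forall n (i : 'I_n.+2) (x : X n.+1),
    smap_fun (sset_face i x) = sset_face i (smap_fun x);
  smap_dgn : forall n (i : 'I_n.+1) (x : X n),
    smap_fun (sset_dgn i x) = sset_dgn i (smap_fun x) }.

Definition reduced (n : nat) (X : sset) : Prop :=
  forall k, (k <= n)%N -> exists x : X k, forall y : X k, y = x.

Definition degenerate (X : sset_data) (n : nat) : X n -> Prop :=
  match n with
  | 0 => fun=> False
  | m.+1 => fun x : X m.+1 => exists i (y : X m), x = sset_dgn i y
  end.

Definition simplex (X : sset_data) : Type := {n : nat & {classic X n}}.

Definition simp (X : sset_data) (n : nat) (x : X n) : simplex X :=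
  existT (fun n => {classic X n}) n x.

Definition dim (X : sset_data) (s : simplex X) : nat := tag s.

(* For x of dimension n and r <= n, [drop_last (n - r) x] is x_(0,...,r) and
   [drop_first r x] is x_(r,...,n). *)
Fixpoint drop_last (X : sset_data) (k n : nat) : X n -> simplex X :=
  match k, n with
  | k'.+1, m.+1 => fun x : X m.+1 => drop_last k' (face m.+1 x)
  | _, _ => fun x => simp x
  end.

Fixpoint drop_first (X : sset_data) (k n : nat) : X n -> simplex X :=
  match k, n with
  | k'.+1, m.+1 => fun x : X m.+1 => drop_first k' (face 0 x)
  | _, _ => fun x => simp x
  end.

Definition smap_simplex (X Y : sset) (f : sset_map X Y) (s : simplex X) :
  simplex Y := simp (f (tag s) (tagged s : X (tag s))).

(* The additive map on a free abelian group with given values on the basis. *)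
Definition linext (K : choiceType) (V : zmodType) (f : K -> V)
  (c : {malg int[K]}) : V := \sum_(k <- msupp c) f k *~ c@_k.

Definition nondeg (X : sset_data) : Type :=
  {s : simplex X | ~~ `[< degenerate (tagged s : X (tag s)) >]}.

HB.instance Definition _ (X : sset_data) := Choice.on (nondeg X).

(* The direct sum of the groups C_n X, [chains_in n] being its n-th summand. *)
Definition chains (X : sset_data) : Type := {malg int[nondeg X]}.

HB.instance Definition _ (X : sset_data) := GRing.Lmodule.on (chains X).

Definition chains_in (X : sset_data) (n : nat) (c : chains X) : Prop :=
  forall b, b \in msupp c -> dim (val b) = n.

Definition chain (X : sset_data) (s : simplex X) : chains X :=
  if insub s is Some b then << (b : nondeg X) >> else 0.

Definition boundary_simplex (X : sset_data) (n : nat) : X n -> chains X :=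
  match n with
  | 0 => fun=> 0
  | m.+1 => fun x : X m.+1 =>
      \sum_(i < m.+2) (-1) ^+ i *: chain (simp (face i x))
  end.

Definition boundary (X : sset_data) : chains X -> chains X :=
  linext (fun b : nondeg X => boundary_simplex (tagged (val b))).

Definition chains_map (X Y : sset) (f : sset_map X Y) : chains X -> chains Y :=
  linext (fun b : nondeg X => chain (smap_simplex f (val b))).

Definition cobar_gen (X : sset_data) : Type :=
  {s : simplex X |
    (1 < dim s)%N && ~~ `[< degenerate (tagged s : X (tag s)) >]}.

HB.instance Definition _ (X : sset_data) := Choice.on (cobar_gen X).

(* The free associative ring on [cobar_gen X] is the integral monoid ring of
   the free monoid of words in [cobar_gen X]. *)
Definition cobar (X : sset_data) : Type := {malg int[{fmonom cobar_gen X}]}.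

HB.instance Definition _ (X : sset_data) := GRing.Lalgebra.on (cobar X).

Definition cobar_gen_deg (X : sset_data) (a : cobar_gen X) : nat :=
  (dim (val a)).-1.

Definition cobar_in (X : sset_data) (n : nat) (c : cobar X) : Prop :=
  forall w : {fmonom cobar_gen X}, w \in msupp c ->
    (\sum_(a <- (w : seq _)) cobar_gen_deg a)%N = n.

Definition cobar_word (X : sset_data) (w : seq (cobar_gen X)) : cobar X :=
  << FMonom w >>.

(* s^{-1}, with value 0 on degenerate simplices and in dimensions <= 1. *)
Definition desusp (X : sset_data) (s : simplex X) : cobar X :=
  if insub s is Some a then cobar_word [:: a : cobar_gen X] else 0.

Definition cobar_diff_simplex (X : sset_data) (m : nat) : X m -> cobar X :=
  match m with
  | 0 => fun=> 0
  | n.+1 => fun x : X n.+1 =>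
      \sum_(r < n.+2) (-1) ^+ r.+1 *: desusp (simp (face r x))
      + \sum_(1 <= r < n.+1)
          (-1) ^+ r *: (desusp (drop_last (n.+1 - r) x)
                        * desusp (drop_first r x))
  end.

Fixpoint cobar_diff_word (X : sset_data) (w : seq (cobar_gen X)) : cobar X :=
  if w is a :: w' then
    cobar_diff_simplex (tagged (val a)) * cobar_word w'
    + (-1) ^+ cobar_gen_deg a *: (cobar_word [:: a] * cobar_diff_word w')
  else 0.

Definition cobar_diff (X : sset_data) : cobar X -> cobar X :=
  linext (fun w : {fmonom cobar_gen X} => cobar_diff_word (w : seq _)).

Definition cobar_map (X Y : sset) (f : sset_map X Y) : cobar X -> cobar Y :=
  linext (fun w : {fmonom cobar_gen X} =>
    \prod_(a <- (w : seq _)) desusp (smap_simplex f (val a))).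

Section FreeGroup.
Variable S : Type.

(* The letter (x, b) stands for x^-1 if b = true and for x if b = false. *)
Definition fg_word : Type := seq ({classic S} * bool).
HB.instance Definition _ := Choice.on fg_word.

Inductive fg_eq : fg_word -> fg_word -> Prop :=
| fg_refl w : fg_eq w w
| fg_sym v w : fg_eq v w -> fg_eq w v
| fg_trans u v w : fg_eq u v -> fg_eq v w -> fg_eq u w
| fg_cancel u x b v : fg_eq (u ++ (x, b) :: (x, ~~ b) :: v) (u ++ v).

Definition fg_rel (v w : fg_word) : bool := `[< fg_eq v w >].

Lemma fg_rel_equiv : equiv_class_of fg_rel.
Proof.
split=> [w|v w|v u w]; first exact/asboolP/fg_refl.
  by apply/asboolP/asboolP; exact: fg_sym.
by move=> /asboolP uv /asboolP vw; apply/asboolP/(fg_trans uv vw).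
Qed.
Canonical fg_equiv := EquivRelPack fg_rel_equiv.

Definition free_group : Type := {eq_quot fg_equiv}.
HB.instance Definition _ := Choice.on free_group.
HB.instance Definition _ := EqQuotient.on free_group.

Lemma fg_piP (v w : fg_word) :
  \pi_(free_group) v = \pi_(free_group) w <-> fg_eq v w.
Proof.
split; first by move=> /eqmodP /asboolP.
by move=> h; apply/eqmodP/asboolP.
Qed.

Lemma fg_surj (a : free_group) : exists w, a = \pi_(free_group) w.
Proof. by exists (repr a); rewrite reprK. Qed.

Lemma fg_reprP (w : fg_word) : fg_eq (repr (\pi_(free_group) w)) w.
Proof. by apply/fg_piP; rewrite reprK. Qed.

Lemma fg_eq_catl u v w : fg_eq v w -> fg_eq (u ++ v) (u ++ w).
Proof.
elim=> [?|? ? _|? ? ? _ h _|? ? ? ?]; rewrite ?catA; first exact: fg_refl.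
- exact: fg_sym.
- exact: fg_trans.
- exact: fg_cancel.
Qed.

Lemma fg_eq_catr u v w : fg_eq v w -> fg_eq (v ++ u) (w ++ u).
Proof.
elim=> [?|? ? _|? ? ? _ h _|? ? ? ?]; rewrite -?catA; first exact: fg_refl.
- exact: fg_sym.
- exact: fg_trans.
- exact: fg_cancel.
Qed.

Definition fg_flip (w : fg_word) : fg_word := rev [seq (p.1, ~~ p.2) | p <- w].

Lemma fg_eq_flip v w : fg_eq v w -> fg_eq (fg_flip v) (fg_flip w).
Proof.
elim=> [?|? ? _|? ? ? _ h _|u x b v']; first exact: fg_refl.
- exact: fg_sym.
- exact: fg_trans.
- rewrite /fg_flip !map_cat !rev_cat /= !rev_cons -!cats1 -!catA /= negbK.
  exact: fg_cancel.
Qed.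

Lemma fg_flipK (w : fg_word) : fg_eq (fg_flip w ++ w) [::].
Proof.
elim: w => [|[x b] w ih]; first exact: fg_refl.
rewrite /fg_flip /= rev_cons -cats1 -catA /=; apply: fg_trans ih.
by rewrite -{2}[b]negbK; exact: fg_cancel.
Qed.

Lemma fg_flip_flip (w : fg_word) : fg_flip (fg_flip w) = w.
Proof.
rewrite /fg_flip map_rev revK -map_comp -[RHS]map_id; apply: eq_map.
by case=> x b /=; rewrite negbK.
Qed.

Definition fg_one : free_group := \pi_(free_group) [::].
Definition fg_mul (a b : free_group) : free_group :=
  \pi_(free_group) (repr a ++ repr b).
Definition fg_inv (a : free_group) : free_group :=
  \pi_(free_group) (fg_flip (repr a)).

Lemma fg_mulE (v w : fg_word) :
  fg_mul (\pi_(free_group) v) (\pi_(free_group) w)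
  = \pi_(free_group) (v ++ w).
Proof.
apply/fg_piP; apply: fg_trans (fg_eq_catl _ (fg_reprP w)).
exact: fg_eq_catr (fg_reprP v).
Qed.

Lemma fg_invE (w : fg_word) :
  fg_inv (\pi_(free_group) w) = \pi_(free_group) (fg_flip w).
Proof. by apply/fg_piP/fg_eq_flip/fg_reprP. Qed.

Lemma fg_mulA : associative fg_mul.
Proof.
move=> a b c; have [u ->] := fg_surj a; have [v ->] := fg_surj b.
have [w ->] := fg_surj c.
by rewrite !fg_mulE catA.
Qed.

Lemma fg_mul1 : left_id fg_one fg_mul.
Proof. by move=> a; have [w ->] := fg_surj a; rewrite fg_mulE. Qed.

Lemma fg_mulr1 : right_id fg_one fg_mul.
Proof. by move=> a; have [w ->] := fg_surj a; rewrite fg_mulE cats0. Qed.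

Lemma fg_mulV : left_inverse fg_one fg_inv fg_mul.
Proof.
move=> a; have [w ->] := fg_surj a; rewrite fg_invE fg_mulE.
exact: (fg_piP _ _).2 (fg_flipK _).
Qed.

Lemma fg_mulrV : right_inverse fg_one fg_inv fg_mul.
Proof.
move=> a; have [w ->] := fg_surj a; rewrite fg_invE fg_mulE.
apply: (fg_piP _ _).2; rewrite -{1}[w]fg_flip_flip; exact: fg_flipK.
Qed.

HB.instance Definition _ :=
  isGroup.Build free_group fg_mulA fg_mul1 fg_mulr1 fg_mulV fg_mulrV.

Definition fg_gen (x : S) : free_group := \pi_(free_group) [:: (x, false)].

Section Lift.
Variables (H : groupType) (f : S -> H).
Local Open Scope group_scope.

Definition fg_eval (w : fg_word) : H :=
  \prod_(p <- w) (if p.2 then (f p.1)^-1 else f p.1).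

Definition fg_lift (a : free_group) : H := fg_eval (repr a).

Lemma fg_eval_eq v w : fg_eq v w -> fg_eval v = fg_eval w.
Proof.
elim=> [//|? ? _ -> //|? ? ? _ -> _ -> //|u x b v'].
rewrite /fg_eval !big_cat !big_cons /=; congr (_ * _).
by case: b; rewrite /= mulgA ?mulVg ?mulgV mul1g.
Qed.

Lemma fg_liftE w : fg_lift (\pi_(free_group) w) = fg_eval w.
Proof. exact: fg_eval_eq (fg_reprP _). Qed.

Lemma fg_lift_gen x : fg_lift (fg_gen x) = f x.
Proof. by rewrite fg_liftE /fg_eval big_seq1. Qed.

Lemma fg_liftM : {morph fg_lift : a b / a * b}.
Proof.
move=> a b; have [v ->] := fg_surj a; have [w ->] := fg_surj b.
by rewrite [_ * _]fg_mulE !fg_liftE /fg_eval big_cat.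
Qed.

End Lift.

Local Open Scope group_scope.

Lemma fg_ind (P : free_group -> Prop) : P 1 ->
  (forall x a, P a -> P (fg_gen x * a)) ->
  (forall x a, P a -> P ((fg_gen x)^-1 * a)) -> forall a, P a.
Proof.
move=> P1 Pg Pv a; have [u ->] := fg_surj a; elim: u => [//|[x b] w ih].
case: b.
  by have := Pv x _ ih; rewrite [_^-1]fg_invE [_ * _]fg_mulE.
by have := Pg x _ ih; rewrite [_ * _]fg_mulE.
Qed.

End FreeGroup.

Section QuotientGroup.
Variables (G : groupType) (N : G -> Prop).
Local Open Scope group_scope.

Inductive normal_closure : G -> Prop :=
| nc_base g : N g -> normal_closure g
| nc_one : normal_closure 1
| nc_mul g h : normal_closure g -> normal_closure h -> normal_closure (g * h)
| nc_inv g : normal_closure g -> normal_closure g^-1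
| nc_conj g h : normal_closure g -> normal_closure (g ^ h).

Definition qg_rel (g h : G) : bool := `[< normal_closure (g^-1 * h) >].

Lemma qg_rel_equiv : equiv_class_of qg_rel.
Proof.
split=> [g|g h|h g k]; first by apply/asboolP; rewrite mulVg; exact: nc_one.
  by apply/asboolP/asboolP => /nc_inv; rewrite invgM invgK.
move=> /asboolP gh /asboolP hk; apply/asboolP.
by have := nc_mul gh hk; rewrite mulgA mulgK.
Qed.
Canonical qg_equiv := EquivRelPack qg_rel_equiv.

Definition quot_group : Type := {eq_quot qg_equiv}.
HB.instance Definition _ := Choice.on quot_group.
HB.instance Definition _ := EqQuotient.on quot_group.

Definition qg_pi (g : G) : quot_group := \pi_quot_group g.

Lemma qg_piP g h : qg_pi g = qg_pi h <-> normal_closure (g^-1 * h).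
Proof.
split; first by move=> /eqmodP /asboolP.
by move=> e; apply/eqmodP/asboolP.
Qed.

Lemma qg_surj (a : quot_group) : exists g, a = qg_pi g.
Proof. by exists (repr a); rewrite /qg_pi reprK. Qed.

Lemma qg_reprP g : normal_closure ((repr (qg_pi g))^-1 * g).
Proof. by apply/qg_piP; rewrite /qg_pi reprK. Qed.

Definition qg_mul (a b : quot_group) : quot_group := qg_pi (repr a * repr b).
Definition qg_inv (a : quot_group) : quot_group := qg_pi (repr a)^-1.

Lemma qg_mulE g h : qg_mul (qg_pi g) (qg_pi h) = qg_pi (g * h).
Proof.
apply/qg_piP; have := nc_mul (qg_reprP h) (nc_conj h (qg_reprP g)).
by rewrite /conjg invgM !mulgA mulgK.
Qed.

Lemma qg_invE g : qg_inv (qg_pi g) = qg_pi g^-1.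
Proof.
apply/qg_piP; have := nc_conj (g^-1) (nc_inv (qg_reprP g)).
by rewrite /conjg !invgM !invgK !mulgA mulgV mul1g.
Qed.

Lemma qg_mulA : associative qg_mul.
Proof.
move=> a b c; have [u ->] := qg_surj a; have [v ->] := qg_surj b.
have [w ->] := qg_surj c.
by rewrite !qg_mulE mulgA.
Qed.

Lemma qg_mul1 : left_id (qg_pi 1) qg_mul.
Proof. by move=> a; have [w ->] := qg_surj a; rewrite qg_mulE mul1g. Qed.

Lemma qg_mulr1 : right_id (qg_pi 1) qg_mul.
Proof. by move=> a; have [w ->] := qg_surj a; rewrite qg_mulE mulg1. Qed.

Lemma qg_mulV : left_inverse (qg_pi 1) qg_inv qg_mul.
Proof. by move=> a; have [w ->] := qg_surj a; rewrite qg_invE qg_mulE mulVg. Qed.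

Lemma qg_mulrV : right_inverse (qg_pi 1) qg_inv qg_mul.
Proof. by move=> a; have [w ->] := qg_surj a; rewrite qg_invE qg_mulE mulgV. Qed.

HB.instance Definition _ :=
  isGroup.Build quot_group qg_mulA qg_mul1 qg_mulr1 qg_mulV qg_mulrV.

Lemma qg_piM : {morph qg_pi : g h / g * h}.
Proof. by move=> g h; rewrite [RHS]qg_mulE. Qed.

Lemma qg_pi1 : qg_pi 1 = 1.
Proof. by []. Qed.

Lemma qg_piV g : qg_pi g^-1 = (qg_pi g)^-1.
Proof. by rewrite [RHS]qg_invE. Qed.

Lemma qg_pi_base g : N g -> qg_pi g = 1.
Proof.
by move=> Ng; apply/esym/qg_piP; rewrite invg1 mul1g; exact: nc_base.
Qed.

End QuotientGroup.

Record sgroup : Type := SGroup {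
  sgrp : nat -> groupType;
  sgrp_face : forall n, 'I_n.+2 -> sgrp n.+1 -> sgrp n;
  sgrp_dgn : forall n, 'I_n.+1 -> sgrp n -> sgrp n.+1;
  sgrp_faceM : forall n i, {morph @sgrp_face n i : g h / (g * h)%g};
  sgrp_dgnM : forall n i, {morph @sgrp_dgn n i : g h / (g * h)%g};
  sgrp_ax : sset_axioms (SSetData sgrp_face sgrp_dgn) }.

Coercion sset_of_sgroup (G : sgroup) : sset := SSet (sgrp_ax G).

(* [iter_dgn mu x] is s_{mu(q-1)} ... s_{mu(0)} x. *)
Fixpoint iter_dgn (X : sset_data) (p q : nat) :
    ('I_q -> nat) -> X p -> X (q + p)%N :=
  match q with
  | 0 => fun _ x => x
  | q'.+1 => fun mu x =>
      dgn (mu ord_max) (iter_dgn (fun j => mu (widen_ord (leqnSn q') j)) x)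
  end.

(* A (p,q)-shuffle is encoded as the permutation
   (nu(1),...,nu(p),mu(1),...,mu(q)) of {0,...,p+q-1}. *)
Definition is_shuffle (p q : nat) (s : 'S_(p + q)) : bool :=
  [forall i : 'I_p, forall j : 'I_p,
     (i < j)%N ==> (s (lshift q i) < s (lshift q j))%N]
  && [forall i : 'I_q, forall j : 'I_q,
     (i < j)%N ==> (s (rshift p i) < s (rshift p j))%N].

Definition shuffle_mul_simplex (G : sgroup) (p q : nat)
    (g : sgrp G p) (h : sgrp G q) : chains G :=
  \sum_(s : 'S_(p + q) | is_shuffle s)
    let g' : sgrp G (q + p)%N :=
      iter_dgn (X := G) (fun j : 'I_q => s (rshift p j) : nat) g in
    let h' : sgrp G (p + q)%N :=
      iter_dgn (X := G) (fun i : 'I_p => s (lshift q i) : nat) h in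
    (-1) ^+ s *: chain (simp (X := G)
      (ecast n (sgrp G n) (addnC q p) g' * h')%g).

Definition shuffle_mul (G : sgroup) (a b : chains G) : chains G :=
  linext (fun g : nondeg G => linext (fun h : nondeg G =>
    shuffle_mul_simplex (tagged (val g)) (tagged (val h))) b) a.

Definition chains_one (G : sgroup) : chains G :=
  chain (simp (X := G) (1%g : sgrp G 0)).

Section LoopGroup.
Variable X : sset.
Local Open Scope group_scope.

(* The quotient of F(X_{n+1}) by F(s_0 X_n), i.e. by the normal subgroup
   which the latter generates. *)
Definition loop (n : nat) : groupType :=
  quot_group (fun g : free_group (X n.+1) =>
    exists y : X n, g = fg_gen (dgn 0 y)).

Definition tau (n : nat) (x : X n.+1) : loop n := qg_pi _ (fg_gen x).

Lemma tau_dgn0 (n : nat) (y : X n) : tau (dgn 0 y) = 1.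
Proof. by apply: qg_pi_base; exists y. Qed.

(* The homomorphism with value [f x] on [tau x]; it is only used when
   [f (dgn 0 y) = 1] for all [y]. *)
Definition loop_lift (n : nat) (H : groupType) (f : X n.+1 -> H)
  (a : loop n) : H := fg_lift f (repr a).

Lemma morph1 (G H : groupType) (f : G -> H) :
  {morph f : x y / x * y} -> f 1 = 1.
Proof. by move=> fM; apply: (mulgI (f 1)); rewrite -fM !mulg1. Qed.

Lemma morphV (G H : groupType) (f : G -> H) :
  {morph f : x y / x * y} -> {morph f : x / x^-1}.
Proof.
move=> fM x; apply: (mulgI (f x)).
by rewrite -fM !mulgV morph1.
Qed.

Section LoopLift.
Variables (n : nat) (H : groupType) (f : X n.+1 -> H).
Hypothesis f1 : forall y : X n, f (dgn 0 y) = 1.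

Lemma loop_lift_pi g : loop_lift f (qg_pi _ g) = fg_lift f g.
Proof.
have fM := fg_liftM f.
have kill h : normal_closure (fun g : free_group (X n.+1) =>
    exists y : X n, g = fg_gen (dgn 0 y)) h -> fg_lift f h = 1.
  elim=> [_ [y ->]||? ? _ e _ e'|? _ e|? ? _ e].
  - by rewrite fg_lift_gen f1.
  - exact: morph1.
  - by rewrite fM e e' mulg1.
  - by rewrite morphV // e invg1.
  - by rewrite /conjg !fM morphV // e mul1g mulVg.
have := kill _ (qg_reprP _ g); rewrite fM morphV // => e.
by apply: (mulgI (loop_lift f (qg_pi _ g))^-1); rewrite mulVg; exact/esym.
Qed.

Lemma loop_lift_tau x : loop_lift f (tau x) = f x.
Proof. by rewrite loop_lift_pi fg_lift_gen. Qed.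

Lemma loop_liftM : {morph loop_lift f : a b / a * b}.
Proof.
move=> a b; have [u ->] := qg_surj a; have [v ->] := qg_surj b.
by rewrite -qg_piM !loop_lift_pi fg_liftM.
Qed.

End LoopLift.

Lemma loop_morph_eq (n : nat) (H : groupType) (f g : loop n -> H) :
  {morph f : a b / a * b} -> {morph g : a b / a * b} ->
  (forall x, f (tau x) = g (tau x)) -> f =1 g.
Proof.
move=> fM gM e a; have [u ->] := qg_surj a.
elim/fg_ind: u => [|x b ih|x b ih].
- by rewrite !qg_pi1 !morph1.
- by rewrite qg_piM fM gM ih -/(tau x) e.
- by rewrite qg_piM qg_piV fM gM ih -/(tau x) !morphV // e.
Qed.

Definition loop_face_gen (n : nat) (i : 'I_n.+2) (x : X n.+2) : loop n :=
  if (i : nat) == 0%N then (tau (face 0 x))^-1 * tau (face 1 x)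
  else tau (face i.+1 x).

Definition loop_dgn_gen (n : nat) (i : 'I_n.+1) (x : X n.+1) : loop n.+1 :=
  tau (dgn i.+1 x).

Definition loop_face (n : nat) (i : 'I_n.+2) : loop n.+1 -> loop n :=
  loop_lift (loop_face_gen i).

Definition loop_dgn (n : nat) (i : 'I_n.+1) : loop n -> loop n.+1 :=
  loop_lift (loop_dgn_gen i).

Let ax := sset_ax X.

Lemma loop_face_gen1 n (i : 'I_n.+2) (y : X n.+1) :
  loop_face_gen i (dgn 0 y) = 1.
Proof.
rewrite /loop_face_gen; case: eqP => [_|/eqP i0].
  by rewrite (face_dgn_eq ax) // (face_dgn_eqS ax) // mulVg.
rewrite (face_dgn_gt ax) ?tau_dgn0 // lt0n i0 /=.
by have := ltn_ord i.
Qed.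

Lemma loop_dgn_gen1 n (i : 'I_n.+1) (y : X n) :
  loop_dgn_gen i (dgn 0 y) = 1.
Proof.
rewrite /loop_dgn_gen -(dgn_dgn ax) ?tau_dgn0 //=.
by have := ltn_ord i.
Qed.

Lemma loop_face_tau n (i : 'I_n.+2) x :
  loop_face i (tau x) = loop_face_gen i x.
Proof. exact/loop_lift_tau/loop_face_gen1. Qed.

Lemma loop_dgn_tau n (i : 'I_n.+1) x : loop_dgn i (tau x) = tau (dgn i.+1 x).
Proof. exact/loop_lift_tau/loop_dgn_gen1. Qed.

Lemma loop_faceM n (i : 'I_n.+2) : {morph loop_face i : a b / a * b}.
Proof. exact/loop_liftM/loop_face_gen1. Qed.

Lemma loop_dgnM n (i : 'I_n.+1) : {morph loop_dgn i : a b / a * b}.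
Proof. exact/loop_liftM/loop_dgn_gen1. Qed.

Definition loop_data : sset_data := SSetData loop_face loop_dgn.

Local Notation lface := (@face loop_data _).
Local Notation ldgn := (@dgn loop_data _).

Lemma lface0 n (x : X n.+2) :
  lface 0 (tau x) = (tau (face 0 x))^-1 * tau (face 1 x).
Proof. by rewrite /face /= loop_face_tau /loop_face_gen inordK. Qed.

Lemma lfaceS n i (x : X n.+2) : (i <= n)%N ->
  lface i.+1 (tau x) = tau (face i.+2 x).
Proof.
by move=> le; rewrite {1}/face /= loop_face_tau /loop_face_gen inordK.
Qed.

Lemma ldgnE n i (x : X n.+1) : (i <= n)%N ->
  ldgn i (tau x) = tau (dgn i.+1 x).
Proof. by move=> le; rewrite {1}/dgn /= loop_dgn_tau inordK. Qed.

Lemma lfaceM n i : {morph (lface i : loop n.+1 -> loop n) : a b / a * b}.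
Proof. exact: loop_faceM. Qed.

Lemma ldgnM n i : {morph (ldgn i : loop n -> loop n.+1) : a b / a * b}.
Proof. exact: loop_dgnM. Qed.

Let lfaceV n i : {morph (lface i : loop n.+1 -> loop n) : a / a^-1}.
Proof. exact/morphV/lfaceM. Qed.

Let ldgnV n i : {morph (ldgn i : loop n -> loop n.+1) : a / a^-1}.
Proof. exact/morphV/ldgnM. Qed.

Lemma loop_axioms : sset_axioms loop_data.
Proof.
split.
- move=> n i j x /andP[ij jn]; move: x.
  apply: (@loop_morph_eq _ (loop n)) => [a b|a b|x]; rewrite ?lfaceM //.
  case: i ij => [_|i]; last first.
    case: j jn => [//|j] jn ij; have iN : (i <= n)%N by exact: leq_trans ij jn.
    rewrite !lfaceS //; last exact: leqW.
    by rewrite (@face_face _ ax _ i.+2 j.+2) //; apply/andP.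
  rewrite lfaceS // !lface0 lfaceM lfaceV; case: j jn => [|j] jn.
    rewrite !lface0 invgM invgK (@face_face _ ax _ 0 1) //.
    rewrite (@face_face _ ax _ 1 1) // (@face_face _ ax _ 0 0) //.
    by rewrite -mulgA mulVKg.
  rewrite !lfaceS // (@face_face _ ax _ 0 j.+2) //.
  by rewrite (@face_face _ ax _ 1 j.+2).
- move=> n i j x /andP[ij jn]; move: x.
  apply: (@loop_morph_eq _ (loop n.+2)) => [a b|a b|x]; rewrite ?ldgnM //.
  have iN : (i <= n)%N by exact: leq_trans ij jn.
  rewrite !ldgnE //; last exact: leqW.
  by rewrite (@dgn_dgn _ ax _ i.+1 j.+1) //; apply/andP.
- move=> n i j x /andP[ij jn]; move: x.
  apply: (@loop_morph_eq _ (loop n.+1)) => [a b|a b|x];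
    rewrite ?(lfaceM, ldgnM) //.
  case: i ij => [_|i ij].
    rewrite ldgnE // !lface0 ldgnM ldgnV !ldgnE //.
    rewrite (@face_dgn_lt _ ax _ 0 j.+1) //.
    by rewrite (@face_dgn_lt _ ax _ 1 j.+1).
  have iN : (i <= n)%N by apply: ltnW; exact: leq_trans ij jn.
  rewrite ldgnE // lfaceS; last exact: leqW.
  rewrite lfaceS // ldgnE //.
  by rewrite (@face_dgn_lt _ ax _ i.+2 j.+1) //; apply/andP.
- move=> n j x jn; move: x.
  apply: (@loop_morph_eq _ (loop n)) => [a b|a b|x];
    rewrite ?(lfaceM, ldgnM) // ldgnE //.
  case: j jn => [|j] jn.
    rewrite lface0 (@face_dgn_eq _ ax _ 1) // (@face_dgn_lt _ ax _ 0 0) //.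
    by rewrite tau_dgn0 invg1 mul1g.
  by rewrite lfaceS 1?ltnW // (face_dgn_eq ax).
- move=> n j x jn; move: x.
  apply: (@loop_morph_eq _ (loop n)) => [a b|a b|x];
    rewrite ?(lfaceM, ldgnM) // ldgnE //.
  by rewrite lfaceS // (face_dgn_eqS ax).
- move=> n i j x /andP[ji iN]; move: x.
  apply: (@loop_morph_eq _ (loop n.+1)) => [a b|a b|x];
    rewrite ?(lfaceM, ldgnM) //.
  case: i ji iN => [//|i] ji iN.
  have jN : (j <= n)%N by exact: leq_trans ji iN.
  rewrite ldgnE; last exact: leqW.
  rewrite !lfaceS // ldgnE //.
  by rewrite (@face_dgn_gt _ ax _ i.+2 j.+1) //; apply/andP.
Qed.

Definition loop_group : sgroup :=
  @SGroup loop loop_face loop_dgn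
    loop_faceM loop_dgnM loop_axioms.

End LoopGroup.

Section LoopMap.
Variables (X Y : sset) (f : sset_map X Y).
Local Open Scope group_scope.

Definition loop_map_fun (n : nat) : loop X n -> loop Y n :=
  loop_lift (fun x : X n.+1 => tau (f n.+1 x)).

Lemma loop_map_gen1 n (y : X n) : tau (f n.+1 (dgn 0 y)) = 1.
Proof. by rewrite /dgn smap_dgn tau_dgn0. Qed.

Lemma loop_map_tau n (x : X n.+1) : loop_map_fun (tau x) = tau (f n.+1 x).
Proof. exact: loop_lift_tau (@loop_map_gen1 n) x. Qed.

Lemma loop_mapM n : {morph @loop_map_fun n : a b / a * b}.
Proof. exact: loop_liftM (@loop_map_gen1 n). Qed.

Lemma loop_map_face n (i : 'I_n.+2) (a : loop_group X n.+1) :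
  loop_map_fun (sset_face i a) = @sset_face (loop_group Y) n i (loop_map_fun a).
Proof.
move: a; apply: (@loop_morph_eq _ _ (loop Y n)) => [a b|a b|x].
- by rewrite /= loop_faceM loop_mapM.
- by rewrite /= loop_mapM loop_faceM.
rewrite /= loop_face_tau loop_map_tau loop_face_tau /loop_face_gen.
case: eqP => _; last by rewrite loop_map_tau /face smap_face.
rewrite loop_mapM (morphV (@loop_mapM n)) !loop_map_tau.
by rewrite /face !smap_face.
Qed.

Lemma loop_map_dgn n (i : 'I_n.+1) (a : loop_group X n) :
  loop_map_fun (sset_dgn i a) = @sset_dgn (loop_group Y) n i (loop_map_fun a).
Proof.
move: a; apply: (@loop_morph_eq _ _ (loop Y n.+1)) => [a b|a b|x].
- by rewrite /= loop_dgnM loop_mapM.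
- by rewrite /= loop_mapM loop_dgnM.
by rewrite /= loop_dgn_tau !loop_map_tau loop_dgn_tau /dgn smap_dgn.
Qed.

Definition loop_map : sset_map (loop_group X) (loop_group Y) :=
  @SSetMap (loop_group X) (loop_group Y) loop_map_fun
    loop_map_face loop_map_dgn.

End LoopMap.

(* Main.v *)
(* The map psi : C(GX) -> Omega CX is multiplicative for the Alexander-Whitney
   splitting, psi(gh) = sum_i psi(g_(0,...,i)) psi(h_(i,...,n)), and on
   generators it is determined by recursion from
     sum_i psi(tau x_(0,...,i+1)) s^{-1}x_(0,i+1,...,n+1) = 0  (x in X_{n+1}, n > 0),
   where s^{-1}y stands for 1 if dim y = 1.  A function on GX with prescribed
   increments along g -> tau x * g exists because the Cayley graph of a free group
   is a tree.

   Let K = ker psi, and let h be a natural contraction of K in degrees < n with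
   psi h = 0.  The Eilenberg-Mac Lane homotopy, corrected by h, gives a cochain l
   on GX x GX whose increments l(tau x, y) - l(1, y) integrate to an operator M
   with psi M = 0.  For F_p spanned by the chains [y] - [tau x * y] with x in the
   p-skeleton, Q = 1 - dM - Md maps K_n into itself and lowers the filtration there;
   hence Q^n = 0 on K_n, and N = sum_{i<n} M Q^i yields h = N (1 - hd) in degree n.

   Any additive section of psi becomes a chain map after composition with
   1 - dh - hd, and phi is obtained by correcting it on the generators s^{-1}x, by
   induction on dim x.  Finally Phi = h phi psi - h. *)

From HB Require Import structures.
Require Import Defs.
From mathcomp Require Import all_boot all_order all_algebra perm.
From mathcomp Require Import boolp finmap monalg.
From mathcomp Require Import zify.

Set Implicit Arguments.
Unset Strict Implicit.
Unset Printing Implicit Defensive.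

Import GRing.Theory.
Local Open Scope ring_scope.

(** Why Q lowers the filtration: below degree n, E = 1 - dh - hd vanishes on K and hence factors
    through psi. For x in the (p+1)-skeleton, Q([y] - [tau x * y]) is, up to sign, the sum of the
    products [tau x_(0,...,i+1)] E[y_(i,...,n)] with i > 0, plus two differences of values of l
    caused by the twisted face d_0 tau x = (tau d_0 x)^{-1} tau d_1 x. These differences lie in F_p,
    because d_0 moves x into the p-skeleton unless tau x = 1. Modulo F_p only the products with i =
    p remain; since psi(tau w) is - s^{-1}w plus words that begin with a generator of smaller
    dimension, they can be read off psi([y] - [tau x * y]). So modulo F_p, Q factors through psi on
    F_{p+1} and is 0 on K. As X is 1-reduced, F_1 = 0. Naturality requires that no choice be made:
    everything is given by formulas or recursions, and the section of psi in use is 1 - dh - hd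
    factored through psi, which is unique as psi is surjective. Simplicial identities are handled
    through the decalage: without d_0 and s_0, a formula becomes the same formula one degree
    lower. *)

(** * Deciding equations in abelian groups by reflection *)

Inductive zmod_exp :=
  ZmodZero | ZmodVar of nat | ZmodOpp of zmod_exp | ZmodAdd of zmod_exp & zmod_exp.

Fixpoint zmod_eval (V : zmodType) (env : seq V) (e : zmod_exp) : V :=
  match e with
  | ZmodZero => 0
  | ZmodVar n => env`_n
  | ZmodOpp e => - zmod_eval env e
  | ZmodAdd e f => zmod_eval env e + zmod_eval env f
  end.

Fixpoint zmod_coef (e : zmod_exp) (i : nat) : int :=
  match e with
  | ZmodZero => 0
  | ZmodVar n => if n == i then 1 else 0
  | ZmodOpp e => - zmod_coef e i
  | ZmodAdd e f => zmod_coef e i + zmod_coef f i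
  end.

Lemma zmod_evalE (V : zmodType) (env : seq V) e :
  zmod_eval env e = \sum_(i < size env) env`_i *~ zmod_coef e i.
Proof.
elim: e => [|n|e ih|e ihe f ihf] /=.
- by rewrite big1 // => i _; rewrite mulr0z.
- case: (ltnP n (size env)) => ns.
    rewrite (bigD1 (Ordinal ns)) //= eqxx mulr1z big1 ?addr0 // => i ne.
    by case: eqP => // e; rewrite -(val_eqE i) /= e eqxx in ne.
  rewrite nth_default // big1 // => i _; case: eqP => // e.
  by move: ns; rewrite e leqNgt ltn_ord.
- by rewrite ih -sumrN; apply: eq_bigr => i _; rewrite mulrNz.
- by rewrite ihe ihf -big_split; apply: eq_bigr => i _; rewrite mulrzDr.
Qed.

Lemma zmod_decide (V : zmodType) (env : seq V) e f :
  all (fun i => zmod_coef e i == zmod_coef f i) (iota 0 (size env)) ->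
  zmod_eval env e = zmod_eval env f.
Proof.
move=> /allP h; rewrite !zmod_evalE; apply: eq_bigr => i _.
by have /eqP -> : zmod_coef e i == zmod_coef f i by apply: h; rewrite mem_iota ltn_ord.
Qed.

Ltac zmod_find x l :=
  lazymatch l with
  | ?a :: ?l' =>
      match constr:((x, a)) with
      | (?z, ?z) => constr:(0%N)
      | _ => let n := zmod_find x l' in constr:(n.+1)
      end
  end.

Ltac zmod_atoms t l :=
  lazymatch t with
  | (?a + ?b)%R => let l' := zmod_atoms a l in zmod_atoms b l'
  | (- ?a)%R => zmod_atoms a l
  | 0%R => l
  | ?a =>
      match l with
      | _ => let n := zmod_find a l in l
      | _ => constr:(a :: l)
      end
  end.

Ltac zmod_reify t l :=
  lazymatch t with
  | (?a + ?b)%R =>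
      let x := zmod_reify a l in let y := zmod_reify b l in constr:(ZmodAdd x y)
  | (- ?a)%R => let x := zmod_reify a l in constr:(ZmodOpp x)
  | 0%R => constr:(ZmodZero)
  | ?a => let n := zmod_find a l in constr:(ZmodVar n)
  end.

(* Decides equations that hold in every abelian group. *)
Ltac abel :=
  lazymatch goal with
  | |- @eq ?V ?s ?t =>
      let l0 := constr:(@nil V) in
      let l1 := zmod_atoms s l0 in
      let l := zmod_atoms t l1 in
      let e := zmod_reify s l in
      let f := zmod_reify t l in
      exact: (@zmod_decide _ l e f isT)
  end.

(** * Signs, decalage and shuffles *)

(** Available in every abelian group, so that one calculus of signs serves chains, the cobar ring
    and auxiliary groups without scalar multiplication. *)
Definition sgn (V : zmodType) (n : nat) (v : V) : V := if odd n then - v else v.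

Section Sgn.
Variable V : zmodType.
Implicit Types v w : V.

Lemma sgnS n v : sgn n.+1 v = - sgn n v.
Proof. by rewrite /sgn /=; case: odd; rewrite /= ?opprK. Qed.

Lemma sgnN n v : sgn n (- v) = - sgn n v.
Proof. by rewrite /sgn; case: odd. Qed.

Lemma sgn0 n : sgn n 0 = 0 :> V.
Proof. by rewrite /sgn; case: odd; rewrite ?oppr0. Qed.

Lemma sgnK n : involutive (@sgn V n).
Proof. by move=> v; rewrite /sgn; case: odd; rewrite ?opprK. Qed.

Lemma sgnD n v w : sgn n (v + w) = sgn n v + sgn n w.
Proof. by rewrite /sgn; case: odd; rewrite ?opprD. Qed.

Lemma sgnB n v w : sgn n (v - w) = sgn n v - sgn n w.
Proof. by rewrite sgnD sgnN. Qed.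

Lemma sgn_add m n v : sgn (m + n) v = sgn m (sgn n v).
Proof. by rewrite /sgn oddD; case: odd; case: odd; rewrite /= ?opprK. Qed.

Lemma sgnC m n v : sgn m (sgn n v) = sgn n (sgn m v).
Proof. by rewrite -!sgn_add addnC. Qed.

Lemma sgn_sum n (I : Type) (r : seq I) (P : pred I) (f : I -> V) :
  sgn n (\sum_(i <- r | P i) f i) = \sum_(i <- r | P i) sgn n (f i).
Proof. by rewrite /sgn; case: odd; rewrite // sumrN. Qed.

End Sgn.

Lemma raddf_sgn (V W : zmodType) (f : {additive V -> W}) n v :
  f (sgn n v) = sgn n (f v).
Proof. by rewrite /sgn; case: odd; rewrite ?raddfN. Qed.

(* the decalage of U *)
Definition Dec (U : sset_data) : sset_data :=
  @SSetData (fun n => U n.+1)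
    (fun n i x => sset_face (lift ord0 i) x)
    (fun n i x => sset_dgn (lift ord0 i) x).

Lemma lift0_max n : lift ord0 (@ord_max n) = ord_max.
Proof. exact: val_inj. Qed.

Section SimplicialIdentities.
Variables (U : sset_data) (ax : sset_axioms U).

Lemma faceE n (i : 'I_n.+2) (x : U n.+1) : face i x = sset_face i x.
Proof. by rewrite /face inord_val. Qed.

Lemma dgnE n (i : 'I_n.+1) (x : U n) : dgn i x = sset_dgn i x.
Proof. by rewrite /dgn inord_val. Qed.

Lemma face0_face n (i : 'I_n.+2) (x : U n.+2) :
  sset_face ord0 (sset_face (lift ord0 i) x) = sset_face i (sset_face ord0 x).
Proof.
have := face_face ax (i := 0) (j := i) x; rewrite leq0n /= -ltnS ltn_ord.
by move=> /(_ isT); rewrite -(faceE (lift ord0 i)) -!(faceE ord0) -faceE lift0 /=.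
Qed.

Lemma face0_dgn0 n (x : U n) : sset_face ord0 (sset_dgn ord0 x) = x.
Proof. by rewrite -dgnE -faceE (face_dgn_eq ax). Qed.

Lemma face1_dgn0 n (x : U n) :
  sset_face (lift ord0 ord0) (sset_dgn ord0 x) = x.
Proof. by rewrite -dgnE -faceE (face_dgn_eqS ax). Qed.

Lemma face0_dgn n (i : 'I_n.+1) (x : U n.+1) :
  sset_face ord0 (sset_dgn (lift ord0 i) x) = sset_dgn i (sset_face ord0 x).
Proof.
rewrite -dgnE -faceE lift0 (face_dgn_lt ax) -?faceE -?dgnE //=.
by rewrite -ltnS ltn_ord.
Qed.

Lemma face_dgn0 n (i : 'I_n.+1) (x : U n.+1) :
  sset_face (lift ord0 (lift ord0 i)) (sset_dgn ord0 x)
  = sset_dgn ord0 (sset_face (lift ord0 i) x).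
Proof.
rewrite -dgnE -faceE !lift0 (face_dgn_gt ax) //=.
by rewrite -[sset_face _ x]faceE -dgnE lift0.
Qed.

Lemma dgn_dgn0 n (i : 'I_n.+1) (x : U n) :
  sset_dgn (lift ord0 i) (sset_dgn ord0 x) = sset_dgn ord0 (sset_dgn i x).
Proof.
rewrite -!dgnE lift0 -(dgn_dgn ax) //=.
by rewrite -ltnS ltn_ord.
Qed.

Lemma Dec_face n i (x : U n.+2) : (i <= n.+1)%N ->
  face (X := Dec U) i x = face i.+1 x.
Proof.
move=> le; rewrite /face /=; congr sset_face; apply: val_inj.
by rewrite /= /bump /= add1n !inordK.
Qed.

Lemma Dec_dgn n i (x : U n.+1) : (i <= n)%N ->
  dgn (X := Dec U) i x = dgn i.+1 x.
Proof.
move=> le; rewrite /dgn /=; congr sset_dgn; apply: val_inj.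
by rewrite /= /bump /= add1n !inordK.
Qed.

Lemma Dec_axioms : sset_axioms (Dec U).
Proof.
split=> n i.
- move=> j x /andP[ij jn]; rewrite !Dec_face; try lia.
  by rewrite (face_face ax (i := i.+1) (j := j.+1)) //; lia.
- move=> j x /andP[ij jn]; rewrite !Dec_dgn; try lia.
  by rewrite (dgn_dgn ax (i := i.+1) (j := j.+1)) //; lia.
- move=> j x /andP[ij jn]; rewrite Dec_dgn; last lia.
  rewrite Dec_face; last lia.
  rewrite [RHS]Dec_dgn ?Dec_face; try lia.
  by rewrite (face_dgn_lt ax (i := i.+1) (j := j.+1)) //; lia.
- move=> x ni; rewrite Dec_dgn // Dec_face; last lia.
  exact: (face_dgn_eq ax).
- move=> x ni; rewrite Dec_dgn // Dec_face; last lia.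
  exact: (face_dgn_eqS ax).
- move=> j x /andP[ij jn]; rewrite Dec_dgn; last lia.
  rewrite Dec_face; last lia.
  rewrite [RHS]Dec_dgn ?Dec_face; try lia.
  by rewrite (face_dgn_gt ax (i := i.+1) (j := j.+1)) //; lia.
Qed.

Lemma face_max_dgn0 n (x : U n.+1) :
  sset_face ord_max (sset_dgn ord0 x) = sset_dgn ord0 (sset_face ord_max x).
Proof. by rewrite -!lift0_max face_dgn0. Qed.

End SimplicialIdentities.

Fixpoint vertex0 (U : sset_data) (n : nat) : U n -> U 0 :=
  match n with
  | 0 => fun x => x
  | m.+1 => fun x => vertex0 (sset_face ord_max x)
  end.

(** The vertex of x in [Dec U] is the edge x_(0,1) of U, and d_1 reduces it to x_(0). *)
Lemma vertex0_dec (U : sset_data) n (x : U n.+1) :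
  vertex0 x = sset_face (lift ord0 ord0) (vertex0 (x : Dec U n)).
Proof.
elim: n x => [|n ih] x /=; first by rewrite -lift0_max; congr sset_face; apply: val_inj.
by rewrite -ih /= lift0_max.
Qed.

Lemma vertex0_face (U : sset_data) (ax : sset_axioms U) n k (x : U n.+1) :
  (0 < k <= n.+1)%N -> vertex0 (face k x) = vertex0 x.
Proof.
have fmax m (y : U m.+1) : sset_face ord_max y = face m.+1 y.
  by rewrite /face; congr sset_face; apply: val_inj; rewrite /= inordK.
have vE m (y : U m.+1) : vertex0 y = vertex0 (face m.+1 y) by rewrite /= fmax.
elim: n k x => [|n ih] k x kn.
  by have -> : k = 1%N by [lia]; rewrite [RHS]vE.
have [->|/eqP ne] := eqVneq k n.+2; first by rewrite [RHS]vE.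
have {ne} kn' : (k <= n.+1)%N by lia.
rewrite (vE _ (face k x)) (vE _ x) -(ih k (face n.+2 x)); last by lia.
by rewrite (face_face ax (i := k) (j := n.+1)) //; lia.
Qed.

Lemma vertex0_dec_dgn (U : sset_data) (ax : sset_axioms U) n (i : 'I_n.+1) (x : U n.+1) :
  vertex0 (sset_dgn (lift ord0 i) x) = vertex0 x.
Proof.
rewrite -(@vertex0_face U ax _ i.+2) //; last by have := ltn_ord i; lia.
rewrite -(dgnE (lift ord0 i)) lift0 (face_dgn_eqS ax) //.
Qed.

(** The Eilenberg-Zilber maps are treated in transposed form, acting on functions of simplices with
    values in any abelian group A. [sh], [AW] and [EZh] are the transposes of the shuffle map, the
    Alexander-Whitney map and the homotopy; a tautological F with values in chains returns the usual
    maps. *)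
Definition cochain2 (U V : sset_data) (A : Type) := forall n, U n -> V n -> A.
Definition bicochain (U V : sset_data) (A : Type) := forall p q, U p -> V q -> A.

Definition Dec2 (U V : sset_data) (A : Type) (F : cochain2 U V A) :
  cochain2 (Dec U) (Dec V) A := fun n => F n.+1.

Definition cobd2 (U V : sset_data) (A : zmodType) (F : cochain2 U V A) :
  cochain2 U V A := fun n =>
  match n with
  | 0 => fun _ _ => 0
  | m.+1 => fun u v => \sum_(i < m.+2) sgn i (F m (sset_face i u) (sset_face i v))
  end.

Definition cobdl (U V : sset_data) (A : zmodType) (K : bicochain U V A) :
  bicochain U V A := fun p q =>
  match p with
  | 0 => fun _ _ => 0
  | p'.+1 => fun u v => \sum_(i < p'.+2) sgn i (K p' q (sset_face i u) v)
  end.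

Definition cobdr (U V : sset_data) (A : zmodType) (K : bicochain U V A) :
  bicochain U V A := fun p q =>
  match q with
  | 0 => fun _ _ => 0
  | q'.+1 => fun u v => \sum_(i < q'.+2) sgn i (K p q' u (sset_face i v))
  end.

Definition bicobd (U V : sset_data) (A : zmodType) (K : bicochain U V A) :
  bicochain U V A := fun p q u v => cobdl K u v + sgn p (cobdr K u v).

(* sum over the (p,q)-shuffles, that is over the lattice paths from (0,0) to
   (p,q), according to the first step of the path *)
Fixpoint sh (A : zmodType) (p : nat) :
  forall q (U V : sset_data), cochain2 U V A -> U p -> V q -> A :=
  match p with
  | 0 => fix sh0 (q : nat) (U V : sset_data) {struct q} :
           cochain2 U V A -> U 0 -> V q -> A :=
      match q with
      | 0 => fun F u v => F 0%N u v
      | q'.+1 => fun F u v => sh0 q' (Dec U) (Dec V) (Dec2 F) (sset_dgn ord0 u) v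
      end
  | p'.+1 => fix shp (q : nat) (U V : sset_data) {struct q} :
           cochain2 U V A -> U p'.+1 -> V q -> A :=
      match q with
      | 0 => fun F u v => @sh A p' 0%N (Dec U) (Dec V) (Dec2 F) u (sset_dgn ord0 v)
      | q'.+1 => fun F u v =>
          @sh A p' q'.+1 (Dec U) (Dec V) (Dec2 F) u (sset_dgn ord0 v)
          - sgn p' (shp q' (Dec U) (Dec V) (Dec2 F) (sset_dgn ord0 u) v)
      end
  end.

Arguments sh {A p q U V} F u v.

Section ShE.
Variables (A : zmodType) (U V : sset_data) (F : cochain2 U V A).

Lemma sh00 (u : U 0) (v : V 0) : sh F u v = @F 0%N u v. Proof. by []. Qed.

Lemma sh0S q (u : U 0) (v : V q.+1) :
  sh F u v = sh (Dec2 F) (sset_dgn ord0 u : Dec U 0) (v : Dec V q).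
Proof. by []. Qed.

Lemma shS0 p (u : U p.+1) (v : V 0) :
  sh F u v = sh (Dec2 F) (u : Dec U p) (sset_dgn ord0 v : Dec V 0).
Proof. by []. Qed.

(** If the first step goes in the second direction, mu(1) = 0 has to pass the p + 1 entries of nu;
    hence the sign -(-1)^p. *)
Lemma shSS p q (u : U p.+1) (v : V q.+1) :
  sh F u v = sh (Dec2 F) (u : Dec U p) (sset_dgn ord0 v : Dec V q.+1)
    - sgn p (sh (Dec2 F) (sset_dgn ord0 u : Dec U p.+1) (v : Dec V q)).
Proof. by []. Qed.

End ShE.

(** The recursion of [sh] replaces both simplicial sets by their decalages, so P has to quantify
    over them. *)
Lemma sh_ind (P : forall p q, sset_data -> sset_data -> Prop) :
  (forall U V, P 0%N 0%N U V) ->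
  (forall q U V, P 0%N q (Dec U) (Dec V) -> P 0%N q.+1 U V) ->
  (forall p U V, P p 0%N (Dec U) (Dec V) -> P p.+1 0%N U V) ->
  (forall p q U V, P p q.+1 (Dec U) (Dec V) -> P p.+1 q (Dec U) (Dec V) ->
     P p.+1 q.+1 U V) ->
  forall p q U V, P p q U V.
Proof.
move=> h00 h0S hS0 hSS; elim=> [|p ihp].
  by elim=> [|q ihq] U V; [exact: h00 | apply: h0S].
by elim=> [|q ihq] U V; [apply: hS0 | apply: hSS].
Qed.

Section ShBasic.
Variable A : zmodType.

Lemma sh_ext p q (U V : sset_data) (F G : cochain2 U V A) (u : U p) (v : V q) :
  (forall n u v, n = (p + q)%N -> F n u v = G n u v) -> sh F u v = sh G u v.
Proof.
move: p q U V F G u v; apply: sh_ind => [U V|q U V ih|p U V ih|p q U V ih1 ih2] F G u v e.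
- exact: e.
- by rewrite !sh0S; apply: ih => n *; apply: e; lia.
- by rewrite !shS0; apply: ih => n *; apply: e; lia.
rewrite !shSS; congr (_ - sgn p _); [apply: ih1|apply: ih2] => n *; apply: e; lia.
Qed.

Lemma shD p q (U V : sset_data) (F G : cochain2 U V A) (u : U p) (v : V q) :
  sh (fun n u v => F n u v + G n u v) u v = sh F u v + sh G u v.
Proof.
move: p q U V F G u v; apply: sh_ind => [U V|q U V ih|p U V ih|p q U V ih1 ih2] F G u v.
- by [].
- exact: ih.
- exact: ih.
by rewrite !shSS (ih1 (Dec2 F) (Dec2 G)) (ih2 (Dec2 F) (Dec2 G)) sgnD; abel.
Qed.

Lemma sh0 p q (U V : sset_data) (u : U p) (v : V q) :
  sh (fun n (_ : U n) (_ : V n) => 0 : A) u v = 0.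
Proof.
move: p q U V u v; apply: sh_ind => [U V|q U V ih|p U V ih|p q U V ih1 ih2] u v //; try exact: ih.
by rewrite shSS [X in X - _]ih1 [X in sgn p X]ih2 sgn0 subr0.
Qed.

Lemma shN p q (U V : sset_data) (F : cochain2 U V A) (u : U p) (v : V q) :
  sh (fun n u v => - F n u v) u v = - sh F u v.
Proof.
move: p q U V F u v; apply: sh_ind => [U V|q U V ih|p U V ih|p q U V ih1 ih2] F u v //.
- exact: ih.
- exact: ih.
by rewrite !shSS (ih1 (Dec2 F)) (ih2 (Dec2 F)) sgnN; abel.
Qed.

Lemma sh_sgn k p q (U V : sset_data) (F : cochain2 U V A) (u : U p) (v : V q) :
  sh (fun n u v => sgn k (F n u v)) u v = sgn k (sh F u v).
Proof. by rewrite /sgn; case: odd; [exact: shN|]. Qed.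

(** Shuffles use degeneracies only, so f and g need not commute with faces; this admits the map
    [act] below, which does not commute with d_0. *)
Lemma sh_nat p q (U V U' V' : sset_data) (f : forall n, U n -> U' n)
    (g : forall n, V n -> V' n) (F : cochain2 U' V' A) (u : U p) (v : V q) :
  (forall n i (x : U n), f _ (sset_dgn i x) = sset_dgn i (f _ x)) ->
  (forall n i (x : V n), g _ (sset_dgn i x) = sset_dgn i (g _ x)) ->
  sh (fun n u v => F n (f n u) (g n v)) u v = sh F (f p u) (g q v).
Proof.
move: p q U V U' V' f g F u v; apply: sh_ind => [U V|q U V ih|p U V ih|p q U V ih1 ih2] U' V' f g F u v ef eg.
- by [].
- rewrite !sh0S -ef; apply: (ih (Dec U') (Dec V') (fun n => f n.+1) (fun n => g n.+1) (Dec2 F)) => n i x; [exact: ef|exact: eg].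
- rewrite !shS0 -eg; apply: (ih (Dec U') (Dec V') (fun n => f n.+1) (fun n => g n.+1) (Dec2 F)) => n i x; [exact: ef|exact: eg].
rewrite !shSS -ef -eg; congr (_ - sgn p _).
  by apply: (ih1 (Dec U') (Dec V') (fun n => f n.+1) (fun n => g n.+1) (Dec2 F)) => n i x; [exact: ef|exact: eg].
by apply: (ih2 (Dec U') (Dec V') (fun n => f n.+1) (fun n => g n.+1) (Dec2 F)) => n i x; [exact: ef|exact: eg].
Qed.

Lemma sh_raddf (B : zmodType) (f : {additive A -> B}) p q (U V : sset_data)
    (F : cochain2 U V A) (u : U p) (v : V q) :
  sh (fun n u v => f (F n u v)) u v = f (sh F u v).
Proof.
move: p q U V F u v; apply: sh_ind => [U V|q U V ih|p U V ih|p q U V ih1 ih2] F u v.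
- by [].
- exact: ih.
- exact: ih.
by rewrite !shSS raddfB raddf_sgn -(ih1 (Dec2 F)) -(ih2 (Dec2 F)).
Qed.

(** For membership statements: P is a subgroup, and R is a condition on the first argument that
    survives degeneracies. It serves for degrees and for the skeletal filtration. *)
Lemma sh_closed (P : A -> Prop) :
  (forall a b, P a -> P b -> P (a - b)) ->
  forall p q (U V : sset_data) (R : forall n, U n -> Prop) (F : cochain2 U V A)
    (u : U p) (v : V q),
  (forall n i x, R n x -> R n.+1 (sset_dgn i x)) ->
  (forall n u v, n = (p + q)%N -> R n u -> P (F n u v)) -> R p u -> P (sh F u v).
Proof.
move=> PB.
have Psgn n a : P a -> P (sgn n a).
  move=> Pa; rewrite /sgn; case: odd => //.
  by have := PB _ _ (PB _ _ Pa Pa) Pa; rewrite subrr add0r.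
apply: sh_ind => [U V|q U V ih|p U V ih|p q U V ih1 ih2] R F u v Rd RP Ru.
- exact: RP.
- rewrite sh0S; apply: (ih (fun n => R n.+1)) => [n i x|n x y e|]; [exact: Rd| |exact: Rd].
  by apply: RP; lia.
- rewrite shS0; apply: (ih (fun n => R n.+1)) => [n i x|n x y e|]; [exact: Rd| |exact: Ru].
  by apply: RP; lia.
rewrite shSS; apply: PB; [|apply: Psgn].
  apply: (ih1 (fun n => R n.+1)) => [n i x|n x y e|]; [exact: Rd| |exact: Ru].
  by apply: RP; lia.
apply: (ih2 (fun n => R n.+1)) => [n i x|n x y e|]; [exact: Rd| |exact: Rd].
by apply: RP; lia.
Qed.

End ShBasic.

Section ShDgn.
Variable A : zmodType.

Lemma sh_Dec_dgn0 p q (U V : sset_data) (axU : sset_axioms U)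
    (axV : sset_axioms V) (F : cochain2 (Dec U) (Dec V) A) (u : U p) (v : V q) :
  sh F (sset_dgn ord0 u : Dec U p) (sset_dgn ord0 v : Dec V q)
  = sh (fun n (u : U n) (v : V n) => F n (sset_dgn ord0 u) (sset_dgn ord0 v)) u v.
Proof.
have nat (p' q' : nat) (u' : U p'.+1) (v' : V q'.+1) : 
  sh (Dec2 F) (sset_dgn ord0 u' : Dec (Dec U) p') (sset_dgn ord0 v' : Dec (Dec V) q')
  = sh (fun n (u : Dec U n) (v : Dec V n) =>
        F n.+1 (@sset_dgn U n.+1 ord0 u) (@sset_dgn V n.+1 ord0 v))
      (u' : Dec U p') (v' : Dec V q').
  apply/esym/(@sh_nat _ _ _ (Dec U) (Dec V) (Dec (Dec U)) (Dec (Dec V))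
    (fun n => @sset_dgn U n.+1 ord0) (fun n => @sset_dgn V n.+1 ord0) (Dec2 F)) => n i x /=;
    by rewrite -dgn_dgn0.
case: p u => [|p] u; case: q v => [|q] v.
- by [].
- by rewrite !sh0S -nat /= (dgn_dgn0 axU).
- by rewrite !shS0 -nat /= (dgn_dgn0 axV).
by rewrite !shSS; congr (_ - sgn p _); rewrite -nat /= ?(dgn_dgn0 axU) ?(dgn_dgn0 axV).
Qed.

Definition normalised2 (U V : sset_data) (F : cochain2 U V A) : Prop :=
  forall n i (u : U n) (v : V n), F n.+1 (sset_dgn i u) (sset_dgn i v) = 0.

Definition binormalised (U V : sset_data) (K : bicochain U V A) : Prop :=
  (forall p q i (u : U p) (v : V q), K p.+1 q (sset_dgn i u) v = 0) /\
  (forall p q i (u : U p) (v : V q), K p q.+1 u (sset_dgn i v) = 0).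

Lemma Dec2_normalised (U V : sset_data) (F : cochain2 U V A) :
  normalised2 F -> normalised2 (Dec2 F).
Proof. by move=> nF n i u v; exact: nF. Qed.

Lemma ord0P n (i : 'I_n.+1) : (i = ord0) \/ exists j : 'I_n, i = lift ord0 j.
Proof. by case: (unliftP ord0 i) => [j ->|->]; [right; exists j|left]. Qed.

(** Where both arguments acquire the degeneracy s_0, every term is a common degeneracy and F kills
    it. In all other terms the degeneracy of u persists in the decalage, as s_0 s_i = s_{i+1} s_0,
    and induction applies. *)
Lemma sh_dgnl p q (U V : sset_data) (axU : sset_axioms U)
    (axV : sset_axioms V) (F : cochain2 U V A) (i : 'I_p.+1) (u : U p) (v : V q) :
  normalised2 F -> sh F (sset_dgn i u) v = 0.
Proof.
have vanish p' q' (U' V' : sset_data) (axU' : sset_axioms U') (axV' : sset_axioms V')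
    (F' : cochain2 U' V' A) (u' : U' p') (v' : V' q') : normalised2 F' ->
  sh (Dec2 F') (sset_dgn ord0 u' : Dec U' p') (sset_dgn ord0 v' : Dec V' q') = 0.
  move=> nF; rewrite sh_Dec_dgn0 // -[RHS](@sh0 A p' q' U' V' u' v').
  by apply: sh_ext => n a b _; exact: nF.
move=> nF.
elim: p q U V axU axV F i u v nF => [|p ihp] q U V axU axV F i u v nF; last first.
  elim: q U V axU axV F i u v nF => [|q ihq] U V axU axV F i u v nF.
    rewrite shS0; case: (ord0P i) => [->|[j ->]]; first exact: vanish.
    by apply: (ihp _ (Dec U) (Dec V)); [exact: Dec_axioms..|exact: Dec2_normalised].
  rewrite shSS; case: (ord0P i) => [->|[j ->]].
    rewrite vanish // -(dgn_dgn0 axU).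
    by rewrite (ihq (Dec U) (Dec V)) ?sgn0 ?subrr //; [exact: Dec_axioms..|exact: Dec2_normalised].
  rewrite (ihp _ (Dec U) (Dec V)); [|exact: Dec_axioms..|exact: Dec2_normalised].
  rewrite -(dgn_dgn0 axU (lift ord0 j)).
  by rewrite (ihq (Dec U) (Dec V)) ?sgn0 ?subrr //; [exact: Dec_axioms..|exact: Dec2_normalised].
elim: q U V axU axV F i u v nF => [|q ihq] U V axU axV F i u v nF.
  by rewrite shS0 (ord1 i); exact: vanish.
rewrite shSS (ord1 i) vanish // -(dgn_dgn0 axU).
by rewrite (ihq (Dec U) (Dec V)) ?sgn0 ?subrr //; [exact: Dec_axioms..|exact: Dec2_normalised].
Qed.

Lemma sh_dgnr p q (U V : sset_data) (axU : sset_axioms U)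
    (axV : sset_axioms V) (F : cochain2 U V A) (i : 'I_q.+1) (u : U p) (v : V q) :
  normalised2 F -> sh F u (sset_dgn i v) = 0.
Proof.
have vanish p' q' (U' V' : sset_data) (axU' : sset_axioms U') (axV' : sset_axioms V')
    (F' : cochain2 U' V' A) (u' : U' p') (v' : V' q') : normalised2 F' ->
  sh (Dec2 F') (sset_dgn ord0 u' : Dec U' p') (sset_dgn ord0 v' : Dec V' q') = 0.
  move=> nF; rewrite sh_Dec_dgn0 // -[RHS](@sh0 A p' q' U' V' u' v').
  by apply: sh_ext => n a b _; exact: nF.
move=> nF.
elim: p q U V axU axV F i u v nF => [|p ihp] q U V axU axV F i u v nF.
  elim: q U V axU axV F i u v nF => [|q ihq] U V axU axV F i u v nF.
    by rewrite sh0S (ord1 i); exact: vanish.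
  rewrite sh0S; case: (ord0P i) => [->|[j ->]]; first exact: vanish.
  by apply: (ihq (Dec U) (Dec V)); [exact: Dec_axioms..|exact: Dec2_normalised].
elim: q U V axU axV F i u v nF => [|q ihq] U V axU axV F i u v nF.
  rewrite shSS (ord1 i) vanish // -(dgn_dgn0 axV).
  by rewrite (ihp _ (Dec U) (Dec V)) ?sgn0 ?subrr //; [exact: Dec_axioms..|exact: Dec2_normalised].
rewrite shSS -(dgn_dgn0 axV).
rewrite (ihp _ (Dec U) (Dec V)); [|exact: Dec_axioms..|exact: Dec2_normalised].
case: (ord0P i) => [->|[j ->]]; first by rewrite vanish // sgn0 subrr.
by rewrite (ihq (Dec U) (Dec V)) ?sgn0 ?subrr //; [exact: Dec_axioms..|exact: Dec2_normalised].
Qed.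

Lemma sh_binormalised (U V : sset_data) (axU : sset_axioms U)
    (axV : sset_axioms V) (F : cochain2 U V A) :
  normalised2 F -> binormalised (fun p q (u : U p) (v : V q) => sh F u v).
Proof. by move=> nF; split=> p q i u v; [exact: sh_dgnl|exact: sh_dgnr]. Qed.

End ShDgn.

Lemma sum_sgn_recl (A : zmodType) n (f : 'I_n.+1 -> A) :
  \sum_(i < n.+1) sgn i (f i) = f ord0 - \sum_(i < n) sgn i (f (lift ord0 i)).
Proof.
rewrite big_ord_recl; congr (_ + _); rewrite -sumrN.
by apply: eq_bigr => i _; rewrite lift0 sgnS.
Qed.

Lemma sum_sgnB (A : zmodType) n k (f g : 'I_n -> A) :
  \sum_(i < n) sgn i (f i - sgn k (g i))
  = \sum_(i < n) sgn i (f i) - sgn k (\sum_(i < n) sgn i (g i)).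
Proof.
rewrite sgn_sum -sumrB; apply: eq_bigr => i _.
by rewrite sgnB [sgn i (sgn k _)]sgnC.
Qed.

(** * The shuffle map commutes with the coboundaries *)

Section Leibniz.
Variable A : zmodType.

Lemma cobd2_Dec2 (U V : sset_data) (F : cochain2 U V A) n (u : U n.+2) (v : V n.+2) :
  cobd2 F u v = F n.+1 (sset_face ord0 u) (sset_face ord0 v)
    - cobd2 (Dec2 F) (u : Dec U n.+1) (v : Dec V n.+1).
Proof. exact: sum_sgn_recl. Qed.

(** d_0 is a map from the decalage back to U, so it can be taken out of [sh]. In total degree 0 the
    equation is false: d_1 has no counterpart in the coboundary over the decalage. *)
Lemma sh_Dec_cobd p q (U V : sset_data) (axU : sset_axioms U)
    (axV : sset_axioms V) (F : cochain2 U V A) (u : Dec U p) (v : Dec V q) :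
  (0 < p + q)%N ->
  sh (Dec2 (cobd2 F)) u v
  = sh F (sset_face ord0 (u : U p.+1)) (sset_face ord0 (v : V q.+1))
    - sh (cobd2 (Dec2 F)) u v.
Proof.
move=> pq.
have -> : sh F (sset_face ord0 (u : U p.+1)) (sset_face ord0 (v : V q.+1))
  = sh (fun n (u : Dec U n) (v : Dec V n) => 
      F n (@sset_face U n ord0 u) (@sset_face V n ord0 v)) u v.
  apply/esym/(@sh_nat _ _ _ (Dec U) (Dec V) U V
    (fun n => @sset_face U n ord0) (fun n => @sset_face V n ord0) F) => n i x /=;
  exact: face0_dgn.
rewrite -shN -shD; apply: sh_ext => -[|n] a b e; first by lia.
exact: cobd2_Dec2.
Qed.

Definition shc (U V : sset_data) (F : cochain2 U V A) : bicochain U V A :=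
  fun p q u v => sh F u v.

Lemma sh_cobd p q (U V : sset_data) (axU : sset_axioms U)
    (axV : sset_axioms V) (F : cochain2 U V A) (u : U p) (v : V q) :
  sh (cobd2 F) u v = bicobd (shc F) u v.
Proof.
rewrite /bicobd /shc; move: axU axV F u v.
pose P p q U V := forall (axU : sset_axioms U) (axV : sset_axioms V)
  (F : cochain2 U V A) (u : U p) (v : V q),
  sh (cobd2 F) u v = cobdl (shc F) u v + sgn p (cobdr (shc F) u v).
apply: (sh_ind (P := P)) => {p q U V}
  [U V|q U V ih|p U V ih|p q U V ih1 ih2] axU axV F u v.
- by rewrite /= addr0.
- rewrite sh0S; case: q => [|q] in ih v *.
    rewrite sh00 /Dec2 /= !sum_sgn_recl !big_ord0 !subr0 /shc !sh00 add0r.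
    by rewrite face0_dgn0 // face1_dgn0.
  rewrite sh_Dec_cobd // ih; try exact: Dec_axioms.
  by rewrite face0_dgn0 //= !add0r /shc [RHS]sum_sgn_recl.
- rewrite shS0; case: p => [|p] in ih u *.
    rewrite sh00 /Dec2 /= sgn0 addr0 !sum_sgn_recl !big_ord0 !subr0 /shc !sh00.
    by rewrite face0_dgn0 // face1_dgn0.
  rewrite sh_Dec_cobd // ih; try exact: Dec_axioms.
  by rewrite face0_dgn0 //= !sgn0 !addr0 /shc [RHS]sum_sgn_recl.
rewrite shSS !sh_Dec_cobd //; try lia.
rewrite ih1 ?ih2; try exact: Dec_axioms.
rewrite !face0_dgn0 //.
(* [El] and [Er] begin with the same term, which comes from d_1 s_0 = 1 at a corner of the lattice
   path. It enters with opposite signs and cancels. *)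
have El : cobdl (shc (Dec2 F)) (sset_dgn ord0 u : Dec U p.+1) (v : Dec V q)
  = sh (Dec2 F) (u : Dec U p) (v : Dec V q)
    - \sum_(i < p.+1) sgn i (sh (Dec2 F)
        (sset_dgn ord0 (sset_face (lift ord0 i) u) : Dec U p) (v : Dec V q)).
  rewrite /= sum_sgn_recl /= face1_dgn0 //; congr (_ - _).
  by apply: eq_bigr => i _; rewrite face_dgn0.
have Er : cobdr (shc (Dec2 F)) (u : Dec U p) (sset_dgn ord0 v : Dec V q.+1)
  = sh (Dec2 F) (u : Dec U p) (v : Dec V q)
    - \sum_(i < q.+1) sgn i (sh (Dec2 F) (u : Dec U p)
        (sset_dgn ord0 (sset_face (lift ord0 i) v) : Dec V q)).
  rewrite /= sum_sgn_recl /= face1_dgn0 //; congr (_ - _).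
  by apply: eq_bigr => i _; rewrite face_dgn0.
rewrite {}El {}Er.
rewrite [in RHS]/= [X in _ = X + _]sum_sgn_recl [X in _ = _ + sgn _ X]sum_sgn_recl.
have Sl : \sum_(i < p.+1) sgn i (sh F (sset_face (lift ord0 i) u) v)
  = cobdl (shc (Dec2 F)) (u : Dec U p) (sset_dgn ord0 v : Dec V q.+1)
    + sgn p (\sum_(i < p.+1) sgn i (sh (Dec2 F)
        (sset_dgn ord0 (sset_face (lift ord0 i) u) : Dec U p) (v : Dec V q))).
  case: (p) u => [|p'] u'; first by rewrite /= !big_ord1 add0r.
  by rewrite sgnS -sum_sgnB; apply: eq_bigr => i _; congr sgn.
have Sr : \sum_(i < q.+1) sgn i (sh F u (sset_face (lift ord0 i) v))
  = \sum_(i < q.+1) sgn i (sh (Dec2 F) (u : Dec U p)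
        (sset_dgn ord0 (sset_face (lift ord0 i) v) : Dec V q))
    - sgn p (cobdr (shc (Dec2 F)) (sset_dgn ord0 u : Dec U p.+1) (v : Dec V q)).
  clear Sl; case: (q) v => [|q'] v'.
    by rewrite /= !big_ord1 sgn0 subr0.
  by rewrite -sum_sgnB; apply: eq_bigr => i _; congr sgn.
rewrite {}Sl {}Sr !(sgnD, sgnN, sgnS, sgnK) /shc.
abel.
Qed.

End Leibniz.

Lemma sgn_ord0 (A : zmodType) n (v : A) : sgn (@ord0 n) v = v.
Proof. by []. Qed.

Definition Decl (U V : sset_data) (A : Type) (K : bicochain U V A) :
  bicochain (Dec U) V A := fun p => K p.+1.

(** * The Alexander-Whitney map *)

(* the Alexander-Whitney map, evaluated on a bicochain: the sum over i of the
   values at (i-th front face of u, (n-i)-th back face of v) *)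
Fixpoint AW (A : zmodType) (n : nat) :
  forall U V : sset_data, bicochain U V A -> U n -> V n -> A :=
  match n with
  | 0 => fun U V K u v => K 0%N 0%N u v
  | m.+1 => fun U V K u v =>
      K 0%N m.+1 (vertex0 u) v
      + @AW A m (Dec U) V (Decl K) u (sset_face ord0 v)
  end.

Arguments AW {A n U V} K u v.

Lemma AWS (A : zmodType) n (U V : sset_data) (K : bicochain U V A) (u : U n.+1) (v : V n.+1) :
  AW K u v = K 0%N n.+1 (vertex0 u) v + AW (Decl K) (u : Dec U n) (sset_face ord0 v).
Proof. by []. Qed.

Section AWBasic.
Variable A : zmodType.

Lemma AW_ext n (U V : sset_data) (K L : bicochain U V A) (u : U n) (v : V n) :
  (forall p q u v, (p + q)%N = n -> K p q u v = L p q u v) -> AW K u v = AW L u v.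
Proof.
elim: n U V K L u v => [|n ih] U V K L u v e; first exact: e.
rewrite !AWS e //; congr (_ + _).
by apply: ih => p q *; apply: e; lia.
Qed.

Lemma AWD n (U V : sset_data) (K L : bicochain U V A) (u : U n) (v : V n) :
  AW (fun p q u v => K p q u v + L p q u v) u v = AW K u v + AW L u v.
Proof.
elim: n U V K L u v => [//|n ih] U V K L u v.
by rewrite !AWS (ih _ _ (Decl K) (Decl L)); abel.
Qed.

Lemma AWN n (U V : sset_data) (K : bicochain U V A) (u : U n) (v : V n) :
  AW (fun p q u v => - K p q u v) u v = - AW K u v.
Proof.
elim: n U V K u v => [//|n ih] U V K u v.
by rewrite !AWS (ih _ _ (Decl K)); abel.
Qed.

Lemma AWB n (U V : sset_data) (K L : bicochain U V A) (u : U n) (v : V n) :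
  AW (fun p q u v => K p q u v - L p q u v) u v = AW K u v - AW L u v.
Proof. by rewrite AWD AWN. Qed.

Lemma AW_sgn k n (U V : sset_data) (K : bicochain U V A) (u : U n) (v : V n) :
  AW (fun p q u v => sgn k (K p q u v)) u v = sgn k (AW K u v).
Proof. by rewrite /sgn; case: odd; [exact: AWN|]. Qed.

Lemma AW0 n (U V : sset_data) (u : U n) (v : V n) :
  AW (fun p q (_ : U p) (_ : V q) => 0 : A) u v = 0.
Proof.
have := @AWB n U V (fun _ _ _ _ => 0) (fun _ _ _ _ => 0) u v.
rewrite [RHS]subrr => e; rewrite -[RHS]e.
by apply: AW_ext => *; rewrite subrr.
Qed.

Lemma AW_raddf (B : zmodType) (f : {additive A -> B}) n (U V : sset_data)
    (K : bicochain U V A) (u : U n) (v : V n) :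
  AW (fun p q u v => f (K p q u v)) u v = f (AW K u v).
Proof.
elim: n U V K u v => [//|n ih] U V K u v.
by rewrite !AWS raddfD -(ih _ _ (Decl K)).
Qed.

(** Front faces are formed by last faces and back faces by d_0; commuting with these is enough. *)
Lemma AW_nat n (U V U' V' : sset_data) (f : forall n, U n -> U' n)
    (g : forall n, V n -> V' n) (K : bicochain U' V' A) (u : U n) (v : V n) :
  (forall n (x : U n.+1), f _ (sset_face ord_max x) = sset_face ord_max (f _ x)) ->
  (forall n (x : V n.+1), g _ (sset_face ord0 x) = sset_face ord0 (g _ x)) ->
  AW (fun p q u v => K p q (f p u) (g q v)) u v = AW K (f n u) (g n v).
Proof.
elim: n U V U' V' f g K u v => [//|n ih] U V U' V' f g K u v ef eg.
rewrite !AWS -eg; congr (K _ _ _ _ + _).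
  elim: n.+1 u => [//|m ihm] u /=; by rewrite ihm ef.
apply: (ih (Dec U) V (Dec U') V' (fun n => f n.+1) g (Decl K)) => // m x /=.
by rewrite !lift0_max; exact: ef.
Qed.

Lemma AW_closed (P : A -> Prop) : (forall a b, P a -> P b -> P (a + b)) ->
  forall n (U V : sset_data) (R : forall n, U n -> Prop) (K : bicochain U V A)
    (u : U n) (v : V n),
  (forall n x, R n.+1 x -> R n (sset_face ord_max x)) ->
  (forall p q u v, (p + q)%N = n -> R p u -> P (K p q u v)) -> R n u -> P (AW K u v).
Proof.
move=> PD n U V; elim: n U V => [|n ih] U V R K u v Rf RP Ru; first exact: RP.
rewrite AWS; apply: PD.
  apply: RP => //; elim: n.+1 u Ru => [//|m ihm] u Ru /=; exact/ihm/Rf.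
apply: (ih (Dec U) V (fun n => R n.+1)) => [m x|p q x y e|//].
  by rewrite /= lift0_max; exact: Rf.
by apply: RP; lia.
Qed.

(* only the first summand involves bidegree (0, n) *)
Lemma AW_degl0 n (U V : sset_data) (K : bicochain U V A) (u : U n) (v : V n) :
  (forall p q u v, K p.+1 q u v = 0) -> AW K u v = K 0%N n (vertex0 u) v.
Proof.
case: n u v => [//|n] u v K0; rewrite AWS -[RHS]addr0; congr (_ + _).
by rewrite -[RHS](@AW0 n (Dec U) V u (sset_face ord0 v)); apply: AW_ext => p q *; exact: K0.
Qed.

End AWBasic.

Section AWNormalised.
Variable A : zmodType.

Lemma AW_Dec_dgn0 n (U V : sset_data) (axU : sset_axioms U)
    (K : bicochain (Dec U) V A) (u : U n) (v : V n) :
  AW K (sset_dgn ord0 u : Dec U n) v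
  = AW (fun p q (u : U p) v => K p q (sset_dgn ord0 u) v) u v.
Proof.
apply/esym/(@AW_nat _ _ U V (Dec U) V (fun n => @sset_dgn U n ord0) (fun n => id)) => // m x /=.
by rewrite lift0_max (face_max_dgn0 axU).
Qed.

Lemma AW_normalised (U V : sset_data) (axU : sset_axioms U) (axV : sset_axioms V)
    (K : bicochain U V A) : binormalised K -> normalised2 (fun n (u : U n) (v : V n) => AW K u v).
Proof.
move=> nK n i u v.
elim: n U V axU axV K nK i u v => [|n ih] U V axU axV K [nl nr] i u v.
  by rewrite AWS nr add0r (ord1 i) face0_dgn0 //; exact: nl.
rewrite AWS nr add0r; case: (ord0P i) => [->|[j ->]].
  rewrite face0_dgn0 // AW_Dec_dgn0 // -[RHS](@AW0 A n.+1 U V u v).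
  by apply: AW_ext => p q a b _; exact: nl.
rewrite face0_dgn //; apply: (ih (Dec U) V (Dec_axioms axU) axV (Decl K)).
by split=> p q k a b; [exact: nl|exact: nr].
Qed.

End AWNormalised.

Section AWCobd.
Variable A : zmodType.

Lemma AW_cobd n (U V : sset_data) (axU : sset_axioms U) (axV : sset_axioms V)
    (K : bicochain U V A) (u : U n) (v : V n) :
  AW (bicobd K) u v = cobd2 (fun n (u : U n) (v : V n) => AW K u v) u v.
Proof.
elim: n U V axU axV K u v => [|n ih] U V axU axV K u v.
  by rewrite /= /bicobd /= addr0.
(* [K0] is the face d_1 of an edge, which the coboundary of [Decl K] lacks in bidegree (0, q). Its
   sum cancels the term with d_0 v in the summand of bidegree (0, n + 1). *)
pose K0 : bicochain (Dec U) V A := fun p =>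
  match p with
  | 0 => fun q (u : U 1) v => K 0%N q (sset_face (lift ord0 ord0) u) v
  | _.+1 => fun _ _ _ => 0
  end.
have EK p q (a : Dec U p) (b : V q) : Decl (bicobd K) a b
    = K p q (sset_face ord0 (a : U p.+1)) b - bicobd (Decl K) a b - K0 p q a b.
  have E : cobdr (Decl K) a b = cobdr K (a : U p.+1) b by case: q b.
  rewrite {1}/Decl /bicobd {}E [cobdl K _ _]sum_sgn_recl sgnS.
  case: p a => [|p] a /=; last by rewrite /Decl; abel.
  rewrite big_ord1 sgn_ord0 add0r; abel.
rewrite AWS (_ : AW (Decl (bicobd K)) _ _ =
  AW K (sset_face ord0 u) (sset_face ord0 v)
  - AW (bicobd (Decl K)) (u : Dec U n) (sset_face ord0 v)
  - K 0%N n (vertex0 u) (sset_face ord0 v)); last first.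
  have -> : AW K (sset_face ord0 u) (sset_face ord0 v)
      = AW (fun p q (a : Dec U p) b => K p q (@sset_face U p ord0 a) b)
          (u : Dec U n) (sset_face ord0 v).
    apply/esym/(@AW_nat _ _ (Dec U) V U V (fun n => @sset_face U n ord0) (fun n => id)) => // m x /=.
    by rewrite face0_face.
  have -> : K 0%N n (vertex0 u) (sset_face ord0 v) = AW K0 (u : Dec U n) (sset_face ord0 v).
    rewrite AW_degl0 /K0; last by case.
    by rewrite vertex0_dec.
  by rewrite -!AWB; apply: AW_ext => p q *; exact: EK.
rewrite ih //; last exact: Dec_axioms.
have -> : cobd2 (fun n (u : U n) (v : V n) => AW K u v) u v
  = AW K (sset_face ord0 u) (sset_face ord0 v)
    - (\sum_(i < n.+1) sgn i (K 0%N n (vertex0 u) (sset_face (lift ord0 i) v))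
       + cobd2 (fun n (u : Dec U n) (v : V n) => AW (Decl K) u v)
           (u : Dec U n) (sset_face ord0 v)).
  rewrite [LHS]sum_sgn_recl; congr (_ - _).
  case: n u v {ih} => [|n] u v.
    rewrite /= !big_ord1 addr0 /=; congr (K _ _ _ _).
    by rewrite -lift0_max; congr sset_face; exact: val_inj.
  rewrite [cobd2 _ _ _]/= -big_split; apply: eq_bigr => i _.
  rewrite AWS sgnD face0_face //; congr (sgn _ (K _ _ _ _) + _).
  have := @vertex0_face U axU _ (lift ord0 i) u; rewrite faceE; apply.
  by rewrite lift0 /=; have := ltn_ord i; lia.
rewrite /bicobd /= add0r [X in sgn 0 X]sum_sgn_recl /sgn /=.
abel.
Qed.

End AWCobd.

(** * The Alexander-Whitney map is a left inverse of the shuffle map *)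

Section ShAW.
Variable A : zmodType.

(** For p > 0 every shuffle degenerates v, and k kills that. For p = 0 only u is degenerated, which
    e does not notice. *)
Lemma sh_const (C : Type) p q (U V : sset_data) (axV : sset_axioms V) (e : forall n, U n -> C)
    (k : forall n, C -> V n -> A) (u : U p) (v : V q) :
  (forall n i (u : U n), e n.+1 (sset_dgn i u) = e n u) ->
  (forall n c i (v : V n), k n.+1 c (sset_dgn i v) = 0) ->
  sh (fun n u v => k n (e n u) v) u v = if p is 0 then k q (e p u) v else 0.
Proof.
move: axV e k u v.
pose P p q (U V : sset_data) := forall (axV : sset_axioms V) (e : forall n, U n -> C)
    (k : forall n, C -> V n -> A) (u : U p) (v : V q),
  (forall n i (u : U n), e n.+1 (sset_dgn i u) = e n u) ->
  (forall n c i (v : V n), k n.+1 c (sset_dgn i v) = 0) ->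
  sh (fun n u v => k n (e n u) v) u v = if p is 0 then k q (e p u) v else 0.
apply: (sh_ind (P := P)) => {p q U V}
  [U V|q U V ih|p U V ih|p q U V ih1 ih2] axV e k u v he hk //.
- rewrite sh0S [LHS](ih (Dec_axioms axV) (fun n => e n.+1) (fun n => k n.+1)) ?he // => *; [exact: he|exact: hk].
- rewrite shS0 [LHS](ih (Dec_axioms axV) (fun n => e n.+1) (fun n => k n.+1)).
  + by case: p {ih} u => // u; exact: hk.
  + by move=> *; exact: he.
  + by move=> *; exact: hk.
rewrite shSS [X in X - _](ih1 (Dec_axioms axV) (fun n => e n.+1) (fun n => k n.+1));
  [|by move=> *; exact: he|by move=> *; exact: hk].
rewrite [X in sgn p X](ih2 (Dec_axioms axV) (fun n => e n.+1) (fun n => k n.+1));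
  [|by move=> *; exact: he|by move=> *; exact: hk].
rewrite sgn0 subr0; case: p {ih1 ih2} u => // u; exact: hk.
Qed.

(** In the recursion of [AW], the summand of bidegree (0, n) sees only the vertex of u and is
    evaluated by [sh_const]; the rest is [AW] for [Dec U], composed with d_0 on the second
    factor. *)
Lemma sh_AW p q (U V : sset_data) (axU : sset_axioms U) (axV : sset_axioms V)
    (K : bicochain U V A) (u : U p) (v : V q) :
  binormalised K -> sh (fun n (u : U n) (v : V n) => AW K u v) u v = K p q u v.
Proof.
move: axU axV K u v.
pose P p q := forall (U V : sset_data) (axU : sset_axioms U) (axV : sset_axioms V)
    (K : bicochain U V A) (u : U p) (v : V q),
  binormalised K -> sh (fun n (u : U n) (v : V n) => AW K u v) u v = K p q u v.
move: U V; rewrite -/(P p q).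
have dec p' q' U V (axU : sset_axioms U) (axV : sset_axioms V) (K : bicochain U V A)
    (u : Dec U p') (v : Dec V q') : binormalised K ->
  sh (Dec2 (fun n (u : U n) (v : V n) => AW K u v)) u v
  = (if p' is 0 then K 0%N q'.+1 (vertex0 (u : U p'.+1)) (v : V q'.+1) else 0)
    + sh (fun n (u : Dec U n) (v : V n) => AW (Decl K) u v) u (sset_face ord0 (v : V q'.+1)).
  move=> [nl nr].
  rewrite -(@sh_const (U 0) p' q' (Dec U) (Dec V) (Dec_axioms axV)
    (fun n => @vertex0 U n.+1) (fun n c (v : Dec V n) => K 0%N n.+1 c v)) //.
  - rewrite -(@sh_nat A p' q' (Dec U) (Dec V) (Dec U) V (fun n => id)
       (fun n => @sset_face V n ord0)) //; last by move=> n i x; exact: face0_dgn.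
    by rewrite -shD.
  - by move=> n i x /=; exact: vertex0_dec_dgn.
  - by move=> *; exact: nr.
have nD U V (K : bicochain U V A) : binormalised K -> binormalised (Decl K).
  by move=> [nl nr]; split=> *; [exact: nl|exact: nr].
elim: p q => [|p ihp]; elim=> [|q ihq] U V axU axV K u v nK.
- by [].
- rewrite sh0S dec // (ihq (Dec U) V (Dec_axioms axU) axV (Decl K)); last exact: nD.
  rewrite [Decl K _ _](_ : _ = 0) ?addr0; last exact: nK.1.
  by congr (K _ _ _ _); rewrite /= (_ : ord_max = lift ord0 ord0) ?face1_dgn0 //; exact: val_inj.
- rewrite shS0 dec // (ihp 0%N (Dec U) V (Dec_axioms axU) axV (Decl K)); last exact: nD.
  by rewrite face0_dgn0 //; case: p u {ihp} => [|p] u; rewrite ?nK.2 add0r.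
rewrite shSS !dec // (ihp q.+1 (Dec U) V (Dec_axioms axU) axV (Decl K)); last exact: nD.
rewrite (_ : sh (fun n (u : Dec U n) (v : V n) => AW (Decl K) u v)
  (sset_dgn ord0 u : Dec U p.+1) (sset_face ord0 v) = 0); last first.
  rewrite (ihq (Dec U) V (Dec_axioms axU) axV (Decl K)); last exact: nD.
  exact: nK.1.
rewrite addr0 sgn0 subr0 face0_dgn0 //.
by case: p u {ihp ihq} => [|p] u; rewrite ?nK.2 add0r.
Qed.

End ShAW.

Section ShawCompat.
Variable A : zmodType.

Lemma shaw_nat n (U V U' V' : sset_data) (f : forall n, U n -> U' n)
    (g : forall n, V n -> V' n) (F : cochain2 U' V' A) (u : U n) (v : V n) :
  (forall n i (x : U n), f _ (sset_dgn i x) = sset_dgn i (f _ x)) ->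
  (forall n i (x : V n), g _ (sset_dgn i x) = sset_dgn i (g _ x)) ->
  (forall n (x : U n.+1), f _ (sset_face ord_max x) = sset_face ord_max (f _ x)) ->
  (forall n (x : V n.+1), g _ (sset_face ord0 x) = sset_face ord0 (g _ x)) ->
  AW (shc (fun n u v => F n (f n u) (g n v))) u v = AW (shc F) (f n u) (g n v).
Proof.
move=> fd gd ff gf; rewrite -(@AW_nat _ _ U V U' V' f g) //.
by apply: AW_ext => p q a b _; exact: sh_nat.
Qed.

Lemma shaw_cobd n (U V : sset_data) (axU : sset_axioms U) (axV : sset_axioms V)
    (F : cochain2 U V A) (u : U n) (v : V n) :
  AW (shc (cobd2 F)) u v = cobd2 (fun n (u : U n) (v : V n) => AW (shc F) u v) u v.
Proof. by rewrite -AW_cobd //; apply: AW_ext => p q a b _; exact: sh_cobd. Qed.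

Lemma shaw_normalised (U V : sset_data) (axU : sset_axioms U) (axV : sset_axioms V)
    (F : cochain2 U V A) : normalised2 F ->
  normalised2 (fun n (u : U n) (v : V n) => AW (shc F) u v).
Proof. by move=> nF; apply: AW_normalised => //; exact: sh_binormalised. Qed.

End ShawCompat.

(** * The Eilenberg-Mac Lane homotopy *)

(* The Eilenberg-Mac Lane homotopy between the identity and the composite of
   the Alexander-Whitney and shuffle maps. *)
Fixpoint EZh (A : zmodType) (n : nat) :
  forall U V : sset_data, cochain2 U V A -> U n -> V n -> A :=
  match n with
  | 0 => fun U V F u v => F 1%N (sset_dgn ord0 u) (sset_dgn ord0 v)
  | m.+1 => fun U V F u v =>
      - @EZh A m (Dec U) (Dec V) (Dec2 F) u v
      + AW (shc (Dec2 F)) (sset_dgn ord0 u : Dec U m.+1) (sset_dgn ord0 v : Dec V m.+1)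
  end.

Arguments EZh {A n U V} F u v.

Section EZhBasic.
Variable A : zmodType.

Lemma EZhS n (U V : sset_data) (F : cochain2 U V A) (u : U n.+1) (v : V n.+1) :
  EZh F u v = - EZh (Dec2 F) (u : Dec U n) (v : Dec V n)
    + AW (shc (Dec2 F)) (sset_dgn ord0 u : Dec U n.+1) (sset_dgn ord0 v : Dec V n.+1).
Proof. by []. Qed.

Lemma EZh_ext n (U V : sset_data) (F G : cochain2 U V A) (u : U n) (v : V n) :
  (forall k u v, k = n.+1 -> F k u v = G k u v) -> EZh F u v = EZh G u v.
Proof.
elim: n U V F G u v => [|n ih] U V F G u v e; first exact: e.
rewrite !EZhS; congr (- _ + _).
  by apply: ih => k a b ek; apply: e; lia.
by apply: AW_ext => p q a b epq; apply: sh_ext => k c d ek; apply: e; lia.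
Qed.

Lemma EZhD n (U V : sset_data) (F G : cochain2 U V A) (u : U n) (v : V n) :
  EZh (fun n u v => F n u v + G n u v) u v = EZh F u v + EZh G u v.
Proof.
elim: n U V F G u v => [//|n ih] U V F G u v.
rewrite !EZhS (ih _ _ (Dec2 F) (Dec2 G)).
rewrite (_ : AW (shc (Dec2 (fun n u v => F n u v + G n u v))) _ _ =
  AW (shc (Dec2 F)) (sset_dgn ord0 u : Dec U n.+1) (sset_dgn ord0 v : Dec V n.+1)
  + AW (shc (Dec2 G)) (sset_dgn ord0 u : Dec U n.+1) (sset_dgn ord0 v : Dec V n.+1)).
  abel.
by rewrite -AWD; apply: AW_ext => p q a b _; exact: (shD (Dec2 F) (Dec2 G)).
Qed.

Lemma EZh_raddf (B : zmodType) (f : {additive A -> B}) n (U V : sset_data)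
    (F : cochain2 U V A) (u : U n) (v : V n) :
  EZh (fun n u v => f (F n u v)) u v = f (EZh F u v).
Proof.
elim: n U V F u v => [//|n ih] U V F u v.
rewrite !EZhS raddfD raddfN -(ih _ _ (Dec2 F)) -AW_raddf; congr (_ + _).
by apply: AW_ext => p q a b _; exact: (sh_raddf f (Dec2 F)).
Qed.

Lemma EZhN n (U V : sset_data) (F : cochain2 U V A) (u : U n) (v : V n) :
  EZh (fun n u v => - F n u v) u v = - EZh F u v.
Proof. exact: (EZh_raddf (-%R : {additive A -> A})). Qed.

Lemma EZh0 n (U V : sset_data) (u : U n) (v : V n) :
  EZh (fun n (_ : U n) (_ : V n) => 0 : A) u v = 0.
Proof. exact: (EZh_raddf (\0 : {additive A -> A}) (fun n _ _ => 0)). Qed.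

(** Under repeated decalage the face d_0 of v becomes d_1, d_2 and so on, whence all faces in the
    condition on g. The last face of u remains the last face, so that f may again be [act]. *)
Lemma EZh_nat n (U V U' V' : sset_data) (f : forall n, U n -> U' n)
    (g : forall n, V n -> V' n) (F : cochain2 U' V' A) (u : U n) (v : V n) :
  (forall n i (x : U n), f _ (sset_dgn i x) = sset_dgn i (f _ x)) ->
  (forall n i (x : V n), g _ (sset_dgn i x) = sset_dgn i (g _ x)) ->
  (forall n (x : U n.+1), f _ (sset_face ord_max x) = sset_face ord_max (f _ x)) ->
  (forall n i (x : V n.+1), g _ (sset_face i x) = sset_face i (g _ x)) ->
  EZh (fun n u v => F n (f n u) (g n v)) u v = EZh F (f n u) (g n v).
Proof.
elim: n U V U' V' f g F u v => [|n ih] U V U' V' f g F u v fd gd ff gf.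
  by rewrite /= fd gd.
have ff' k (x : Dec U k.+1) : f k.+1 (sset_face ord_max x) = @sset_face (Dec U') _ ord_max (f k.+2 x).
  by rewrite /= !lift0_max.
rewrite !EZhS -fd -gd.
rewrite -(ih (Dec U) (Dec V) (Dec U') (Dec V') (fun n => f n.+1) (fun n => g n.+1)) //;
  try (by move=> *; (exact: fd || exact: gd || exact: gf || exact: ff')).
rewrite -(@shaw_nat _ _ (Dec U) (Dec V) (Dec U') (Dec V') (fun n => f n.+1) (fun n => g n.+1)) //;
  by move=> *; (exact: fd || exact: gd || exact: gf || exact: ff').
Qed.

Lemma EZh_closed (P : A -> Prop) : (forall a b, P a -> P b -> P (a - b)) ->
  forall n (U V : sset_data) (R : forall n, U n -> Prop) (F : cochain2 U V A)
    (u : U n) (v : V n),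
  (forall n i x, R n x -> R n.+1 (sset_dgn i x)) ->
  (forall n x, R n.+1 x -> R n (sset_face ord_max x)) ->
  (forall k u v, k = n.+1 -> R k u -> P (F k u v)) -> R n u -> P (EZh F u v).
Proof.
move=> PB.
have PN a : P a -> P (- a).
  by move=> Pa; have := PB _ _ (PB _ _ Pa Pa) Pa; rewrite subrr add0r.
have PD a b : P a -> P b -> P (a + b).
  by move=> Pa Pb; rewrite -[b]opprK; apply: PB => //; exact: PN.
elim=> [|n ih] U V R F u v Rd Rf RP Ru; first by apply: RP => //; exact: Rd.
have Rf' k (x : Dec U k.+1) : R k.+2 x -> R k.+1 (sset_face ord_max x).
  by move=> Rx; rewrite /= lift0_max; exact: Rf.
rewrite EZhS; apply: (PD).
  apply: PN; apply: (ih (Dec U) (Dec V) (fun n => R n.+1)) => // [m i x|m x y e]; [exact: Rd|apply: RP; lia].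
apply: (AW_closed PD (U := Dec U) (R := fun n => R n.+1)) => // [p q a b epq Ra|]; last exact: Rd.
apply: (sh_closed PB (U := Dec U) (R := fun n => R n.+1)) => // [m i x|m x y e]; [exact: Rd|apply: RP; lia].
Qed.

End EZhBasic.

Section EZhHomotopy.
Variable A : zmodType.

(** Splitting off d_0 reduces the equation to the one for [Dec2 F]. In the terms with s_0, d_0 s_0 =
    1 and d_1 s_0 = 1 give the composites for F and for [Dec2 F]; the sums over the other faces in
    [E2] and [E3] cancel. *)
Lemma EZh_homotopy n (U V : sset_data) (axU : sset_axioms U) (axV : sset_axioms V)
    (F : cochain2 U V A) (u : U n) (v : V n) :
  EZh (cobd2 F) u v + cobd2 (fun n (u : U n) (v : V n) => EZh F u v) u v
  = AW (shc F) u v - F n u v.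
Proof.
elim: n U V axU axV F u v => [|n ih] U V axU axV F u v.
  rewrite /= addr0 sum_sgn_recl big_ord1 sgn_ord0 !face0_dgn0 // !face1_dgn0 //.
have axU' := Dec_axioms axU; have axV' := Dec_axioms axV.
have fnat k (i : 'I_k.+1) (W : sset_data) (ax : sset_axioms W) (x : Dec W k) :
  @sset_face W _ ord0 (sset_dgn i x) = sset_dgn i (@sset_face W k ord0 x) by exact: face0_dgn.
have ffnat k (i : 'I_k.+2) (W : sset_data) (ax : sset_axioms W) (x : Dec W k.+1) :
  @sset_face W _ ord0 (sset_face i x) = sset_face i (@sset_face W k.+1 ord0 x) by exact: face0_face.
have E1 : EZh (Dec2 (cobd2 F)) (u : Dec U n) (v : Dec V n)
    = EZh F (sset_face ord0 u) (sset_face ord0 v) - EZh (cobd2 (Dec2 F)) (u : Dec U n) (v : Dec V n).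
  rewrite -(@EZh_nat _ _ (Dec U) (Dec V) U V (fun n => @sset_face U n ord0)
    (fun n => @sset_face V n ord0)) => [||||]; try (by move=> *; (exact: fnat || exact: ffnat)).
  by rewrite -EZhN -EZhD; apply: EZh_ext => k a b e; move: a b; rewrite e => a b; exact: cobd2_Dec2.
have E2 : AW (shc (Dec2 (cobd2 F))) (sset_dgn ord0 u : Dec U n.+1) (sset_dgn ord0 v : Dec V n.+1)
    = AW (shc F) u v - AW (shc (Dec2 F)) (u : Dec U n) (v : Dec V n)
      + \sum_(i < n.+1) sgn i (AW (shc (Dec2 F))
         (sset_dgn ord0 (sset_face (lift ord0 i) u) : Dec U n)
         (sset_dgn ord0 (sset_face (lift ord0 i) v) : Dec V n)).
  rewrite -[in AW (shc F) u v](face0_dgn0 axU u) -[in AW (shc F) _ v](face0_dgn0 axV v).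
  rewrite -(@AW_nat _ _ (Dec U) (Dec V) U V (fun n => @sset_face U n ord0)
    (fun n => @sset_face V n ord0)); try (by move=> *; exact: ffnat).
  rewrite (_ : AW (shc (Dec2 (cobd2 F))) _ _ =
    AW (fun p q (a : Dec U p) (b : Dec V q) =>
        shc F (@sset_face U p ord0 a) (@sset_face V q ord0 b))
      (sset_dgn ord0 u : Dec U n.+1) (sset_dgn ord0 v : Dec V n.+1)
    - AW (shc (cobd2 (Dec2 F))) (sset_dgn ord0 u : Dec U n.+1) (sset_dgn ord0 v : Dec V n.+1));
    last first.
    rewrite -AWB; apply: AW_ext => p q a b e; apply: sh_Dec_cobd => //; lia.
  rewrite shaw_cobd // [cobd2 _ _ _]sum_sgn_recl [X in X - \sum_(i < _) _](_ : _ =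
     AW (shc (Dec2 F)) (u : Dec U n) (v : Dec V n)); last by rewrite /= !face1_dgn0.
  rewrite (_ : \sum_(i < n.+1) sgn i (AW (shc (Dec2 F)) (sset_face (lift ord0 i)
       (sset_dgn ord0 u : Dec U n.+1)) _) =
    \sum_(i < n.+1) sgn i (AW (shc (Dec2 F))
         (sset_dgn ord0 (sset_face (lift ord0 i) u) : Dec U n)
         (sset_dgn ord0 (sset_face (lift ord0 i) v) : Dec V n))); first by abel.
  by apply: eq_bigr => i _; rewrite /= !face_dgn0.
have E3 : \sum_(i < n.+1) sgn i (EZh F (sset_face (lift ord0 i) u) (sset_face (lift ord0 i) v))
   = - cobd2 (fun n (u : Dec U n) (v : Dec V n) => EZh (Dec2 F) u v) (u : Dec U n) (v : Dec V n)
     + \sum_(i < n.+1) sgn i (AW (shc (Dec2 F))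
         (sset_dgn ord0 (sset_face (lift ord0 i) u) : Dec U n)
         (sset_dgn ord0 (sset_face (lift ord0 i) v) : Dec V n)).
  case: (n) u v {E1 E2} => [|m] u v; first by rewrite /= oppr0 add0r.
  rewrite -sumrN -big_split; apply: eq_bigr => i _.
  by rewrite EZhS sgnD sgnN.
have := ih (Dec U) (Dec V) axU' axV' (Dec2 F) u v => {ih} E4.
rewrite [cobd2 _ u v]sum_sgn_recl E3 EZhS E1 E2.
rewrite (_ : F n.+1 u v = AW (shc (Dec2 F)) (u : Dec U n) (v : Dec V n)
   - (EZh (cobd2 (Dec2 F)) (u : Dec U n) (v : Dec V n)
     + cobd2 (fun n (u : Dec U n) (v : Dec V n) => EZh (Dec2 F) u v) (u : Dec U n) (v : Dec V n))).
  abel.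
by rewrite E4 opprB addrC subrK.
Qed.

Lemma EZh_const (C : Type) n (U V : sset_data) (axV : sset_axioms V)
    (e : forall n, U n -> C) (k : forall n, C -> V n -> A) (u : U n) (v : V n) :
  (forall n i (u : U n), e n.+1 (sset_dgn i u) = e n u) ->
  (forall n c i (v : V n), k n.+1 c (sset_dgn i v) = 0) ->
  EZh (fun n u v => k n (e n u) v) u v = 0.
Proof.
elim: n U V axV e k u v => [|n ih] U V axV e k u v he hk; first exact: hk.
rewrite EZhS [X in - X](ih (Dec U) (Dec V) (Dec_axioms axV) (fun n => e n.+1) (fun n => k n.+1));
  [|by move=> *; exact: he|by move=> *; exact: hk].
rewrite oppr0 add0r.
pose K p q (a : Dec U p) (b : Dec V q) := if p is 0 then k q.+1 (e p.+1 a) b else 0.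
rewrite (@AW_ext _ _ _ _ _ K); first by rewrite AW_degl0 // /K; exact: hk.
move=> p q a b _; apply: (@sh_const _ C p q (Dec U) (Dec V) (Dec_axioms axV)
  (fun n => e n.+1) (fun n => k n.+1)) => *; [exact: he|exact: hk].
Qed.

Lemma sh_Dec_AW p q (U V : sset_data) (axU : sset_axioms U) (axV : sset_axioms V)
    (K : bicochain U V A) (u : Dec U p) (v : Dec V q) : binormalised K ->
  sh (Dec2 (fun n (u : U n) (v : V n) => AW K u v)) u v
  = (if p is 0 then K 0%N q.+1 (vertex0 (u : U p.+1)) (v : V q.+1) else 0)
    + Decl K u (sset_face ord0 (v : V q.+1)).
Proof.
move=> nK.
rewrite -(@sh_const A (U 0) p q (Dec U) (Dec V) (Dec_axioms axV)
  (fun n => @vertex0 U n.+1) (fun n c (v : Dec V n) => K 0%N n.+1 c v)) //.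
- rewrite -(@sh_AW A p q (Dec U) V (Dec_axioms axU) axV (Decl K)); last first.
    by split=> *; [exact: nK.1|exact: nK.2].
  rewrite -(@sh_nat A p q (Dec U) (Dec V) (Dec U) V (fun n => id)
     (fun n => @sset_face V n ord0)) //; last by move=> n i x; exact: face0_dgn.
  by rewrite -shD.
- by move=> n i x /=; exact: vertex0_dec_dgn.
- by move=> *; exact: nK.2.
Qed.

(** Side condition of the homotopy, in transposed form: the Alexander-Whitney map annihilates its
    values. Because of it psi vanishes on [ell] below. *)
Lemma EZh_AW n (U V : sset_data) (axU : sset_axioms U) (axV : sset_axioms V)
    (K : bicochain U V A) (u : U n) (v : V n) :
  binormalised K -> EZh (fun n (u : U n) (v : V n) => AW K u v) u v = 0.
Proof.
elim: n U V axU axV K u v => [|n ih] U V axU axV K u v nK.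
  exact: (AW_normalised axU axV nK).
have nK' : binormalised (Decl K) by split=> *; [exact: nK.1|exact: nK.2].
rewrite EZhS.
have -> : EZh (Dec2 (fun n (u : U n) (v : V n) => AW K u v)) (u : Dec U n) (v : Dec V n) = 0.
  rewrite (@EZh_ext A n (Dec U) (Dec V) _ (fun n (a : Dec U n) (b : Dec V n) =>
     K 0%N n.+1 (@vertex0 U n.+1 a) b + AW (Decl K) a (@sset_face V n ord0 b))) //.
  rewrite EZhD (@EZh_const (U 0) n (Dec U) (Dec V) (Dec_axioms axV)
    (fun n => @vertex0 U n.+1) (fun n c (v : Dec V n) => K 0%N n.+1 c v)); last first.
  - by move=> *; exact: nK.2.
  - by move=> m i x /=; exact: vertex0_dec_dgn.
  rewrite add0r (@EZh_nat A n (Dec U) (Dec V) (Dec U) V (fun n => id)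
     (fun n => @sset_face V n ord0) (fun n u v => AW (Decl K) u v)) //.
  - exact: (ih (Dec U) V (Dec_axioms axU)).
  - by move=> *; exact: face0_dgn.
  - by move=> *; exact: face0_face.
rewrite oppr0 add0r.
pose K0 p q (a : Dec U p) (b : Dec V q) := if p is 0 then K 0%N q.+1 (@vertex0 U p.+1 a) b else 0.
rewrite (@AW_ext _ _ _ _ _ (fun p q a b => K0 p q a b + Decl K a (@sset_face V q ord0 b))); last first.
  by move=> p q a b _; exact: sh_Dec_AW.
rewrite AWD AW_degl0 // {1}/K0 nK.2 add0r.
rewrite (@AW_nat A n.+1 (Dec U) (Dec V) (Dec U) V (fun n => id) (fun n => @sset_face V n ord0) (Decl K)) //;
  last by move=> *; exact: face0_face.
rewrite face0_dgn0 // AW_Dec_dgn0 // -[RHS](@AW0 A n.+1 U V u v).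
by apply: AW_ext => p q a b _; exact: nK.1.
Qed.

(** As a map from [Dec U] to [Dec (Dec U)], s_0 commutes with faces and degeneracies. It can be
    moved inside [EZh], where F then meets common degeneracies only. *)
Lemma EZh_Dec_dgn0 n (U V : sset_data) (axU : sset_axioms U) (axV : sset_axioms V)
    (F : cochain2 U V A) (u : U n) (v : V n) : normalised2 F ->
  EZh (Dec2 F) (sset_dgn ord0 u : Dec U n) (sset_dgn ord0 v : Dec V n) = 0.
Proof.
move=> nF; case: n u v => [|n] u v.
  by rewrite /= !dgn_dgn0 //; exact: nF.
have sd (W : sset_data) (axW : sset_axioms W) k (i : 'I_k.+1) (x : Dec W k) :
  @sset_dgn W k.+2 ord0 (sset_dgn i x) = @sset_dgn (Dec (Dec W)) _ i (@sset_dgn W k.+1 ord0 x).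
  by rewrite /= dgn_dgn0.
have sf (W : sset_data) (axW : sset_axioms W) k (i : 'I_k.+2) (x : Dec W k.+1) :
  @sset_dgn W k.+1 ord0 (sset_face i x) = @sset_face (Dec (Dec W)) _ i (@sset_dgn W k.+2 ord0 x).
  by rewrite /= face_dgn0.
rewrite EZhS.
rewrite -(@EZh_nat A n (Dec U) (Dec V) (Dec (Dec U)) (Dec (Dec V))
  (fun n => @sset_dgn U n.+1 ord0) (fun n => @sset_dgn V n.+1 ord0)) //;
  try (by move=> *; (exact: sd || exact: sf)).
have Es (W : sset_data) (axW : sset_axioms W) (w : W n.+1) :
  @sset_dgn (Dec W) _ ord0 (sset_dgn ord0 w) = @sset_dgn W n.+2 ord0 (@sset_dgn W n.+1 ord0 w).
  exact: (dgn_dgn0 axW ord0 w).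
rewrite !Es // -(@shaw_nat A n.+1 (Dec U) (Dec V) (Dec (Dec U)) (Dec (Dec V))
  (fun n => @sset_dgn U n.+1 ord0) (fun n => @sset_dgn V n.+1 ord0)) //;
  try (by move=> *; (exact: sd || exact: sf)).
rewrite (@EZh_ext A n (Dec U) (Dec V) _ (fun _ _ _ => 0)); last by move=> *; exact: nF.
rewrite EZh0 oppr0 add0r -[RHS](@AW0 A n.+1 (Dec U) (Dec V) (sset_dgn ord0 u) (sset_dgn ord0 v)).
apply: AW_ext => p q a b _; rewrite -[RHS](@sh0 A p q (Dec U) (Dec V) a b).
by apply: sh_ext => m x y _; exact: nF.
Qed.

Lemma EZh_normalised (U V : sset_data) (axU : sset_axioms U) (axV : sset_axioms V)
    (F : cochain2 U V A) : normalised2 F ->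
  normalised2 (fun n (u : U n) (v : V n) => EZh F u v).
Proof.
move=> nF n i u v.
elim: n U V axU axV F nF i u v => [|n ih] U V axU axV F nF i u v.
  rewrite EZhS (ord1 i) EZh_Dec_dgn0 // oppr0 add0r -(dgn_dgn0 axU) -(dgn_dgn0 axV).
  apply: (shaw_normalised (Dec_axioms axU) (Dec_axioms axV)); exact: Dec2_normalised.
rewrite EZhS -(dgn_dgn0 axU) -(dgn_dgn0 axV).
rewrite [X in _ + X](shaw_normalised (Dec_axioms axU) (Dec_axioms axV) (Dec2_normalised nF)) addr0.
case: (ord0P i) => [->|[j ->]]; first by rewrite EZh_Dec_dgn0 // oppr0.
by rewrite [X in - X](ih (Dec U) (Dec V) (Dec_axioms axU) (Dec_axioms axV) _ (Dec2_normalised nF)) oppr0.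
Qed.

End EZhHomotopy.

(** * Coassociativity of the Alexander-Whitney map *)

Definition Prod (U V : sset_data) : sset_data :=
  @SSetData (fun n => (U n * V n)%type)
    (fun n i x => (sset_face i x.1, sset_face i x.2))
    (fun n i x => (sset_dgn i x.1, sset_dgn i x.2)).

Lemma vertex0_prod (U V : sset_data) n (u : U n) (v : V n) :
  vertex0 ((u, v) : Prod U V n) = (vertex0 u, vertex0 v).
Proof. by elim: n u v => [//|n ih] u v /=; rewrite -ih. Qed.

Section Coassociativity.
Variable A : zmodType.

Lemma AW_const (C : Type) n (U V : sset_data) (e : forall n, U n -> C)
    (K : C -> bicochain U V A) (u : U n) (v : V n) :
  (forall n (x : U n.+1), e n (sset_face ord_max x) = e n.+1 x) ->
  AW (fun p q (u : U p) (v : V q) => K (e p u) p q u v) u v = AW (K (e n u)) u v.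
Proof.
elim: n U e K u v => [//|n ih] U e K u v he; rewrite !AWS.
have -> : e 0%N (vertex0 u) = e n.+1 u.
  by elim: n.+1 u => [//|m ihm] x /=; rewrite ihm he.
congr (_ + _); apply: (ih (Dec U) (fun n => e n.+1) (fun c => Decl (K c))) => m x /=.
by rewrite lift0_max he.
Qed.

(** By induction on n: the triples whose first member is a vertex are split off on both sides, and
    the others belong to [Dec U]. The three simplicial sets are distinct since the applications mix
    GX with [Dec X] and X. *)
Lemma AW_coassoc n (U V W : sset_data) (axU : sset_axioms U) (axV : sset_axioms V)
    (K : forall p q r, U p -> V q -> W r -> A) (u : U n) (v : V n) (w : W n) :
  AW (fun p m (a : U p) (x : Prod V W m) =>
        AW (fun q r (b : V q) (c : W r) => K p q r a b c) x.1 x.2)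
    u ((v, w) : Prod V W n)
  = AW (fun m r (x : Prod U V m) (c : W r) =>
        AW (fun p q (a : U p) (b : V q) => K p q r a b c) x.1 x.2)
    ((u, v) : Prod U V n) w.
Proof.
elim: n U V axU axV K u v w => [//|n ih] U V axU axV K u v w.
rewrite [LHS]AWS [RHS]AWS.
rewrite [AW (Decl _) _ _](ih (Dec U) V (Dec_axioms axU) axV (fun p => K p.+1)
  (u : Dec U n) (@sset_face V n ord0 v) (@sset_face W n ord0 w)).
rewrite [X in X + _]AWS -addrA; congr (_ + _).
  by rewrite vertex0_prod.
pose e n (x : Prod (Dec U) (Dec V) n) : U 0 := @vertex0 U n.+1 x.1.
rewrite (_ : AW (Decl (fun m r (x : Prod U V m) (c : W r) =>
        AW (fun p q (a : U p) (b : V q) => K p q r a b c) x.1 x.2)) _ _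
  = AW (fun m r (x : Prod (Dec U) (Dec V) m) (c : W r) =>
      K 0%N m.+1 r (e m x) (x.2 : V m.+1) c) ((u, v) : Prod (Dec U) (Dec V) n) (sset_face ord0 w)
   + AW (fun m r (x : Prod (Dec U) (Dec V) m) (c : W r) =>
       AW (fun p q (a : Dec U p) (b : V q) => K p.+1 q r a b c) x.1 (@sset_face V m ord0 x.2))
       ((u, v) : Prod (Dec U) (Dec V) n) (sset_face ord0 w)); last by rewrite -AWD.
congr (_ + _).
  rewrite (@AW_const (U 0) n (Prod (Dec U) (Dec V)) W e
     (fun c0 m r (x : Prod (Dec U) (Dec V) m) c => K 0%N m.+1 r c0 x.2 c)); last first.
    by move=> m x; rewrite /e /= lift0_max.
  by rewrite (@AW_nat A n (Prod (Dec U) (Dec V)) W (Dec V) W (fun n x => x.2) (fun n => id)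
    (fun m r b c => K 0%N m.+1 r (e n (u, v)) b c)).
rewrite (@AW_nat A n (Prod (Dec U) (Dec V)) W (Prod (Dec U) V) W
  (fun n x => (x.1, @sset_face V n ord0 x.2)) (fun n => id)
  (fun m r x c => AW (fun p q (a : Dec U p) (b : V q) => K p.+1 q r a b c) x.1 x.2)) //.
by move=> m [x y] /=; rewrite face0_face.
Qed.

End Coassociativity.

(** * Unit and associativity of the shuffle map *)

Section ShUnit.
Variable A : zmodType.

Lemma sh_unitl q (U V : sset_data) (F : cochain2 U V A) (e : forall n, U n) (v : V q) :
  (forall n i, sset_dgn i (e n) = e n.+1) -> sh F (e 0%N) v = F q (e q) v.
Proof.
elim: q U V F e v => [//|q ih] U V F e v he; rewrite sh0S he.
by rewrite (ih (Dec U) (Dec V) (Dec2 F) (fun n => e n.+1)) // => *; exact: he.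
Qed.

Lemma sh_unitr p (U V : sset_data) (F : cochain2 U V A) (u : U p) (e : forall n, V n) :
  (forall n i, sset_dgn i (e n) = e n.+1) -> sh F u (e 0%N) = F p u (e p).
Proof.
elim: p U V F u e => [//|p ih] U V F u e he; rewrite shS0 he.
by rewrite (ih (Dec U) (Dec V) (Dec2 F) u (fun n => e n.+1)) // => *; exact: he.
Qed.

End ShUnit.

Section Associativity.
Variable A : zmodType.

Definition sh_stepl p q (U V : sset_data) (F : cochain2 U V A) : U p -> V q -> A :=
  match p with
  | 0 => fun _ _ => 0
  | p'.+1 => fun u v => sh (Dec2 F) (u : Dec U p') (sset_dgn ord0 v : Dec V q)
  end.

Definition sh_stepr p q (U V : sset_data) (F : cochain2 U V A) : U p -> V q -> A :=
  match q with
  | 0 => fun _ _ => 0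
  | q'.+1 => fun u v => sh (Dec2 F) (sset_dgn ord0 u : Dec U p) (v : Dec V q')
  end.

Lemma sh_step p q (U V : sset_data) (F : cochain2 U V A) (u : U p) (v : V q) :
  (0 < p + q)%N -> sh F u v = sh_stepl F u v + sgn p (sh_stepr F u v).
Proof.
case: p u => [|p] u; case: q v => [|q] v //= _.
- by rewrite add0r.
- by rewrite sgn0 addr0.
- by rewrite sgnS.
Qed.

Definition cochain3 (U V W : sset_data) := forall n, U n -> V n -> W n -> A.

Definition sh_left (U V W : sset_data) (F : cochain3 U V W) p q r (x : U p) (y : V q) (z : W r) : A :=
  sh (fun n u v => sh (fun k (a : Prod U V k) c => F k a.1 a.2 c) ((u, v) : Prod U V n) z) x y.

Definition sh_right (U V W : sset_data) (F : cochain3 U V W) p q r (x : U p) (y : V q) (z : W r) : A :=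
  sh (fun n v w => sh (fun k a (c : Prod V W k) => F k a c.1 c.2) x ((v, w) : Prod V W n)) y z.

Definition Dec3 (U V W : sset_data) (F : cochain3 U V W) :
  cochain3 (Dec U) (Dec V) (Dec W) := fun n => F n.+1.

(** The recursion for triple shuffles by the first step of a lattice path in dimension three. Both
    bracketings satisfy it, and hence they agree. *)
Definition triple_rec (T : forall U V W : sset_data, cochain3 U V W ->
      forall p q r, U p -> V q -> W r -> A)
    (U V W : sset_data) (F : cochain3 U V W) p q r (x : U p) (y : V q) (z : W r) : A :=
  match p return U p -> A with
  | 0 => fun _ => 0
  | p'.+1 => fun x => T (Dec U) (Dec V) (Dec W) (Dec3 F) p' q r x (sset_dgn ord0 y) (sset_dgn ord0 z)
  end x
  + sgn p (match q return V q -> A with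
  | 0 => fun _ => 0
  | q'.+1 => fun y => T (Dec U) (Dec V) (Dec W) (Dec3 F) p q' r (sset_dgn ord0 x) y (sset_dgn ord0 z)
  end y)
  + sgn (p + q) (match r return W r -> A with
  | 0 => fun _ => 0
  | r'.+1 => fun z => T (Dec U) (Dec V) (Dec W) (Dec3 F) p q r' (sset_dgn ord0 x) (sset_dgn ord0 y) z
  end z).

Lemma sh_left_rec (U V W : sset_data) (axU : sset_axioms U) (axV : sset_axioms V)
    (F : cochain3 U V W) p q r (x : U p) (y : V q) (z : W r) : (0 < p + q + r)%N ->
  sh_left F x y z = triple_rec sh_left F x y z.
Proof.
move=> pqr; pose F' k (a : Prod U V k) c := F k a.1 a.2 c.
have [e|pq] : (p + q = 0)%N \/ (0 < p + q)%N by lia.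
  have p0 : p = 0%N by lia. have q0 : q = 0%N by lia.
  move: pqr x y; rewrite p0 q0 => {e}; case: r z => // r z _ x y.
  by rewrite /triple_rec !add0r.
(* First step of the outer shuffle: [Gl] moves the pair (u, v), while [Gr] moves z and is used with
   u and v degenerated together. The inner shuffle then divides the moves of the pair between x and
   y. *)
pose G n (u : U n) (v : V n) := sh F' ((u, v) : Prod U V n) z.
pose Gl n (u : U n.+1) (v : V n.+1) :=
  sh (Dec2 F') ((u, v) : Dec (Prod U V) n) (sset_dgn ord0 z : Dec W r).
pose Gr n (u : U n.+1) (v : V n.+1) : A := match r return W r -> A with
  | 0 => fun _ => 0
  | r'.+1 => fun z => sh (Dec2 F') ((u, v) : Dec (Prod U V) n) (z : Dec W r')
  end z.
have GE n (u : U n.+1) (v : V n.+1) : G n.+1 u v = Gl n u v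
    + sgn n.+1 (Gr n.+1 (sset_dgn ord0 u) (sset_dgn ord0 v)).
  rewrite /G sh_step //; congr (_ + sgn _ _).
  by rewrite /Gr; clear G Gl Gr; case: (r) z.
have E p' q' (a : Dec U p') (b : Dec V q') : (p' + q').+1 = (p + q)%N -> sh (Dec2 G) a b
    = sh (fun n (u : Dec U n) (v : Dec V n) => Gl n u v) a b
    + sgn (p + q) (sh (Dec2 (fun n (u : U n) (v : V n) =>
         Gr n (sset_dgn ord0 u) (sset_dgn ord0 v))) a b).
  by move=> e; rewrite -sh_sgn -shD; apply: sh_ext => n u v en; rewrite -e -en -GE.
rewrite [LHS](_ : _ = sh G x y) // sh_step // /triple_rec.
have -> : match r return W r -> A with
    | 0 => fun _ => 0
    | r'.+1 => fun z => sh_left (Dec3 F) (sset_dgn ord0 x : Dec U p) (sset_dgn ord0 y : Dec V q) (z : Dec W r')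
    end z = sh (fun n (u : U n) (v : V n) => Gr n (sset_dgn ord0 u) (sset_dgn ord0 v)) x y.
  rewrite /Gr; clear G Gl Gr GE E; case: (r) z => [|r'] z'; first by rewrite sh0.
  by rewrite -(@sh_Dec_dgn0 A p q U V axU axV (fun n (u : Dec U n) (v : Dec V n) => sh (Dec2 F') ((u, v) : Dec (Prod U V) n) (z' : Dec W r'))).
rewrite [X in sgn (p + q) X]sh_step // sgnD.
set Gd := fun n (u : U n) (v : V n) => _.
have -> : sh_stepl G x y = match p return U p -> A with
  | 0 => fun _ => 0
  | p'.+1 => fun x => sh_left (Dec3 F) (x : Dec U p') (sset_dgn ord0 y : Dec V q) (sset_dgn ord0 z : Dec W r)
  end x + sgn (p + q) (sh_stepl Gd x y).
  move: E; case: (p) x => [|p'] x' E; first by rewrite /= sgn0 addr0.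
  by rewrite /= E.
have -> : sh_stepr G x y = match q return V q -> A with
  | 0 => fun _ => 0
  | q'.+1 => fun y => sh_left (Dec3 F) (sset_dgn ord0 x : Dec U p) (y : Dec V q') (sset_dgn ord0 z : Dec W r)
  end y + sgn (p + q) (sh_stepr Gd x y).
  move: E; case: (q) y => [|q'] y' E; first by rewrite /= sgn0 addr0.
  by rewrite /= E ?addnS.
rewrite sgnD [sgn p (sgn (p + q) _)]sgnC; abel.
Qed.

Lemma sh_right_rec (U V W : sset_data) (axV : sset_axioms V) (axW : sset_axioms W)
    (F : cochain3 U V W) p q r (x : U p) (y : V q) (z : W r) : (0 < p + q + r)%N ->
  sh_right F x y z = triple_rec sh_right F x y z.
Proof.
move=> pqr; pose F' k a (c : Prod V W k) := F k a c.1 c.2.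
have [e|qr] : (q + r = 0)%N \/ (0 < q + r)%N by lia.
  have q0 : q = 0%N by lia. have r0 : r = 0%N by lia.
  move: pqr y z; rewrite q0 r0 => {e}; case: p x => // p x _ y z.
  by rewrite /triple_rec !sgn0 !addr0.
pose G n (v : V n) (w : W n) := sh F' x ((v, w) : Prod V W n).
pose Gl n (v : V n.+1) (w : W n.+1) : A := match p return U p -> A with
  | 0 => fun _ => 0
  | p'.+1 => fun x => sh (Dec2 F') (x : Dec U p') ((v, w) : Dec (Prod V W) n)
  end x.
pose Gr n (v : V n.+1) (w : W n.+1) :=
  sh (Dec2 F') (sset_dgn ord0 x : Dec U p) ((v, w) : Dec (Prod V W) n).
have GE n (v : V n.+1) (w : W n.+1) : G n.+1 v w = Gl n.+1 (sset_dgn ord0 v) (sset_dgn ord0 w)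
    + sgn p (Gr n v w).
  rewrite /G sh_step ?addnS //; congr (_ + sgn _ _).
  by rewrite /Gl; clear G Gl Gr; case: (p) x.
have E q' r' (b : Dec V q') (c : Dec W r') : sh (Dec2 G) b c
    = sh (Dec2 (fun n (v : V n) (w : W n) =>
         Gl n (sset_dgn ord0 v) (sset_dgn ord0 w))) b c
    + sgn p (sh (fun n (v : Dec V n) (w : Dec W n) => Gr n v w) b c).
  by rewrite -sh_sgn -shD; apply: sh_ext => n u v en; rewrite -GE.
rewrite [LHS](_ : _ = sh G y z) // sh_step // /triple_rec.
have -> : match p return U p -> A with
    | 0 => fun _ => 0
    | p'.+1 => fun x => sh_right (Dec3 F) (x : Dec U p') (sset_dgn ord0 y : Dec V q) (sset_dgn ord0 z : Dec W r)
    end x = sh (fun n (v : V n) (w : W n) => Gl n (sset_dgn ord0 v) (sset_dgn ord0 w)) y z.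
  rewrite /Gl; clear G Gl Gr GE E; case: (p) x => [|p'] x'; first by rewrite sh0.
  by rewrite -(@sh_Dec_dgn0 A q r V W axV axW (fun n (v : Dec V n) (w : Dec W n) => sh (Dec2 F') (x' : Dec U p') ((v, w) : Dec (Prod V W) n))).
rewrite [X in _ = X + _ + _]sh_step //.
set Gd := fun n (v : V n) (w : W n) => _.
have -> : sh_stepl G y z = sh_stepl Gd y z + sgn p (match q return V q -> A with
  | 0 => fun _ => 0
  | q'.+1 => fun y => sh_right (Dec3 F) (sset_dgn ord0 x : Dec U p) (y : Dec V q') (sset_dgn ord0 z : Dec W r)
  end y).
  move: E; case: (q) y => [|q'] y' E; first by rewrite /= sgn0 addr0.
  by rewrite /= E.
have -> : sh_stepr G y z = sh_stepr Gd y z + sgn p (match r return W r -> A with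
  | 0 => fun _ => 0
  | r'.+1 => fun z => sh_right (Dec3 F) (sset_dgn ord0 x : Dec U p) (sset_dgn ord0 y : Dec V q) (z : Dec W r')
  end z).
  move: E; case: (r) z => [|r'] z' E; first by rewrite /= sgn0 addr0.
  by rewrite /= E.
rewrite sgnD -[sgn q (sgn p _)]sgn_add [(q + p)%N]addnC; abel.
Qed.

Lemma sh_assoc (U V W : sset_data) (axU : sset_axioms U) (axV : sset_axioms V)
    (axW : sset_axioms W) (F : cochain3 U V W) p q r (x : U p) (y : V q) (z : W r) :
  sh_left F x y z = sh_right F x y z.
Proof.
have [n] := ubnP (p + q + r); elim: n U V W axU axV axW F p q r x y z
  => [//|n ih] U V W axU axV axW F p q r x y z lt.
have axU' := Dec_axioms axU; have axV' := Dec_axioms axV; have axW' := Dec_axioms axW.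
have [e|pqr] : (p + q + r = 0)%N \/ (0 < p + q + r)%N by lia.
  have p0 : p = 0%N by lia. have q0 : q = 0%N by lia. have r0 : r = 0%N by lia.
  by move: x y z; rewrite p0 q0 r0.
rewrite sh_left_rec // sh_right_rec // /triple_rec; congr (_ + sgn _ _ + sgn _ _).
- case: p x lt {pqr} => // p x lt; apply: ih => //; lia.
- case: q y lt {pqr} => // q y lt; apply: ih => //; lia.
- case: r z lt {pqr} => // r z lt; apply: ih => //; lia.
Qed.

End Associativity.

(** * Linear extension and normalised chains *)

Section LinearExtension.
Variables (K : choiceType) (V : zmodType) (f : K -> V).

Lemma linextEw (c : {malg int[K]}) (d : {fset K}) : (msupp c `<=` d)%fset ->
  linext f c = \sum_(k <- d) f k *~ c@_k.
Proof.
move=> le; apply: big_fset_incl => // k _ /mcoeff_outdom ->; by rewrite mulr0z.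
Qed.

Lemma linext_is_additive : zmod_morphism (linext f).
Proof.
move=> b c.
rewrite (@linextEw b (msupp b `|` msupp c)%fset) ?fsubsetUl //.
rewrite (@linextEw c (msupp b `|` msupp c)%fset) ?fsubsetUr //.
rewrite (@linextEw (b - c) (msupp b `|` msupp c)%fset) ?msuppB_le //.
by rewrite -sumrB; apply: eq_bigr => k _; rewrite mcoeffB mulrzBr.
Qed.

HB.instance Definition _ := GRing.isZmodMorphism.Build _ _ (linext f) linext_is_additive.

Lemma linextU k : linext f << k >> = f k.
Proof. by rewrite /linext msuppU /= big_seq_fset1 mcoeffUU mulr1z. Qed.

Lemma linext_mem (P : V -> Prop) (c : {malg int[K]}) :
  P 0 -> (forall a b, P a -> P b -> P (a - b)) ->
  (forall k, k \in msupp c -> P (f k)) -> P (linext f c).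
Proof.
move=> P0 PB h.
have PN a : P a -> P (- a) by move=> Pa; rewrite -[- a]add0r; exact: PB.
have PD a b : P a -> P b -> P (a + b).
  by move=> Pa Pb; rewrite -[b]opprK; apply: PB => //; exact: PN.
rewrite /linext big_seq; apply: (big_ind P) => // k kc.
have PM n : P (f k *+ n) by elim: n => [|n ihn]; rewrite ?mulr0n // mulrS; apply: (PD) => //; exact: h.
by case: c@_k => n; [exact: PM|apply: PN; exact: PM].
Qed.

Lemma linext_ext (g : K -> V) (c : {malg int[K]}) : f =1 g -> linext f c = linext g c.
Proof. by move=> e; apply: eq_bigr => k _; rewrite e. Qed.

End LinearExtension.

Lemma malg_mem (K : choiceType) (P : {malg int[K]} -> Prop) (c : {malg int[K]}) :
  P 0 -> (forall a b, P a -> P b -> P (a - b)) ->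
  (forall k, k \in msupp c -> P << k >>) -> P c.
Proof.
move=> P0 PB h; rewrite (_ : c = linext (fun k => << k >>) c); first exact: linext_mem.
rewrite [LHS]monalgE /linext; apply: eq_bigr => k _.
by rewrite -raddfMz /= intz.
Qed.

Definition Dec1 (X : sset_data) (V : Type) (F : forall n, X n -> V) :
  forall n, Dec X n -> V := fun n => F n.+1.

Definition normalised (X : sset_data) (V : zmodType) (F : forall n, X n -> V) : Prop :=
  forall n i (x : X n), F n.+1 (sset_dgn i x) = 0.

Definition cobd (X : sset_data) (V : zmodType) (F : forall n, X n -> V) : forall n, X n -> V :=
  fun n => match n with
  | 0 => fun=> 0
  | m.+1 => fun x => \sum_(i < m.+2) sgn i (F m (sset_face i x))
  end.

Section Chains.
Variables (X : sset_data).

Definition lin (V : zmodType) (F : forall n, X n -> V) : chains X -> V :=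
  linext (fun b : nondeg X => F (tag (val b)) (tagged (val b))).

HB.instance Definition _ V F := GRing.Additive.on (@lin V F).

Lemma chain_degenerate n (x : X n) : degenerate x -> chain (simp x) = 0.
Proof.
move=> dx; rewrite /chain insubF //=; apply/negbTE; rewrite negbK.
exact/asboolP.
Qed.

Lemma chain_dgn n i (x : X n) : chain (simp (sset_dgn i x)) = 0.
Proof. by apply: chain_degenerate; exists i, x. Qed.

Lemma lin_chain (V : zmodType) (F : forall n, X n -> V) n (x : X n) :
  normalised F -> lin F (chain (simp x)) = F n x.
Proof.
move=> nF; have [dx|ndx] := pselect (degenerate x).
  rewrite chain_degenerate // raddf0; case: n x dx => // n x [i [y ->]].
  by rewrite nF.
have h : ~~ `[< degenerate (tagged (simp x) : X (tag (simp x))) >] by apply/asboolPn.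
rewrite /chain (insubT (fun s : simplex X => ~~ `[< degenerate (tagged s : X (tag s)) >]) h) /lin.
by rewrite linextU.
Qed.

Lemma nondeg_chain (b : nondeg X) : << b >> = chain (simp (tagged (val b) : X (tag (val b)))).
Proof.
have e : simp (tagged (val b) : X (tag (val b))) = val b by case: (val b).
rewrite /chain e; case: insubP => [u _ /val_inj -> //|].
by rewrite (valP b).
Qed.

Lemma chains_mem (P : chains X -> Prop) n c : chains_in n c ->
  P 0 -> (forall a b, P a -> P b -> P (a - b)) ->
  (forall x : X n, P (chain (simp x))) -> P c.
Proof.
move=> cn P0 PB h; apply: malg_mem => // k kc.
have := cn _ kc; rewrite nondeg_chain /dim.
by case: (val k) => m x /= e; move: x; rewrite e => x; exact: h.
Qed.

Lemma chains_ind (P : chains X -> Prop) c :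
  P 0 -> (forall a b, P a -> P b -> P (a - b)) ->
  (forall n (x : X n), P (chain (simp x))) -> P c.
Proof. by move=> P0 PB h; apply: malg_mem => // k _; rewrite nondeg_chain; exact: h. Qed.

Lemma chains_in0 n : chains_in n (0 : chains X).
Proof. by move=> b; rewrite msupp0. Qed.

Lemma chains_inB n (a b : chains X) : chains_in n a -> chains_in n b -> chains_in n (a - b).
Proof.
move=> ha hb k /(fsubsetP (msuppB_le _ _)); rewrite in_fsetU.
by case/orP; [exact: ha|exact: hb].
Qed.

Lemma chains_in_chain n (x : X n) : chains_in n (chain (simp x)).
Proof.
rewrite /chain; case: insubP => [u _ e|_]; last exact: chains_in0.
by move=> b; rewrite msuppU /= in_fset1 => /eqP ->; rewrite e.
Qed.

End Chains.

Section Cobd.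
Variable V : zmodType.

Lemma cobdS (X : sset_data) (F : forall n, X n -> V) n (x : X n.+2) :
  cobd F x = F n.+1 (sset_face ord0 x) - cobd (Dec1 F) (x : Dec X n.+1).
Proof. exact: sum_sgn_recl. Qed.

Lemma cobd_normalised (X : sset_data) (ax : sset_axioms X) (F : forall n, X n -> V) :
  normalised F -> normalised (cobd F).
Proof.
move=> nF n; elim: n X ax F nF => [|n ih] X ax F nF i x.
  by rewrite (ord1 i) /= sum_sgn_recl big_ord1 sgn_ord0 face0_dgn0 // face1_dgn0 // subrr.
rewrite cobdS; case: (ord0P i) => [->|[j ->]].
  case: n ih x i => [|n] ih x i.
    rewrite face0_dgn0 // [cobd _ _]sum_sgn_recl big_ord1 sgn_ord0 /Dec1 /=.
    by rewrite face1_dgn0 // face_dgn0 // nF subr0 subrr.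
  rewrite cobdS face0_dgn0 // /Dec1 [sset_face _ _]face1_dgn0 //.
  rewrite opprB addrCA subrr addr0 /= big1 // => k _.
  by rewrite face_dgn0 // nF sgn0.
rewrite face0_dgn // nF sub0r.
by rewrite (ih (Dec X) (Dec_axioms ax) (Dec1 F)) ?oppr0 // => m k y; exact: nF.
Qed.

(** When d_0 is split off twice, the two terms [cobd F] at d_0 x cancel and the same double
    coboundary over the decalage remains. *)
Lemma cobd_cobd (X : sset_data) (ax : sset_axioms X) (F : forall n, X n -> V) n (x : X n) :
  cobd (cobd F) x = 0.
Proof.
elim: n X ax F x => [//|n ih] X ax F x.
case: n ih x => [|[|n]] ih x; first by rewrite /= big1 // => i _; rewrite sgn0.
  have d11 : sset_face (lift ord0 ord0) (sset_face (lift ord0 (lift ord0 ord0)) x)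
      = sset_face (lift ord0 ord0) (sset_face (lift ord0 ord0) x).
    have := @face_face _ ax 0%N 1%N 1%N x isT.
    by rewrite -!faceE.
  rewrite /= !sum_sgn_recl !big_ord0 !subr0 !face0_face // d11; abel.
rewrite cobdS (_ : cobd (Dec1 (cobd F)) _ = cobd F (sset_face ord0 x)
   - cobd (cobd (Dec1 F)) (x : Dec X n.+2)).
  by rewrite ih ?subr0 ?subrr //; exact: Dec_axioms.
rewrite /= -sumrB; apply: eq_bigr => i _.
by rewrite -sgnB -face0_face //; congr sgn; exact: cobdS.
Qed.

End Cobd.

(** * Shuffles as permutations and the shuffle product *)

Section ShuffleSums.
Variable V : zmodType.

(* [shuffle_sum p q Psi] is the signed sum of [Psi nu mu] over the shuffles
   (nu, mu), according to the first step of the lattice path *)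
Fixpoint shuffle_sum (p : nat) : nat -> (seq nat -> seq nat -> V) -> V :=
  match p with
  | 0 => fix shuffle_sum0 q Psi :=
      match q with
      | 0 => Psi [::] [::]
      | q'.+1 => shuffle_sum0 q' (fun ns ms => Psi (map S ns) (0%N :: map S ms))
      end
  | p'.+1 => fix shuffle_sumS q Psi :=
      match q with
      | 0 => shuffle_sum p' 0%N (fun ns ms => Psi (0%N :: map S ns) (map S ms))
      | q'.+1 => shuffle_sum p' q (fun ns ms => Psi (0%N :: map S ns) (map S ms))
          - sgn p' (shuffle_sumS q' (fun ns ms => Psi (map S ns) (0%N :: map S ms)))
      end
  end.

Definition perm_val N (s : 'S_N) (i : nat) : nat :=
  if insub i is Some j then s j : nat else 0%N.

Lemma perm_valE N (s : 'S_N) (i : 'I_N) : perm_val s i = s i.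
Proof. by rewrite /perm_val valK. Qed.

(** For i < j, the places lie in one block exactly if j < p or p <= i. The size N is a separate
    parameter, which spares casts along p + q = N in the induction. *)
Definition shuffles p N (s : 'S_N) : bool :=
  [forall i : 'I_N, forall j : 'I_N,
     ((i < j)%N && ((j < p)%N || (p <= i)%N)) ==> (s i < s j)%N].

(** In [sgn s] the permutation is coerced to its parity. *)
Definition shuffle_eval p q N (Psi : seq nat -> seq nat -> V) (s : 'S_N) : V :=
  sgn s (Psi [seq perm_val s i | i <- iota 0 p] [seq perm_val s i | i <- iota p q]).

(** As in the cofactor expansion of a determinant: a permutation that takes i0 to 0 is the extension
    of a unique permutation of the remaining places. *)
Lemma reindex_lift_perm N (i0 : 'I_N.+1) (P : pred 'S_N.+1) (F : 'S_N.+1 -> V) :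
  \sum_(s : 'S_N.+1 | P s && (s i0 == ord0)) F s
  = \sum_(s : 'S_N | P (lift_perm i0 ord0 s)) F (lift_perm i0 ord0 s).
Proof.
rewrite (reindex (lift_perm i0 ord0)); last first.
  pose ulsf i (s : 'S_N.+1) k := odflt k (unlift (s i) (s (lift i k))).
  have ulsfK i (s : 'S_N.+1) k : lift (s i) (ulsf i s k) = s (lift i k).
    rewrite /ulsf; have := neq_lift i k.
    by rewrite -(can_eq (permK s)) => /unlift_some[] ? ? ->.
  have inj_ulsf : injective (ulsf i0 _).
    move=> s; apply: can_inj (ulsf (s i0) s^-1%g) _ => k'.
    by rewrite {1}/ulsf ulsfK !permK liftK.
  exists (fun s => perm (inj_ulsf s)) => [s _ | s].
    by apply/permP=> k'; rewrite permE /ulsf lift_perm_lift lift_perm_id liftK.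
  move/andP => [_ /(s _ =P _) si0]; apply/permP=> k.
  case: (unliftP i0 k) => [k'|] ->; rewrite ?lift_perm_id //.
  by rewrite lift_perm_lift -si0 permE ulsfK.
by apply: eq_bigl => s; rewrite lift_perm_id eqxx andbT.
Qed.

Lemma shufflesP p N (s : 'S_N) : reflect
  (forall i j : 'I_N, (i < j)%N -> (j < p)%N || (p <= i)%N -> (s i < s j)%N) (shuffles p s).
Proof.
apply: (iffP forallP) => [h i j ij pij|h i].
  by move/forallP/(_ j): (h i); rewrite ij pij.
by apply/forallP => j; apply/implyP => /andP[]; exact: h.
Qed.

Lemma perm_val_lift_id N (i0 : 'I_N.+1) (s : 'S_N) :
  perm_val (lift_perm i0 ord0 s) i0 = 0%N.
Proof. by rewrite perm_valE lift_perm_id. Qed.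

Lemma perm_val_lift N (i0 : 'I_N.+1) (s : 'S_N) k : (k < N)%N ->
  perm_val (lift_perm i0 ord0 s) (bump i0 k) = (perm_val s k).+1.
Proof.
move=> kN; rewrite -[k]/(nat_of_ord (Ordinal kN)) -[bump _ _]/(nat_of_ord (lift i0 (Ordinal kN))).
by rewrite !perm_valE lift_perm_lift.
Qed.

Lemma shuffles_lift_first p N (s : 'S_N) :
  shuffles p.+1 (lift_perm ord0 ord0 s) = shuffles p s.
Proof.
apply/shufflesP/shufflesP => h i j ij pij.
  have := h (lift ord0 i) (lift ord0 j); rewrite !lift_perm_lift !lift0 !ltnS.
  exact.
case: (unliftP ord0 j) => [j'|] ej; last by move: ij; rewrite ej.
rewrite ej; case: (unliftP ord0 i) => [i'|] ei; rewrite ei ?lift_perm_id !lift_perm_lift ?lift0 //.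
by rewrite ltnS; apply: h; move: ij pij; rewrite ei ej !lift0 !ltnS.
Qed.

Lemma shuffles_lift_mid p N (i0 : 'I_N.+1) (s : 'S_N) : i0 = p :> nat ->
  shuffles p (lift_perm i0 ord0 s) = shuffles p s.
Proof.
move=> e0; apply/shufflesP/shufflesP => h i j ij pij.
  have := h (lift i0 i) (lift i0 j); rewrite !lift_perm_lift !lift0 !ltnS; apply.
    by rewrite /= /bump; lia.
  by rewrite /= /bump; lia.
case: (unliftP i0 j) => [j'|] ej; last by move: ij pij; rewrite ej e0; lia.
rewrite ej; case: (unliftP i0 i) => [i'|] ei; rewrite ei ?lift_perm_id !lift_perm_lift ?lift0 //.
by rewrite ltnS; apply: h; move: ij pij; rewrite ei ej /= /bump; lia.
Qed.

(** A shuffle attains the value 0 at the first place of a block, that is at place 0 or p. Removing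
    this place corresponds to removing the first step of the lattice path. *)
Lemma shuffle_sumE p q N (Psi : seq nat -> seq nat -> V) : (p + q)%N = N ->
  \sum_(s : 'S_N | shuffles p s) shuffle_eval p q Psi s = shuffle_sum p q Psi.
Proof.
elim: N p q Psi => [|N ih] p q Psi.
  move=> /eqP; rewrite addn_eq0 => /andP[/eqP -> /eqP ->].
  rewrite (big_pred1 (1%g : 'S_0)) /shuffle_eval ?odd_perm1 //= => s.
  rewrite (_ : s = 1%g); last by apply/permP => -[].
  by rewrite /= eqxx; apply/shufflesP => -[].
move=> e.
have step1 p' : p = p'.+1 ->
    \sum_(s : 'S_N.+1 | shuffles p s && (s ord0 == ord0)) shuffle_eval p q Psi s
    = shuffle_sum p' q (fun ns ms => Psi (0%N :: map S ns) (map S ms)).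
  move=> ep; rewrite ep addSn in e *; case: e => e; rewrite reindex_lift_perm -(ih _ _ _ e).
  apply: eq_big => s; first exact: shuffles_lift_first.
  move=> _; rewrite /shuffle_eval odd_lift_perm /=; congr (sgn _ (Psi _ _)).
    rewrite -[1%N]/(1 + 0)%N (perm_val_lift_id ord0) iotaDl -!map_comp; congr cons.
    apply/eq_in_map => i; rewrite mem_iota /= => ip.
    by rewrite -(perm_val_lift ord0) //; lia.
  rewrite -[p'.+1]add1n iotaDl -!map_comp; apply/eq_in_map => i; rewrite mem_iota /= => ip.
  by rewrite -(perm_val_lift ord0) //; lia.
have step2 q' (lt : (p < N.+1)%N) : q = q'.+1 ->
    \sum_(s : 'S_N.+1 | shuffles p s && (s (Ordinal lt) == ord0)) shuffle_eval p q Psi s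
    = sgn p (shuffle_sum p q' (fun ns ms => Psi (map S ns) (0%N :: map S ms))).
  move=> eq; rewrite eq addnS in e *; case: e => e; rewrite reindex_lift_perm -(ih _ _ _ e) sgn_sum.
  apply: eq_big => s; first exact: shuffles_lift_mid.
  move=> _; rewrite /shuffle_eval -sgn_add /=.
  (* The value 0 at place p contributes the sign (-1)^p, by [odd_lift_perm]. *)
  rewrite -[LHS]/(sgn _ _) [in LHS]/sgn oddb odd_lift_perm addbF /= [in RHS]/sgn oddD oddb.
  rewrite (_ : map _ (iota 0 p) = map S [seq perm_val s i | i <- iota 0 p]); last first.
    rewrite -!map_comp; apply/eq_in_map => i; rewrite mem_iota /= => ip.
    by rewrite -(perm_val_lift (Ordinal lt)) /= /bump; [congr perm_val|]; lia.
  rewrite (_ : map _ (iota p.+1 q') = map S [seq perm_val s i | i <- iota p q']); last first.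
    rewrite -[p.+1]add1n iotaDl -!map_comp; apply/eq_in_map => i; rewrite mem_iota /= => ip.
    by rewrite -(perm_val_lift (Ordinal lt)) /= /bump; [congr perm_val|]; lia.
  by rewrite -[p in perm_val _ p]/(nat_of_ord (Ordinal lt)) perm_val_lift_id.
have split0 (i0 : 'I_N.+1) :
    \sum_(s : 'S_N.+1 | shuffles p s) shuffle_eval p q Psi s
    = \sum_(s : 'S_N.+1 | shuffles p s && (s i0 == ord0)) shuffle_eval p q Psi s
      + \sum_(s : 'S_N.+1 | shuffles p s && (s i0 != ord0)) shuffle_eval p q Psi s.
  exact: bigID.
have first (s : 'S_N.+1) (i0 : 'I_N.+1) : shuffles p s -> s i0 = ord0 -> i0 = 0%N :> nat \/ i0 = p :> nat.
  move=> /shufflesP sh s0.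
  have [->|i00] := eqVneq (nat_of_ord i0) 0%N; first by left.
  have [->|ip] := eqVneq (nat_of_ord i0) p; first by right.
  have lt1 : (i0.-1 < N.+1)%N by have := ltn_ord i0; lia.
  have h1 : (i0.-1 < i0)%N by lia.
  have h2 : (i0 < p)%N || (p <= i0.-1)%N by lia.
  by have := sh (Ordinal lt1) i0 h1 h2; rewrite s0.
case: p => [|p'] in e step1 step2 split0 first *.
  case: q => [|q'] in e step1 step2 split0 first *; first by [].
  have lt : (0 < N.+1)%N by [].
  rewrite -[RHS](step2 q' lt erefl); apply: eq_bigl => s.
  case: shufflesP => //= sh; apply/esym/eqP.
  have /first : shuffles 0 s by apply/shufflesP.
  move=> /(_ (s^-1 ord0)%g); rewrite permKV => /(_ erefl) h.
  have -> : Ordinal lt = (s^-1)%g ord0 by apply: val_inj => /=; case: h.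
  by rewrite permKV.
case: q => [|q'] in e step1 step2 split0 first *.
  rewrite -[RHS](step1 p' erefl); apply: eq_bigl => s.
  case: shufflesP => //= sh; apply/esym/eqP.
  have /first : shuffles p'.+1 s by apply/shufflesP.
  move=> /(_ (s^-1 ord0)%g); rewrite permKV => /(_ erefl) h.
  have e0 : (s^-1)%g ord0 = ord0.
    by apply: val_inj => /=; case: h => // h; have := ltn_ord ((s^-1)%g ord0); lia.
  by rewrite -{1}e0 permKV.
have lt : (p'.+1 < N.+1)%N by lia.
rewrite (split0 ord0) (step1 p' erefl) /= -[RHS]/(_ - sgn p' _); congr (_ + _).
rewrite -sgnS -(step2 q' lt erefl); apply: eq_bigl => s.
case sh: (shuffles _ _) => //=.
have := first _ ((s^-1)%g ord0) sh; rewrite permKV => /(_ erefl) h.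
apply/idP/eqP => [|sp].
  case: h => [h|h].
    have e0 : (s^-1)%g ord0 = ord0 by exact: val_inj.
    by rewrite -{1}e0 permKV eqxx.
  by move=> _; rewrite (_ : Ordinal lt = (s^-1)%g ord0) ?permKV //; exact: val_inj.
apply/eqP => s0; have : Ordinal lt = ord0 by apply: (@perm_inj _ s); rewrite s0 sp.
by move=> /(congr1 val).
Qed.

End ShuffleSums.

Section ShuffleProduct.

Definition dgn_seq (X : sset_data) (ms : seq nat) (s : simplex X) : simplex X :=
  foldl (fun s i => simp (dgn i (tagged s : X (tag s)))) s ms.

(** [inord] sends an index out of range to 0, so [dgn] on [Dec X] is the shifted [dgn] of X for
    indices in range only. *)
Fixpoint dgn_range (n : nat) (ms : seq nat) : bool :=
  if ms is m :: ms' then (m <= n)%N && dgn_range n.+1 ms' else true.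

Lemma shuffle_sum_ext (V : zmodType) p q (Phi Psi : seq nat -> seq nat -> V) :
  (forall ns ms, dgn_range q ns -> dgn_range p ms -> Phi ns ms = Psi ns ms) ->
  shuffle_sum p q Phi = shuffle_sum p q Psi.
Proof.
have rS n ms : dgn_range n ms -> dgn_range n.+1 (map S ms).
  by elim: ms n => //= m ms ih n /andP[mn /ih ->]; rewrite ltnS mn.
elim: p q Phi Psi => [|p ihp].
  elim=> [|q ihq] Phi Psi e; first exact: e.
  by apply: ihq => ns ms hn hm; apply: e => //=; apply: rS.
elim=> [|q ihq] Phi Psi e.
  by apply: ihp => ns ms hn hm; apply: e => //=; apply: rS.
congr (_ - sgn p _).
  by apply: ihp => ns ms hn hm; apply: e => //=; apply: rS.
by apply: ihq => ns ms hn hm; apply: e => //=; apply: rS.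
Qed.

Definition undec (X : sset_data) (s : simplex (Dec X)) : simplex X :=
  simp (tagged s : X (tag s).+1).

Lemma dgn_seq_undec (X : sset_data) (ms : seq nat) (s : simplex (Dec X)) :
  dgn_range (tag s) ms -> dgn_seq (map S ms) (undec s) = undec (dgn_seq ms s).
Proof.
elim: ms s => [//|m ms ih] [n x] /= /andP[mn h]; rewrite -ih //.
by rewrite /undec /= -(Dec_dgn x mn).
Qed.

Lemma shuffle_sum_sh (V : zmodType) p q (X Y : sset_data) (F : simplex X -> simplex Y -> V)
    (x : X p) (y : Y q) :
  shuffle_sum p q (fun ns ms => F (dgn_seq ms (simp x)) (dgn_seq ns (simp y)))
  = sh (fun n (x : X n) (y : Y n) => F (simp x) (simp y)) x y.
Proof.
have d0 (Z : sset_data) n (z : Z n) : simp (dgn 0 z) = undec (simp (sset_dgn ord0 z : Dec Z n)).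
  by rewrite -dgnE.
pose F' (X Y : sset_data) (F : simplex X -> simplex Y -> V) (s : simplex (Dec X)) (t : simplex (Dec Y)) :=
  F (undec s) (undec t).
have El p' q' (X' Y' : sset_data) (F0 : simplex X' -> simplex Y' -> V) (a : X' p'.+1) (b : Y' q') :
  shuffle_sum p' q' (fun ns ms => F0 (dgn_seq (map S ms) (simp a)) (dgn_seq (0%N :: map S ns) (simp b)))
  = shuffle_sum p' q' (fun ns ms => F' _ _ F0 (dgn_seq ms (simp (a : Dec X' p')))
       (dgn_seq ns (simp (sset_dgn ord0 b : Dec Y' q')))).
  apply: shuffle_sum_ext => ns ms hn hm; rewrite /F' -!dgn_seq_undec //=.
  by rewrite -d0.
have Er p' q' (X' Y' : sset_data) (F0 : simplex X' -> simplex Y' -> V) (a : X' p') (b : Y' q'.+1) :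
  shuffle_sum p' q' (fun ns ms => F0 (dgn_seq (0%N :: map S ms) (simp a)) (dgn_seq (map S ns) (simp b)))
  = shuffle_sum p' q' (fun ns ms => F' _ _ F0 (dgn_seq ms (simp (sset_dgn ord0 a : Dec X' p')))
       (dgn_seq ns (simp (b : Dec Y' q')))).
  apply: shuffle_sum_ext => ns ms hn hm; rewrite /F' -!dgn_seq_undec //=.
  by rewrite -d0.
move: F x y.
pose P p q (X Y : sset_data) := forall (F : simplex X -> simplex Y -> V) (x : X p) (y : Y q),
  shuffle_sum p q (fun ns ms => F (dgn_seq ms (simp x)) (dgn_seq ns (simp y)))
  = sh (fun n (x : X n) (y : Y n) => F (simp x) (simp y)) x y.
apply: (sh_ind (P := P)) => {p q X Y}
  [X Y|q X Y ih|p X Y ih|p q X Y ih1 ih2] F x y //.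
- by rewrite sh0S -[RHS](ih (F' _ _ F)) -Er.
- by rewrite shS0 -[RHS](ih (F' _ _ F)) -El.
by rewrite shSS -[X in _ = X - _](ih1 (F' _ _ F)) -[X in _ = _ - sgn p X](ih2 (F' _ _ F)) -El -Er.
Qed.

Lemma iter_dgn_seq (X : sset_data) p q (mu : 'I_q -> nat) (x : X p) :
  simp (iter_dgn mu x) = dgn_seq [seq mu j | j <- enum 'I_q] (simp x).
Proof.
elim: q mu => [|q ih] mu; first by rewrite enum_ord0.
rewrite enum_ordSr map_rcons -cats1 /dgn_seq foldl_cat /= -map_comp.
by have := ih (mu \o widen_ord (leqnSn q)); rewrite /dgn_seq => <-.
Qed.

Definition mulc (G : sgroup) : cochain2 G G (chains G) :=
  fun n u v => chain (simp (X := G) ((u : sgrp G n) * v)%g).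

Lemma shuffle_mul_simplexE (G : sgroup) p q (g : G p) (h : G q) :
  shuffle_mul_simplex (G := G) g h = sh (@mulc G) g h.
Proof.
(* The product is extended by 0 to simplices of different dimensions, as [shuffle_sum_sh] requires a
   function of arbitrary pairs. The cast inside it absorbs the cast in the shuffle product. *)
pose F (s t : simplex G) : chains G := match eqVneq (tag s) (tag t) with
  | EqNotNeq e => mulc (ecast n (G n) e (tagged s : G (tag s))) (tagged t : G (tag t))
  | _ => 0 end.
have FE n (u v : G n) : F (simp u) (simp v) = mulc u v.
  by rewrite /F; case: eqVneq => [e|]; rewrite ?eq_axiomK //= eqxx.
have FcE m n (e : m = n) (u : G m) (v : G n) : F (simp u) (simp v) = mulc (ecast n (G n) e u) v.
  by move: v; case: n / e => v; rewrite FE.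
rewrite (_ : sh _ _ _ = sh (fun n (x : G n) (y : G n) => F (simp x) (simp y)) g h); last first.
  by apply: sh_ext => n u v _; rewrite FE.
rewrite -shuffle_sum_sh -(shuffle_sumE _ (erefl (p + q)%N)).
apply: eq_big => s.
  apply/andP/shufflesP => [[/forallP h1 /forallP h2] i j ij pij|hs].
    case: (split_ordP j) pij ij => j' ->; case: (split_ordP i) => i' -> /=.
    - move=> _ ij; by move: (h1 i') => /forallP /(_ j') /implyP; exact.
    - by have := ltn_ord j'; lia.
    - by have := ltn_ord i'; lia.
    - rewrite ltn_add2l => _ ij; by move: (h2 i') => /forallP /(_ j') /implyP; exact.
  split; apply/forallP => i; apply/forallP => j; apply/implyP => ij; apply: hs => //=.
  - by rewrite ltn_ord.
  - by rewrite ltn_add2l.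
  - by rewrite leq_addr orbT.
move=> _; rewrite /shuffle_eval.
rewrite (_ : [seq perm_val s i | i <- iota 0 p] = [seq (s (lshift q i) : nat) | i <- enum 'I_p]); last first.
  by rewrite -val_enum_ord -map_comp; apply: eq_map => i /=; rewrite -perm_valE.
rewrite (_ : [seq perm_val s i | i <- iota p q] = [seq (s (rshift p i) : nat) | i <- enum 'I_q]); last first.
  rewrite -[X in iota X _]addn0 iotaDl -val_enum_ord -!map_comp; apply: eq_map => i /=.
  by rewrite -perm_valE.
rewrite -!(iter_dgn_seq (X := G)) (FcE _ _ (addnC q p)) -signr_odd /sgn oddb.
by case: (odd_perm s); rewrite ?scale1r // expr1 scaleN1r.
Qed.

End ShuffleProduct.

(** * The differential graded algebra of chains on a simplicial group *)

Section Boundary.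

Lemma signr_scale (X : sset_data) n (c : chains X) : (-1) ^+ n *: c = sgn n c.
Proof. by rewrite -signr_odd /sgn; case: odd; rewrite ?scale1r // expr1 scaleN1r. Qed.

Definition basic (X : sset_data) : forall n, X n -> chains X := fun n x => chain (simp x).

Lemma basic_normalised (X : sset_data) : normalised (@basic X).
Proof. by move=> n i x; exact: chain_dgn. Qed.

Lemma boundary_simplexE (X : sset_data) n (x : X n) : boundary_simplex x = cobd (@basic X) x.
Proof.
case: n x => [//|n] x; apply: eq_bigr => i _.
by rewrite signr_scale faceE.
Qed.

HB.instance Definition _ (X : sset_data) := GRing.Additive.copy (@boundary X)
  (linext (fun b : nondeg X => boundary_simplex (tagged (val b)))).

Lemma boundaryB (X : sset_data) (a b : chains X) : boundary (a - b) = boundary a - boundary b.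
Proof. exact: raddfB. Qed.

Lemma boundary_chain (X : sset) n (x : X n) : boundary (chain (simp x)) = cobd (@basic X) x.
Proof.
have nb : normalised (fun n (x : X n) => boundary_simplex x).
  move=> m i y; rewrite boundary_simplexE.
  by apply: (cobd_normalised (sset_ax X)); exact: basic_normalised.
by rewrite -boundary_simplexE -(lin_chain x nb).
Qed.

End Boundary.

Section ShuffleAlgebra.
Variable G : sgroup.
Let ax := sset_ax G.

Lemma mulc_normalised : normalised2 (@mulc G).
Proof.
move=> n i u v; rewrite /mulc.
have := @sgrp_dgnM G n i u v => /= e; rewrite -[(_ * _)%g]e.
exact: (chain_dgn (X := G)).
Qed.

Lemma smul_additiver (a : chains G) : zmod_morphism (shuffle_mul a).
Proof.
move=> b c.
have E d : shuffle_mul a d = \sum_(g <- msupp a) linext (fun h : nondeg G =>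
    shuffle_mul_simplex (tagged (val g)) (tagged (val h))) d *~ a@_g by [].
by rewrite !E -sumrB; apply: eq_bigr => g _; rewrite raddfB mulrzBl.
Qed.

HB.instance Definition _ (a : chains G) :=
  GRing.isZmodMorphism.Build (chains G) (chains G) (shuffle_mul a) (smul_additiver a).

Definition smulr (b a : chains G) : chains G := shuffle_mul a b.

HB.instance Definition _ (b : chains G) := GRing.Additive.copy (smulr b)
  (linext (fun g : nondeg G => linext (fun h : nondeg G =>
    shuffle_mul_simplex (tagged (val g)) (tagged (val h))) b)).

Lemma smulBl (a b c : chains G) : shuffle_mul (a - b) c = shuffle_mul a c - shuffle_mul b c.
Proof. exact: (raddfB (smulr c)). Qed.

Lemma smulBr (a b c : chains G) : shuffle_mul c (a - b) = shuffle_mul c a - shuffle_mul c b.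
Proof. exact: raddfB. Qed.

Lemma smul0r (c : chains G) : shuffle_mul c 0 = 0.
Proof. exact: raddf0. Qed.

Lemma smulDr (a b c : chains G) : shuffle_mul c (a + b) = shuffle_mul c a + shuffle_mul c b.
Proof. exact: raddfD. Qed.

Lemma smulDl (a b c : chains G) : shuffle_mul (a + b) c = shuffle_mul a c + shuffle_mul b c.
Proof. exact: (raddfD (smulr c)). Qed.

Lemma smul0l (c : chains G) : shuffle_mul 0 c = 0.
Proof. exact: (raddf0 (smulr c)). Qed.

Lemma smul_suml (I : Type) (r : seq I) (P : pred I) (f : I -> chains G) c :
  shuffle_mul (\sum_(i <- r | P i) f i) c = \sum_(i <- r | P i) shuffle_mul (f i) c.
Proof. exact: (raddf_sum (smulr c)). Qed.

Lemma smul_sgnl n (a c : chains G) : shuffle_mul (sgn n a) c = sgn n (shuffle_mul a c).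
Proof. exact: (raddf_sgn (smulr c)). Qed.

Lemma smulE (a b : chains G) :
  shuffle_mul a b = lin (fun p (g : G p) => lin (fun q (h : G q) => sh (@mulc G) g h) b) a.
Proof.
apply: linext_ext => g; apply: linext_ext => h; exact: shuffle_mul_simplexE.
Qed.

Lemma smul_chain p q (g : G p) (h : G q) :
  shuffle_mul (chain (simp g)) (chain (simp h)) = sh (@mulc G) g h.
Proof.
have nh p' (g' : G p') : normalised (fun q (h : G q) => sh (@mulc G) g' h).
  by move=> m i y; apply: sh_dgnr => //; exact: mulc_normalised.
rewrite smulE lin_chain ?lin_chain //.
by move=> m i y; rewrite lin_chain //; apply: sh_dgnl => //; exact: mulc_normalised.
Qed.

Lemma smul_mem (P : chains G -> Prop) p q (a b : chains G) : 
  P 0 -> (forall a b, P a -> P b -> P (a - b)) ->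
  (forall (g : G p) (h : G q), P (sh (@mulc G) g h)) ->
  chains_in p a -> chains_in q b -> P (shuffle_mul a b).
Proof.
move=> P0 PB h pa qb; apply: (chains_mem (P := fun a => P (shuffle_mul a b)) pa).
- by rewrite smul0l.
- by move=> *; rewrite smulBl; exact: PB.
move=> g; apply: (chains_mem (P := fun b => P (shuffle_mul (chain (simp g)) b)) qb).
- by rewrite smul0r.
- by move=> *; rewrite smulBr; exact: PB.
by move=> k; rewrite smul_chain.
Qed.

Lemma smul_in p q (a b : chains G) : chains_in p a -> chains_in q b ->
  chains_in (p + q) (shuffle_mul a b).
Proof.
apply: smul_mem => [||g h]; [exact: chains_in0|exact: chains_inB|].
apply: (sh_closed (P := chains_in (p + q)) _ (R := fun _ _ => True)) => //.
  exact: chains_inB.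
by move=> n u v en _; rewrite -en; exact: chains_in_chain.
Qed.

Lemma mulc_cobd n (u v : G n) : boundary (mulc u v) = cobd2 (@mulc G) u v.
Proof.
rewrite /mulc boundary_chain; case: n u v => [//|n] u v.
by apply: eq_bigr => i _; rewrite /basic [sset_face _ _]sgrp_faceM.
Qed.

(** Faces are homomorphisms, so [mulc] commutes with the boundary and [sh_cobd] for [mulc] is the
    Leibniz rule. *)
Lemma boundary_smul p (a b : chains G) : chains_in p a ->
  boundary (shuffle_mul a b)
  = shuffle_mul (boundary a) b + sgn p (shuffle_mul a (boundary b)).
Proof.
move=> pa.
apply: (chains_mem (P := fun a => boundary (shuffle_mul a b)
  = shuffle_mul (boundary a) b + sgn p (shuffle_mul a (boundary b))) pa).
- by rewrite !(smul0l, raddf0) sgn0 addr0.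
- by move=> x y hx hy; rewrite !(smulBl, boundaryB) hx hy sgnB; abel.
move=> g; apply: (chains_ind (P := fun b => boundary (shuffle_mul (chain (simp g)) b)
  = shuffle_mul (boundary (chain (simp g))) b + sgn p (shuffle_mul (chain (simp g)) (boundary b)))).
- by rewrite !raddf0 sgn0 addr0.
- move=> x y hx hy; rewrite !(smulBr x y) (boundaryB x y) (smulBr (boundary x)) boundaryB.
  by rewrite [X in X - _ = _]hx [X in _ - X = _]hy sgnB; abel.
move=> q h; rewrite smul_chain -sh_raddf.
rewrite (@sh_ext _ _ _ _ _ _ (cobd2 (@mulc G))); last by move=> *; exact: mulc_cobd.
rewrite (sh_cobd ax ax) /bicobd !boundary_chain; congr (_ + sgn p _).
  case: (p) g => [|p'] g'; first by rewrite smul0l.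
  by rewrite [cobd _ _]/= smul_suml; apply: eq_bigr => i _; rewrite smul_sgnl smul_chain.
case: (q) h => [|q'] h'; first by rewrite /= raddf0.
by rewrite [cobd _ _]/= raddf_sum; apply: eq_bigr => i _; rewrite raddf_sgn /= smul_chain.
Qed.

(** Both bracketings are triple shuffles of the cochain [u v w], to which [sh_assoc] applies. *)
Lemma smulA (a b c : chains G) :
  shuffle_mul (shuffle_mul a b) c = shuffle_mul a (shuffle_mul b c).
Proof.
apply: (chains_ind (P := fun a => shuffle_mul (shuffle_mul a b) c
    = shuffle_mul a (shuffle_mul b c))) => [|x y hx hy|p g].
- by rewrite !smul0l.
- by rewrite !smulBl hx hy.
apply: (chains_ind (P := fun b => shuffle_mul (shuffle_mul (chain (simp g)) b) c
    = shuffle_mul (chain (simp g)) (shuffle_mul b c))) => [|x y hx hy|q h].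
- by rewrite !(smul0r, smul0l).
- rewrite (smulBr x y) (smulBl x y) (smulBl (shuffle_mul _ x)) (smulBr (shuffle_mul x c)).
  by rewrite [X in X - _ = _]hx [X in _ - X = _]hy.
apply: (chains_ind (P := fun c => shuffle_mul (shuffle_mul (chain (simp g)) (chain (simp h))) c
    = shuffle_mul (chain (simp g)) (shuffle_mul (chain (simp h)) c))) => [|x y hx hy|r k].
- by rewrite !smul0r.
- by rewrite !smulBr hx hy.
rewrite !smul_chain.
pose F3 n (u v w : G n) : chains G :=
  chain (simp (X := G) ((u : sgrp G n) * (v : sgrp G n) * (w : sgrp G n))%g).
have := sh_assoc ax ax ax (F3 : cochain3 _ G G G) g h k; rewrite /sh_left /sh_right => e.
transitivity (sh (fun n u v =>
  sh (fun m (x : Prod G G m) (w : G m) => F3 m x.1 x.2 w) ((u, v) : Prod G G n) k) g h).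
  rewrite -[LHS]/(smulr (chain (simp k)) (sh (@mulc G) g h)) -sh_raddf.
  apply: sh_ext => n u v _; rewrite /= /smulr [LHS]smul_chain.
  rewrite -(@sh_nat _ n r (Prod G G) G G G (fun m x => ((x.1 : sgrp G m) * (x.2 : sgrp G m))%g) (fun m => id) (@mulc G) (u, v) k) //.
  by move=> m i x; rewrite /= sgrp_dgnM.
rewrite e.
rewrite -[RHS]sh_raddf; apply: sh_ext => n u v _; rewrite /= [RHS]smul_chain.
rewrite -(@sh_nat _ p n G (Prod G G) G G (fun m => id) (fun m x => ((x.1 : sgrp G m) * (x.2 : sgrp G m))%g) (@mulc G) g (u, v)) //.
  by apply: sh_ext => m y x _; rewrite /F3 /mulc /= mulgA.
by move=> m i x; rewrite /= sgrp_dgnM.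
Qed.

Lemma sgrp_dgn1 n i : @sset_dgn G n i (1%g : sgrp G n) = (1%g : sgrp G n.+1).
Proof. exact: (morph1 (@sgrp_dgnM G n i)). Qed.

Lemma sgrp_face1 n i : @sset_face G n i (1%g : sgrp G n.+1) = (1%g : sgrp G n).
Proof. exact: (morph1 (@sgrp_faceM G n i)). Qed.

Lemma smul1l (a : chains G) : shuffle_mul (chains_one G) a = a.
Proof.
apply: (chains_ind (P := fun a => shuffle_mul (chains_one G) a = a)) => [|x y hx hy|q h].
- exact: raddf0.
- by rewrite smulBr hx hy.
rewrite /chains_one smul_chain.
rewrite (sh_unitl (U := G) (V := G) (@mulc G) (e := fun n => (1%g : sgrp G n))); last exact: sgrp_dgn1.
by rewrite /mulc mul1g.
Qed.

Lemma smul1r (a : chains G) : shuffle_mul a (chains_one G) = a.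
Proof.
apply: (chains_ind (P := fun a => shuffle_mul a (chains_one G) = a)) => [|x y hx hy|q h].
- exact: smul0l.
- by rewrite smulBl hx hy.
rewrite /chains_one smul_chain.
rewrite (sh_unitr (U := G) (V := G) (@mulc G) _ (e := fun n => (1%g : sgrp G n))); last exact: sgrp_dgn1.
by rewrite /mulc mulg1.
Qed.

End ShuffleAlgebra.

(** * The cobar construction as a differential graded algebra *)

Section Drop.

Lemma undec_drop_last (U : sset_data) k m (u : Dec U m) : (k <= m)%N ->
  undec (drop_last k u) = drop_last k (u : U m.+1).
Proof.
elim: k m u => [|k ih] [|m] u // km.
rewrite -[drop_last k.+1 u in LHS]/(drop_last k (face m.+1 u)).
by rewrite -[RHS]/(drop_last k (face m.+2 (u : U m.+2))) -Dec_face // ih.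
Qed.

Lemma face_maxE (U : sset_data) n (x : U n.+1) : face n.+1 x = sset_face ord_max x.
Proof. by rewrite -faceE. Qed.

Lemma drop_last_vertex0 (U : sset_data) n (u : U n) : drop_last n u = simp (vertex0 u).
Proof. by elim: n u => [//|n ih] u /=; rewrite ih face_maxE. Qed.

(** Links the recursion of [AW] with the explicit sum over r that occurs in the cobar
    differential. *)
Lemma AW_drop (A : zmodType) n (U V : sset_data) (K : simplex U -> simplex V -> A) (u : U n) (v : V n) :
  AW (fun p q (u : U p) (v : V q) => K (simp u) (simp v)) u v
  = \sum_(r < n.+1) K (drop_last (n - r) u) (drop_first r v).
Proof.
elim: n U K u v => [|n ih] U K u v; first by rewrite big_ord1.
rewrite AWS big_ord_recl drop_last_vertex0; congr (_ + _).
rewrite [LHS](ih (Dec U) (fun s t => K (undec s) t)); apply: eq_bigr => r _.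
rewrite undec_drop_last; last by have := ltn_ord r; lia.
by rewrite -(faceE ord0).
Qed.

Lemma tag_drop_last (U : sset_data) k n (u : U n) : tag (drop_last k u) = (n - k)%N.
Proof. by elim: k n u => [|k ih] [|n] u //=; rewrite ih. Qed.

Lemma tag_drop_first (U : sset_data) k n (u : U n) : tag (drop_first k u) = (n - k)%N.
Proof. by elim: k n u => [|k ih] [|n] u //=; rewrite ih. Qed.

End Drop.

Section LeibnizWord.
Variables (T : Type) (R : nzRingType) (g d : T -> R) (deg : T -> nat).

Fixpoint leibniz_word (w : seq T) : R :=
  if w is a :: w' then d a * \prod_(b <- w') g b + sgn (deg a) (g a * leibniz_word w') else 0.

Lemma mulr_sgnl (x y : R) n : x * sgn n y = sgn n (x * y).
Proof. by rewrite /sgn; case: odd; rewrite ?mulrN. Qed.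

Lemma mulr_sgnr (x y : R) n : sgn n x * y = sgn n (x * y).
Proof. by rewrite /sgn; case: odd; rewrite ?mulNr. Qed.

Lemma leibniz_word_cat v w : leibniz_word (v ++ w)
  = leibniz_word v * (\prod_(b <- w) g b)
    + sgn (\sum_(a <- v) deg a)%N ((\prod_(b <- v) g b) * leibniz_word w).
Proof.
elim: v => [|a v ih]; first by rewrite /= !big_nil mul0r add0r mul1r.
rewrite /= ih !big_cons big_cat /= mulrDl mulrDr sgnD sgn_add mulr_sgnl mulr_sgnr !mulrA addrA.
by [].
Qed.

End LeibnizWord.

Section Cobar.
Variable X : sset_data.

Lemma cobar_word0 : cobar_word (X := X) [::] = 1.
Proof. by rewrite /cobar_word -fmoneE. Qed.

Lemma cobar_wordM (v w : seq (cobar_gen X)) : cobar_word (v ++ w) = cobar_word v * cobar_word w.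
Proof.
rewrite /cobar_word [RHS](_ : _ = fgmul << FMonom v >> << FMonom w >>); last exact: malgM_def.
by rewrite fgmulUU mulr1 [X in _ = mkmalgU X _](fmmulE (FMonom v) (FMonom w)).
Qed.

Lemma cobar_mem (P : cobar X -> Prop) b : P 0 -> (forall a b, P a -> P b -> P (a - b)) ->
  (forall w : {fmonom cobar_gen X}, w \in msupp b -> P (cobar_word w)) -> P b.
Proof.
move=> P0 PB h; apply: malg_mem => // w wb.
by have := h w wb; rewrite /cobar_word fmK.
Qed.

Definition gen : forall n, X n -> cobar X := fun n x => desusp (simp x).

Lemma desuspE (s : simplex X) : desusp s = gen (tagged s : X (tag s)).
Proof. by case: s. Qed.

Lemma gen_normalised : normalised gen.
Proof.
move=> n i x; rewrite /gen /desusp insubF //; apply/negbTE; rewrite negb_and negbK.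
by apply/orP; right; apply/asboolP; exists i, x.
Qed.

Lemma gen_low n (x : X n) : (n <= 1)%N -> gen x = 0.
Proof.
move=> n1; rewrite /gen /desusp insubF //; apply/negbTE.
by rewrite negb_and -leqNgt n1.
Qed.

Lemma gen_word (a : cobar_gen X) :
  cobar_word [:: a] = gen (tagged (val a) : X (tag (val a))).
Proof. by rewrite -desuspE /desusp valK. Qed.

Variant gen_spec n (x : X n) : cobar X -> Prop :=
| GenZero of (n <= 1)%N \/ degenerate x : gen_spec x 0
| GenWord a of val a = simp x & (1 < n)%N : gen_spec x (cobar_word [:: a]).

Lemma genP n (x : X n) : gen_spec x (gen x).
Proof.
rewrite /gen /desusp; case: insubP => [a h e|].
  by apply: GenWord => //; case/andP: h.
rewrite negb_and -leqNgt negbK => /orP[n1|/asboolP d]; apply: GenZero; [by left|by right].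
Qed.

Lemma cobar_word_cons a w :
  cobar_word (a :: w) = gen (tagged (val a) : X (tag (val a))) * cobar_word w.
Proof. by rewrite -gen_word -cobar_wordM. Qed.

Lemma cobar_ind (P : cobar X -> Prop) b : P 0 -> (forall a b, P a -> P b -> P (a - b)) ->
  P 1 -> (forall n (x : X n) b, (1 < n)%N -> P b -> P (gen x * b)) -> P b.
Proof.
move=> P0 PB P1 h; apply: cobar_mem => // w _; elim: (w : seq _) => [|a v ih].
  by rewrite cobar_word0.
by rewrite cobar_word_cons; apply: h => //; case/andP: (valP a).
Qed.

Lemma cobar_in0 n : cobar_in n (0 : cobar X).
Proof. by move=> w; rewrite msupp0. Qed.

Lemma cobar_inB n (a b : cobar X) : cobar_in n a -> cobar_in n b -> cobar_in n (a - b).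
Proof.
move=> ha hb k /(fsubsetP (msuppB_le _ _)); rewrite in_fsetU.
by case/orP; [exact: ha|exact: hb].
Qed.

Lemma cobar_in_word w : cobar_in (\sum_(a <- w) cobar_gen_deg a)%N (cobar_word (X := X) w).
Proof. by move=> v; rewrite msuppU /= in_fset1 => /eqP ->. Qed.

Lemma cobar_in1 : cobar_in 0 (1 : cobar X).
Proof. by rewrite -cobar_word0; have := @cobar_in_word [::]; rewrite big_nil. Qed.

Lemma cobar_inM m n (a b : cobar X) : cobar_in m a -> cobar_in n b -> cobar_in (m + n) (a * b).
Proof.
move=> ha hb; apply: (cobar_mem (P := fun a => cobar_in (m + n) (a * b)) (b := a)) => [|x y hx hy|v va].
- by rewrite mul0r; exact: cobar_in0.
- by rewrite mulrBl; exact: (cobar_inB hx hy).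
apply: (cobar_mem (P := fun b => cobar_in (m + n) (cobar_word v * b)) (b := b)) => [|x y hx hy|w wb].
- by rewrite mulr0; exact: cobar_in0.
- by rewrite mulrBr; exact: (cobar_inB hx hy).
rewrite -cobar_wordM -(ha v va) -(hb w wb) -big_cat; exact: cobar_in_word.
Qed.

Lemma gen_in n (x : X n) : cobar_in n.-1 (gen x).
Proof.
case: genP => [_|a e _]; first exact: cobar_in0.
have := @cobar_in_word [:: a]; rewrite big_seq1 /cobar_gen_deg /dim e; exact.
Qed.

Definition bigen : bicochain X X (cobar X) := fun p q x y => sgn p (gen x * gen y).

Lemma bigen_binormalised : binormalised bigen.
Proof.
by split=> p q i x y; rewrite /bigen gen_normalised ?mul0r ?mulr0 sgn0.
Qed.

Lemma signr_cobar n (c : cobar X) : (-1) ^+ n *: c = sgn n c.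
Proof. by rewrite -signr_odd /sgn; case: odd; rewrite ?scale1r // expr1 scaleN1r. Qed.

(** [AW] has two more summands, r = 0 and the last one; they vanish because s^{-1} is 0 on
    vertices. *)
Lemma cobar_diff_simplexE n (x : X n) :
  cobar_diff_simplex x = - cobd gen x + AW bigen x x.
Proof.
case: n x => [|n] x; first by rewrite /= oppr0 /bigen gen_low // mul0r sgn0 addr0.
rewrite [LHS]/=; congr (_ + _).
  rewrite -sumrN; apply: eq_bigr => i _.
  by rewrite signr_cobar sgnS faceE.
rewrite (@AW_ext _ _ _ _ _ (fun p q (a : X p) (b : X q) =>
    (fun s t => sgn (tag s) (desusp s * desusp t)) (simp a) (simp b))) //.
rewrite (AW_drop (fun s t => sgn (tag s) (desusp s * desusp t))).
rewrite big_ord_recl big_ord_recr /=.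
rewrite [desusp (drop_last n (face n.+1 x))]desuspE gen_low; last by rewrite tag_drop_last; lia.
rewrite [desusp (drop_first _ (face 0 x))]desuspE [gen (tagged (drop_first _ _))]gen_low; last first.
  by rewrite tag_drop_first; lia.
rewrite mul0r mulr0 !sgn0 add0r addr0 big_add1 /= big_mkord; apply: eq_bigr => i _.
rewrite signr_cobar tag_drop_last; congr (sgn _ (desusp _ * desusp _)).
by have := ltn_ord i; rewrite /bump /=; lia.
Qed.

HB.instance Definition _ := GRing.Additive.copy (@cobar_diff X)
  (linext (fun w : {fmonom cobar_gen X} => cobar_diff_word (w : seq _))).

Lemma cobar_diff_wordE w : cobar_diff (cobar_word w) = cobar_diff_word (X := X) w.
Proof. by rewrite /cobar_diff /cobar_word linextU. Qed.

Lemma cobar_word_prod w : cobar_word (X := X) w = \prod_(a <- w) cobar_word [:: a].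
Proof.
elim: w => [|a w ih]; first by rewrite big_nil cobar_word0.
by rewrite big_cons -ih -cobar_wordM.
Qed.

Lemma cobar_diff_word_leibniz w : cobar_diff_word (X := X) w
  = leibniz_word (fun a => cobar_word [:: a])
      (fun a => cobar_diff_simplex (tagged (val a) : X (tag (val a)))) (@cobar_gen_deg X) w.
Proof.
elim: w => [//|a w ih].
rewrite -[LHS]/(cobar_diff_simplex (tagged (val a) : X (tag (val a))) * cobar_word w
  + (-1) ^+ cobar_gen_deg a *: (cobar_word [:: a] * cobar_diff_word w)) ih signr_cobar.
by rewrite (cobar_word_prod w).
Qed.

Lemma cobar_diff_word_cat v w : cobar_diff_word (X := X) (v ++ w)
  = cobar_diff_word v * cobar_word w
    + sgn (\sum_(a <- v) cobar_gen_deg a)%N (cobar_word v * cobar_diff_word w).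
Proof.
by rewrite 3!cobar_diff_word_leibniz 2!cobar_word_prod; exact: leibniz_word_cat.
Qed.

Lemma cobar_diffB (a b : cobar X) : cobar_diff (a - b) = cobar_diff a - cobar_diff b.
Proof. exact: raddfB. Qed.

Lemma cobar_diffM m (a b : cobar X) : cobar_in m a ->
  cobar_diff (a * b) = cobar_diff a * b + sgn m (a * cobar_diff b).
Proof.
move=> ha.
apply: (cobar_mem (P := fun a => cobar_diff (a * b) = cobar_diff a * b + sgn m (a * cobar_diff b)) (b := a)) => [|x y hx hy|v va].
- by rewrite !mul0r raddf0 mul0r sgn0 addr0.
- rewrite (mulrBl b x y) !cobar_diffB (mulrBl b) (mulrBl _ x y) sgnB.
  by rewrite [X in X - _ = _]hx [X in _ - X = _]hy opprD addrACA.
apply: (cobar_mem (P := fun b => cobar_diff (cobar_word v * b) = cobar_diff (cobar_word v) * b + sgn m (cobar_word v * cobar_diff b)) (b := b)) => [|x y hx hy|w wb].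
- by rewrite !mulr0 raddf0 mulr0 sgn0 addr0.
- rewrite (mulrBr _ x y) !cobar_diffB mulrBr (mulrBr _ (cobar_diff x)) sgnB.
  by rewrite [X in X - _ = _]hx [X in _ - X = _]hy opprD addrACA.
by rewrite -cobar_wordM !cobar_diff_wordE cobar_diff_word_cat (ha v va).
Qed.

Lemma cobar_diff1 : cobar_diff (1 : cobar X) = 0.
Proof. by rewrite -cobar_word0 cobar_diff_wordE. Qed.

End Cobar.

Section CobarSset.
Variable X : sset.

(** For degenerate x or dim x <= 1 the generator is 0, and so is the right-hand side. Later
    recursions thus avoid a distinction of cases. *)
Lemma cobar_diff_gen n (x : X n) : cobar_diff (gen x) = - cobd (@gen X) x + AW (@bigen X) x x.
Proof.
have ax := sset_ax X.
rewrite -cobar_diff_simplexE; case: genP => [h|a e n1].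
  rewrite raddf0 cobar_diff_simplexE; case: h => [n1|].
    case: n x n1 => [|[|//]] x _.
      by rewrite /= oppr0 /bigen gen_low // mul0r sgn0 addr0.
    rewrite /= !sum_sgn_recl big_ord0 !(@gen_low X 0%N) // /Decl /bigen.
    by rewrite !(@gen_low X 0%N) // !(mul0r, mulr0) !sgn0 !(subr0, oppr0, addr0).
  case: n x => // n x [i [y ->]].
  rewrite (cobd_normalised ax (@gen_normalised X)) oppr0 add0r.
  by apply/esym; exact: (AW_normalised ax ax (@bigen_binormalised X) i y y).
rewrite cobar_diff_wordE /= cobar_word0 mulr1 mulr0 scaler0 addr0.
by rewrite e.
Qed.

End CobarSset.

Section CobarMap.
Variables (X Y : sset) (f : sset_map X Y).

HB.instance Definition _ := GRing.Additive.copy (cobar_map f)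
  (linext (fun w : {fmonom cobar_gen X} =>
    \prod_(a <- (w : seq _)) desusp (smap_simplex f (val a)))).

Lemma cobar_map_word w : cobar_map f (cobar_word w) = \prod_(a <- w) desusp (smap_simplex f (val a)).
Proof. by rewrite /cobar_map /cobar_word linextU. Qed.

Lemma cobar_map1 : cobar_map f 1 = 1.
Proof. by rewrite -cobar_word0 cobar_map_word big_nil. Qed.

Lemma cobar_mapM : {morph cobar_map f : a b / a * b}.
Proof.
move=> a b.
apply: (cobar_mem (P := fun a => cobar_map f (a * b) = cobar_map f a * cobar_map f b) (b := a)) => [|x y hx hy|v va].
- by rewrite !mul0r raddf0 mul0r.
- by rewrite !mulrBl !raddfB /= [X in X - _ = _]hx [X in _ - X = _]hy mulrBl.
apply: (cobar_mem (P := fun b => cobar_map f (cobar_word v * b) = cobar_map f (cobar_word v) * cobar_map f b) (b := b)) => [|x y hx hy|w wb].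
- by rewrite !mulr0 raddf0 mulr0.
- by rewrite !mulrBr !raddfB /= [X in X - _ = _]hx [X in _ - X = _]hy mulrBr.
by rewrite -cobar_wordM !cobar_map_word big_cat.
Qed.

Lemma cobar_map_gen n (x : X n) : cobar_map f (gen x) = gen (f n x).
Proof.
case: genP => [h|a e n1].
  rewrite raddf0; case: h => [n1|]; first by rewrite gen_low.
  by case: n x => // n x [i [y ->]]; rewrite smap_dgn gen_normalised.
by rewrite cobar_map_word big_seq1 e.
Qed.

End CobarMap.

(** Relational form of [AW_nat]. It handles a = tau y, which is compatible with last faces but not
    with d_0, and ratios of two values of tau, which d_0 preserves under a side condition. *)
Lemma AW_rel (A : zmodType) n (U V U' V' : sset_data) (R : forall n, U n -> U' n -> Prop)
    (S : forall n, V n -> V' n -> Prop) (K : bicochain U V A) (K' : bicochain U' V' A)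
    (u : U n) (v : V n) (u' : U' n) (v' : V' n) :
  (forall n a a', R n.+1 a a' -> R n (sset_face ord_max a) (sset_face ord_max a')) ->
  (forall n a a', S n.+1 a a' -> S n (sset_face ord0 a) (sset_face ord0 a')) ->
  (forall p q a b a' b', (p + q)%N = n -> R p a a' -> S q b b' -> K p q a b = K' p q a' b') ->
  R n u u' -> S n v v' -> AW K u v = AW K' u' v'.
Proof.
elim: n U U' R K K' u v u' v' => [|n ih] U U' R K K' u v u' v' hR hS e ru sv; first exact: e.
rewrite !AWS; congr (_ + _).
  apply: e => //; elim: n.+1 u u' ru {ih v v' sv} => [//|m ihm] u u' ru /=.
  by apply: ihm; exact: hR.
apply: (ih (Dec U) (Dec U') (fun n => R n.+1)) => [m a a' r|//|p q a b a' b' e' r s| //|].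
- by rewrite /= !lift0_max; exact: hR.
- by apply: e => //; lia.
- exact: hS.
Qed.

Lemma AW_split (A : zmodType) n (U V : sset_data) (K : bicochain U V A) (u : U n) (v : V n) :
  AW K u v = K 0%N n (vertex0 u) v
    + AW (fun p q u v => if p is 0 then 0 else K p q u v) u v.
Proof.
pose K0 p q (a : U p) (b : V q) := if p is 0 then K p q a b else 0.
rewrite (_ : K 0%N n (vertex0 u) v = AW K0 u v); last by rewrite AW_degl0.
by rewrite -AWD; apply: AW_ext => -[|p] q a b _; rewrite /K0 ?addr0 ?add0r.
Qed.

(* only the last summand involves bidegree (n, 0) *)
Lemma AW_degr0 (A : zmodType) n (U V : sset_data) (k : forall n, U n -> A) (u : U n) (v : V n) :
  AW (fun p q (u : U p) (_ : V q) => if q is 0 then k p u else 0) u v = k n u.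
Proof.
elim: n U k u v => [//|n ih] U k u v; rewrite AWS add0r.
exact: (ih (Dec U) (fun n => k n.+1)).
Qed.

Lemma AW_eq0 (A : zmodType) n (U V : sset_data) (K : bicochain U V A) (u : U n) (v : V n) :
  (forall p q u v, (p + q)%N = n -> K p q u v = 0) -> AW K u v = 0.
Proof. by move=> K0; rewrite -[RHS](@AW0 A n U V u v); exact: AW_ext. Qed.

Definition Pt : sset_data := @SSetData (fun _ => unit) (fun _ _ x => x) (fun _ _ x => x).

(** * Recursion over the degree, and integration over the Cayley graph *)

Section CausalFixpoint.
Variables (S : nat -> Type) (V : zmodType).
Variable Theta : (forall n, S n -> V) -> forall n, S n -> V.

Definition truncate n (f : forall n, S n -> V) : forall n, S n -> V :=
  fun m x => if (m < n)%N then f m x else 0.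

Definition causal_iter k : forall n, S n -> V :=
  iter k (fun f n => Theta (truncate n f) (n := n)) (fun _ _ => 0).

(** In degree n the argument of [Theta] is cut off to degrees below n. This makes every [Theta]
    causal, and [causal_fixE] holds for all of them. *)
Definition causal_fix : forall n, S n -> V := fun n => causal_iter n.+1 (n := n).

Lemma causal_iter_stable n j k (x : S n) : (n < j)%N -> (n < k)%N ->
  causal_iter j x = causal_iter k x.
Proof.
have [b nb] := ubnP n; elim: b n nb j k x => [//|b ih] n nb [|j] [|k] x // nj nk.
suff e : truncate n (causal_iter j) = truncate n (causal_iter k) by rewrite /causal_iter /= -/(causal_iter j) e.
apply: functional_extensionality_dep => m; apply: funext => y; rewrite /truncate.
by case: ltnP => // mn; apply: ih; lia.
Qed.

Lemma causal_fixE n (x : S n) : causal_fix x = Theta (truncate n causal_fix) x.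
Proof.
suff e : truncate n (causal_iter n) = truncate n causal_fix.
  by rewrite {1}/causal_fix /causal_iter /= -/(causal_iter n) e.
apply: functional_extensionality_dep => m; apply: funext => y; rewrite /truncate.
by case: ltnP => // mn; apply: causal_iter_stable.
Qed.

End CausalFixpoint.

Section CayleyGroup.
Variables (G : groupType) (V : zmodType).
Local Open Scope group_scope.

(* the semidirect product of G with the functions from G to V *)
Definition cayley : Type := {classic ((G -> V) * G)%type}.
HB.instance Definition _ := Choice.on cayley.

(** The first component adds increments along y -> b y -> a b y. *)
Definition cayley_mul (a b : cayley) : cayley :=
  ((fun y => (a.1 (b.2 * y)%g + b.1 y)%R), a.2 * b.2).
Definition cayley_one : cayley := ((fun=> 0%R), 1).
Definition cayley_inv (a : cayley) : cayley := ((fun y => (- a.1 (a.2^-1 * y)%g)%R), a.2^-1).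

Lemma cayleyP (a b : cayley) : a.1 =1 b.1 -> a.2 = b.2 -> a = b.
Proof. by case: a b => [a g] [b h] /= /funext -> ->. Qed.

Lemma cayley_mulA : associative cayley_mul.
Proof. by move=> a b c; apply: cayleyP => [y|] /=; rewrite ?mulgA ?addrA. Qed.

Lemma cayley_mul1 : left_id cayley_one cayley_mul.
Proof. by move=> a; apply: cayleyP => [y|] /=; rewrite ?add0r ?mul1g. Qed.

Lemma cayley_mulr1 : right_id cayley_one cayley_mul.
Proof. by move=> a; apply: cayleyP => [y|] /=; rewrite ?addr0 ?mul1g ?mulg1. Qed.

Lemma cayley_mulV : left_inverse cayley_one cayley_inv cayley_mul.
Proof. by move=> a; apply: cayleyP => [y|] /=; rewrite ?mulKg ?addNr ?mulVg. Qed.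

Lemma cayley_mulrV : right_inverse cayley_one cayley_inv cayley_mul.
Proof. by move=> a; apply: cayleyP => [y|] /=; rewrite ?mulgV ?addrN. Qed.

HB.instance Definition _ :=
  isGroup.Build cayley cayley_mulA cayley_mul1 cayley_mulr1 cayley_mulV cayley_mulrV.

End CayleyGroup.

Section LoopIntegral.
Variable X : sset.
Local Open Scope group_scope.

(** The equivalence treats a letter tau x and its inverse at once. *)
Lemma loop_ind n (P : loop X n -> Prop) : P 1 ->
  (forall x g, P g <-> P (tau x * g)) -> forall g, P g.
Proof.
move=> P1 Pt g; have [u ->] := qg_surj g.
elim/fg_ind: u => [//|x a ih|x a ih]; rewrite qg_piM; first exact: (Pt x _).1.
by apply: (Pt x _).2; rewrite qg_piV /tau mulgA mulgV mul1g.
Qed.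

Variables (n : nat) (V : zmodType).

(* The function M on the loop group with M 1 = 0 and
   M (tau x * g) = M g + c x g: it exists since the Cayley graph of a free
   group is a tree. *)
Definition loop_integral (c : X n.+1 -> loop X n -> V) (g : loop X n) : V :=
  ((loop_lift (fun x => (c x, tau x) : cayley (loop X n) V) g : cayley _ _).1 1).

Variable c : X n.+1 -> loop X n -> V.
Hypothesis c0 : forall y g, c (dgn 0 y) g = 0%R.

Let f (x : X n.+1) : cayley (loop X n) V := (c x, tau x).

Let f1 (y : X n) : f (dgn 0 y) = 1.
Proof. by apply: cayleyP => [g|] /=; rewrite ?c0 ?tau_dgn0. Qed.

Lemma loop_integral1 : loop_integral c 1 = 0%R.
Proof. by rewrite /loop_integral (morph1 (loop_liftM f1)). Qed.

Lemma loop_integral_tau x g :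
  loop_integral c (tau x * g) = (loop_integral c g + c x g)%R.
Proof.
(* The second component of the lift is the identity of the loop group; the product rule therefore
   evaluates c x at g. *)
have e2 h : (loop_lift f h : cayley _ _).2 = h.
  apply: (loop_morph_eq (f := fun h => (loop_lift f h : cayley _ _).2) (g := id)) => // [a b|y].
    by rewrite (loop_liftM f1).
  by rewrite (loop_lift_tau f1).
rewrite /loop_integral (loop_liftM f1) (loop_lift_tau f1) /=.
by rewrite e2 mulg1 addrC.
Qed.

End LoopIntegral.

(** * The map psi *)

(* The proof uses the cobar construction only through this interface: [gn x] is
   s^{-1}x, and [cb_fold v R] is the recursion on words with initial value v. *)
Record cobar_algebra (X : sset_data) := CobarAlgebra {
  cb :> nzRingType;
  gn : forall n, X n -> cb;
  cb_in : nat -> cb -> Prop;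
  cb_diff : {additive cb -> cb};
  cb_fold : forall V : zmodType, V -> (forall n, X n -> V -> V) -> {additive cb -> V};
  gn_normalised : normalised gn;
  gn_low : forall n (x : X n), (n <= 1)%N -> gn x = 0;
  gn_in : forall n (x : X n), cb_in n.-1 (gn x);
  cb_in0 : forall n, cb_in n 0;
  cb_inB : forall n a b, cb_in n a -> cb_in n b -> cb_in n (a - b);
  cb_in1 : cb_in 0 1;
  cb_inM : forall m n a b, cb_in m a -> cb_in n b -> cb_in (m + n) (a * b);
  cb_diffM : forall m a b, cb_in m a ->
    cb_diff (a * b) = cb_diff a * b + sgn m (a * cb_diff b);
  cb_diff1 : cb_diff 1 = 0;
  cb_diff_gn : forall n (x : X n), cb_diff (gn x)
    = - cobd gn x + AW (fun p q (a : X p) (b : X q) => sgn p (gn a * gn b)) x x;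
  cb_ind : forall (P : cb -> Prop) b, P 0 -> (forall a b, P a -> P b -> P (a - b)) ->
    P 1 -> (forall n (x : X n) b, (1 < n)%N -> P b -> P (gn x * b)) -> P b;
  cb_in_ind : forall (P : nat -> cb -> Prop) m b, (forall n, P n 0) ->
    (forall n a b, P n a -> P n b -> P n (a - b)) -> P 0%N 1 ->
    (forall n (x : X n) m b, (1 < n)%N -> P m b -> P (n.-1 + m)%N (gn x * b)) ->
    cb_in m b -> P m b;
  cb_pr : nat -> {additive cb -> cb};
  cb_prE : forall m n b, cb_in m b -> cb_pr n b = if m == n then b else 0;
  cb_fold1 : forall (V : zmodType) (v : V) R, @cb_fold V v R 1 = v;
  cb_foldM : forall (V : zmodType) (v : V) (R : forall n, X n -> V -> V) n (x : X n) b,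
    (forall n x, zmod_morphism (R n x)) ->
    (forall n i (x : X n) v, R n.+1 (sset_dgn i x) v = 0) ->
    (forall n (x : X n) v, (n <= 1)%N -> R n x v = 0) ->
    cb_fold v R (gn x * b) = R n x (cb_fold v R b) }.

Arguments gn {X} c {n} x.
Arguments cb_in {X} c n a.
Arguments cb_diff {X} c.

Section Psi.
Variables (X : sset) (B : cobar_algebra X).
Local Notation G := (loop_group X).

(* s^{-1}x, with the value 1 if dim x = 1 *)
Definition unit_gn q : Dec X q -> B :=
  match q with 0 => fun=> 1 | q'.+1 => fun x => gn B (x : X q'.+2) end.

(** The increment psi(tau x * g) - psi g: the splitting formula for psi(tau x * g) minus the
    recursion for psi(tau x), whose value is 0. In bidegree (n, 0) this difference is psi(tau x)(1 -
    1) = 0, and in bidegree (0, n) psi g drops out; so only degrees below n of psi enter. *)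
Definition psi_step (psi : forall n, G n -> B) n (x : X n.+1) (g : loop X n) : B :=
  AW (fun p q (a : G p) (z : Prod (Dec X) G q) =>
        if q == 0%N then 0 else if p == 0%N then - unit_gn z.1
        else psi p a * (psi q z.2 - unit_gn z.1))
     (tau x : G n) ((x, g) : Prod (Dec X) G n).

Definition psi_rec (psi : forall n, G n -> B) : forall n, G n -> B := fun n =>
  match n with
  | 0 => fun=> 1
  | m.+1 => loop_integral (psi_step psi (n := m.+1))
  end.

Definition psi : forall n, G n -> B := causal_fix psi_rec.

Lemma psi0 (g : G 0) : psi g = 1.
Proof. by rewrite /psi causal_fixE. Qed.

Lemma unit_gn_normalised : normalised unit_gn.
Proof. by move=> n i x; exact: gn_normalised. Qed.

Lemma AW_one n (V : sset_data) (A : zmodType) (K : bicochain G V A) (v : V n) :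
  AW K (1%g : loop X n) v = AW (fun p q (_ : Pt p) v => K p q (1%g : loop X p) v) (tt : Pt n) v.
Proof.
apply: (AW_rel (R := fun m (a : G m) _ => a = 1%g) (S := fun m a b => a = b)) => //.
- by move=> m a _ ->; exact: (@sgrp_face1 G _ _).
- by move=> m a b ->.
- by move=> p q a b c d _ -> ->.
Qed.

Lemma psi_step_truncate n (x : X n.+1) g : psi_step (truncate n psi) x g = psi_step psi x g.
Proof.
apply: AW_ext => p q a z e; rewrite /truncate.
case: (posnP q) => // q0; case: (posnP p) => // p0.
have [pn qn] : (p < n)%N /\ (q < n)%N by lia.
by rewrite pn qn.
Qed.

(** The two parts need a common induction: integration requires the increment for x = s_0 y to
    vanish, which uses psi 1 = 0 in lower positive degrees. *)
Lemma psi_main n : (0 < n)%N -> psi (1%g : loop X n) = 0 /\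
  (forall (x : X n.+1) (g : loop X n), psi ((tau x * g)%g : loop X n) = psi g + psi_step psi x g) .
Proof.
have [b nb] := ubnP n; elim: b n nb => [//|b ih] [//|n] nb _.
have c0 (y : X n.+1) (g : loop X n.+1) : psi_step (truncate n.+1 psi) (dgn 0 y) g = 0.
  rewrite psi_step_truncate /psi_step tau_dgn0 AW_one AW_split AW_eq0.
    by rewrite addr0 /= /dgn gn_normalised oppr0.
  by case=> [|p] [|q] // a z epq /=; rewrite (ih p.+1 _ _).1 ?mul0r //; lia.
have e g : psi (g : loop X n.+1) = loop_integral (psi_step (truncate n.+1 psi) (n := n.+1)) g.
  by rewrite /psi causal_fixE.
split=> [|x g]; first by rewrite e (loop_integral1 c0).
by rewrite !e (loop_integral_tau c0) psi_step_truncate.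
Qed.

Lemma psi1 n : psi (1%g : loop X n.+1) = 0.
Proof. exact: (psi_main (ltn0Sn n)).1. Qed.

(** At g = 1 the increment is psi(tau x) minus this sum, and it is also psi(tau x) itself. *)
Lemma psi_gen n (x : X n.+1) :
  AW (fun p q (a : G p) (y : Dec X q) => psi a * unit_gn y) (tau x : G n) (x : Dec X n)
  = if n is 0 then 1 else 0.
Proof.
case: n x => [|n] x; first by rewrite /= psi0 mulr1.
have e : psi (tau x : loop X n.+1) = psi_step psi x 1%g.
  by rewrite -[tau x]mulg1 (psi_main _).2 // psi1 add0r.
have E : psi_step psi x 1%g = AW (fun p q (a : G p) (y : Dec X q) =>
     (if q is 0 then psi a else 0) - psi a * unit_gn y) (tau x : G n.+1) (x : Dec X n.+1).
  apply: (AW_rel (R := fun m (a : G m) (b : G m) => a = b)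
     (S := fun m (z : Prod (Dec X) G m) (y : Dec X m) => z = (y, 1%g : loop X m))) => //.
  - by move=> m a b ->.
  - move=> m a b -> /=; congr pair; exact: (@sgrp_face1 G _ _).
  - move=> p [|q] a z a' z' _ -> -> /=; first by rewrite mulr1 subrr.
    by case: p a a' => [|p] a a' /=; rewrite ?psi0 ?mul1r ?psi1 ?sub0r ?mulrN.
rewrite E AWB AW_degr0 in e; move/eqP: e.
by rewrite eq_sym subr_eq -subr_eq0 opprD addrA subrr sub0r oppr_eq0 => /eqP.
Qed.

Definition bipsi : bicochain G G B := fun p q a b => psi a * psi b.

Lemma psi_tau n (x : X n.+1) (g : loop X n) :
  psi ((tau x * g)%g : loop X n) = AW bipsi (tau x : G n) (g : G n).
Proof.
case: n x g => [|n] x g; first by rewrite !psi0 /= /bipsi !psi0 mulr1.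
rewrite (psi_main _).2 // -[LHS]addr0 -(psi_gen x).
pose z : Prod (Dec X) G n.+1 := (x, g).
have -> : AW bipsi (tau x : G n.+1) (g : G n.+1)
  = AW (fun p q (a : G p) (z : Prod (Dec X) G q) => psi a * psi z.2) (tau x : G n.+1) z.
  by apply/esym/(@AW_nat _ _ _ (Prod (Dec X) G) _ _ (fun n => id) (fun n z => z.2) bipsi).
have -> : AW (fun p q (a : G p) (y : Dec X q) => psi a * unit_gn y) (tau x : G n.+1) (x : Dec X n.+1)
  = AW (fun p q (a : G p) (z : Prod (Dec X) G q) => psi a * unit_gn z.1) (tau x : G n.+1) z.
  by apply/esym/(@AW_nat _ _ _ (Prod (Dec X) G) _ (Dec X) (fun n => id) (fun n z => z.1)
    (fun p q (a : G p) (y : Dec X q) => psi a * unit_gn y)).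
have -> : psi (g : loop X n.+1) = AW (fun p q (a : G p) (z : Prod (Dec X) G q) =>
    if (p == 0%N) && (q != 0%N) then psi z.2 else 0) (tau x : G n.+1) z.
  by rewrite AW_split AW_eq0 ?addr0 // => -[|p] q.
rewrite /psi_step -!AWD; apply: AW_ext => p [|q] a y e /=.
  by rewrite andbF !add0r !psi0.
by case: p a e => [|p] a e /=; rewrite ?psi0 ?mul1r ?mulrBr ?add0r ?subrK // addrA addrN.
Qed.

End Psi.

Lemma AW_mulr (R : nzRingType) n (U V : sset_data) (K : bicochain U V R) c (u : U n) (v : V n) :
  AW (fun p q u v => K p q u v * c) u v = AW K u v * c.
Proof. by elim: n U K u v => [//|n ih] U K u v; rewrite !AWS mulrDl -(ih _ (Decl K)). Qed.

Lemma AW_mull (R : nzRingType) n (U V : sset_data) (K : bicochain U V R) c (u : U n) (v : V n) :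
  AW (fun p q u v => c * K p q u v) u v = c * AW K u v.
Proof. by elim: n U K u v => [//|n ih] U K u v; rewrite !AWS mulrDr -(ih _ (Decl K)). Qed.

(** * The twisting function tau *)

Section TauFace.
Variable X : sset.

(** As a map from [Dec X] to GX, tau commutes with the degeneracies and with all faces except d_0,
    where it is twisted. *)
Lemma tau_face n (i : 'I_n.+1) (x : X n.+2) :
  @sset_face (loop_group X) n (lift ord0 i) (tau x) = tau (@sset_face (Dec X) n (lift ord0 i) x).
Proof.
transitivity (loop_face_gen (lift ord0 i) x); first exact: loop_face_tau.
rewrite /loop_face_gen /=.
by rewrite -(faceE (lift ord0 (lift ord0 i))) lift0.
Qed.

Lemma tau_face_max n (x : X n.+2) :
  @sset_face (loop_group X) n ord_max (tau x) = tau (@sset_face (Dec X) n ord_max x).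
Proof. by rewrite -lift0_max tau_face. Qed.

Lemma tau_dgn n (i : 'I_n.+1) (x : X n.+1) :
  @sset_dgn (loop_group X) n i (tau x) = tau (@sset_dgn (Dec X) n i x).
Proof.
transitivity (tau (dgn i.+1 x)); first exact: loop_dgn_tau.
by rewrite [sset_dgn _ _ in RHS]/= -(dgnE (lift ord0 i)) lift0.
Qed.

Lemma tau_face0 n (x : X n.+2) :
  @sset_face (loop_group X) n ord0 (tau x)
  = ((tau (sset_face ord0 x))^-1 * tau (sset_face (lift ord0 ord0) x))%g.
Proof.
transitivity (loop_face_gen ord0 x); first exact: loop_face_tau.
by rewrite /loop_face_gen /= -(faceE ord0) -(faceE (lift ord0 ord0)).
Qed.

Lemma loop_face_mul n (i : 'I_n.+2) (g h : loop X n.+1) :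
  @sset_face (loop_group X) n i (g * h)%g
  = (@sset_face (loop_group X) n i g * @sset_face (loop_group X) n i h)%g.
Proof. exact: loop_faceM. Qed.

Lemma loop_dgn_mul n (i : 'I_n.+1) (g h : loop X n) :
  @sset_dgn (loop_group X) n i (g * h)%g
  = (@sset_dgn (loop_group X) n i g * @sset_dgn (loop_group X) n i h)%g.
Proof. exact: loop_dgnM. Qed.

Lemma loop_face_inv n (i : 'I_n.+2) (g : loop X n.+1) :
  @sset_face (loop_group X) n i (g^-1)%g = ((@sset_face (loop_group X) n i g : loop X n)^-1)%g.
Proof. exact: (morphV (@loop_faceM X n i)). Qed.

End TauFace.

Section PsiMul.
Variables (X : sset) (B : cobar_algebra X).
Local Notation G := (loop_group X).
Local Notation psi := (psi B).
Local Notation bipsi := (@bipsi X B).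
Let axX := sset_ax X.
Let axG := sset_ax G.

Lemma psi_assoc n (x : X n.+1) (g h : loop X n) :
  (forall m (x : X m.+1) (g : loop X m), (m <= n)%N ->
     psi ((tau x * g)%g : loop X m) = AW bipsi (tau x : G m) (g : G m)) ->
  AW bipsi ((tau x * g)%g : G n) (h : G n)
  = AW (fun p m (y : Dec X p) (z : Prod G G m) => psi (tau y : loop X p) * AW bipsi z.1 z.2)
      (x : Dec X n) ((g, h) : Prod G G n).
Proof.
move=> ptau.
transitivity (AW (fun m r (z : Prod (Dec X) G m) (c : G r) =>
    AW (fun p q (y : Dec X p) (b : G q) => psi (tau y : loop X p) * psi b * psi c) z.1 z.2)
  ((x, g) : Prod (Dec X) G n) (h : G n)).
  apply: (AW_rel (R := fun m (a : G m) (z : Prod (Dec X) G m) => a = (tau z.1 * z.2)%g)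
    (S := fun m (a b : G m) => a = b)) => //.
  - by move=> m a z ->; rewrite loop_face_mul tau_face_max.
  - by move=> m a b ->.
  move=> p q a b z c e -> ->; rewrite AW_mulr /bipsi ptau; last by lia.
  congr (_ * _).
  apply: (AW_rel (R := fun m (a : G m) (y : Dec X m) => a = tau y) (S := fun m (a b : G m) => a = b)) => //.
  - by move=> m a' z' ->; rewrite tau_face_max.
  - by move=> m a' b' ->.
  - by move=> p' q' a' b' c' d' _ -> ->.
rewrite -(AW_coassoc (U := Dec X) (V := G) (W := G) (Dec_axioms axX) axG
  (fun p q r (y : Dec X p) (b : G q) (c : G r) => psi (tau y : loop X p) * psi b * psi c)).
apply: AW_ext => p m y z _; rewrite -AW_mull; apply: AW_ext => q r b c _.
by rewrite mulrA.
Qed.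

(** The difference of the two sides is unchanged when g becomes tau x * g. By [psi_tau] and
    coassociativity it expands into products of psi(tau y) with such differences; induction on the
    degree removes all but the one in bidegree (0, n), which is the difference for g. *)
Lemma psi_mul n (g h : loop X n) : psi ((g * h)%g : loop X n) = AW bipsi (g : G n) (h : G n).
Proof.
have [b nb] := ubnP n; elim: b n nb g h => [//|b ih] n nb.
pose P (g : loop X n) := forall h : loop X n, psi ((g * h)%g : loop X n) = AW bipsi (g : G n) (h : G n).
apply: (@loop_ind X n P) => [h|x g].
  rewrite mul1g AW_one AW_split /bipsi psi0 mul1r AW_eq0 ?addr0 //.
  by case=> [|p] q a c _ //; rewrite psi1 mul0r.
suff e h : psi ((tau x * g * h)%g : loop X n) - AW bipsi ((tau x * g)%g : G n) (h : G n)
    = psi ((g * h)%g : loop X n) - AW bipsi (g : G n) (h : G n).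
  by split=> Pg h; apply/eqP; rewrite -subr_eq0; have := e h; [rewrite (Pg h) subrr => ->|rewrite (Pg h) subrr => <-].
rewrite psi_assoc; last by move=> *; exact: psi_tau.
have -> : psi ((tau x * g * h)%g : loop X n)
  = AW (fun p m (y : Dec X p) (z : Prod G G m) => psi (tau y : loop X p) * psi ((z.1 : loop X m) * z.2)%g)
      (x : Dec X n) ((g, h) : Prod G G n).
  rewrite -mulgA psi_tau.
  apply: (AW_rel (R := fun m (a : G m) (y : Dec X m) => a = tau y)
    (S := fun m (a : G m) (z : Prod G G m) => a = ((z.1 : loop X m) * z.2)%g)) => //.
  - by move=> m a y ->; rewrite tau_face_max.
  - by move=> m a z ->; rewrite loop_face_mul.
  - by move=> p q a c y z _ -> ->.
rewrite -AWB AW_split psi0 !mul1r [X in _ + X]AW_eq0 ?addr0 // => -[|p] m y z e //.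
by rewrite (ih m); [rewrite subrr|lia].
Qed.

(** [AW_normalised] asks for normalised functions, so psi is replaced by [t], its part in degrees at
    most n. In degree n + 1 only the summands of bidegree (n + 1, 0) and (0, n + 1) notice this. *)
Lemma psi_dgn n (i : 'I_n.+1) (g : loop X n) : psi (@sset_dgn G n i g) = 0.
Proof.
have [b nb] := ubnP n; elim: b n nb i g => [//|b ih] n nb i.
pose t : forall m, G m -> B := truncate n.+1 psi.
have nt : normalised t.
  move=> m j g; rewrite /t /truncate; case: ltnP => // mn; apply: ih; lia.
have tE m (g : G m) : (m <= n)%N -> t m g = psi g by rewrite /t /truncate ltnS => ->.
have t0 (g : G n.+1) : t n.+1 g = 0 by rewrite /t /truncate ltnn.
have nu : normalised (@unit_gn X B) := @unit_gn_normalised X B.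
have ptau x : psi (@sset_dgn G n i (tau x)) = 0.
  rewrite tau_dgn; have := psi_gen B (@sset_dgn (Dec X) n i x).
  rewrite (@AW_ext _ _ _ _ _ (fun p q (a : G p) (y : Dec X q) =>
     t p a * unit_gn B y + (if q is 0 then psi a - t p a else 0))); last first.
    move=> p [|q] a y e; first by rewrite /= !mulr1 addrC subrK.
    by rewrite tE ?addr0 //; lia.
  rewrite AWD AW_degr0 -tau_dgn.
  have nK : binormalised (fun p q (a : G p) (y : Dec X q) => t p a * unit_gn B y).
    by split=> p q j a y; rewrite ?nt ?nu ?mul0r ?mulr0.
  by rewrite (AW_normalised axG (Dec_axioms axX) nK) add0r t0 subr0.
move: i ptau => i ptau g; apply: (@loop_ind X n (fun g => psi (@sset_dgn G n i g) = 0)).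
  by rewrite (@sgrp_dgn1 G) psi1.
move=> x {}g; rewrite loop_dgn_mul psi_mul.
rewrite (@AW_ext _ _ _ _ _ (fun p q (a b : G _) =>
   t p a * t q b + (if q is 0 then psi a - t p a else 0)
    + (if p is 0 then psi b - t q b else 0))); last first.
  move=> [|p] [|q] a c e; first (by lia); rewrite /bipsi ?psi0 ?(tE 0%N) ?psi0 ?mul1r ?mulr1 //.
  - by rewrite addr0 addrC subrK.
  - by rewrite addr0 addrC subrK.
  - by rewrite !tE ?addr0 //; lia.
rewrite !AWD AW_degr0.
have nK : binormalised (fun p q (a b : G _) => t p a * t q b).
  by split=> p q j a y; rewrite ?nt ?mul0r ?mulr0.
rewrite (AW_normalised axG axG nK) add0r AW_degl0 // !t0 !subr0 ptau add0r.
by [].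
Qed.

Lemma psi_normalised : normalised psi.
Proof. by move=> n i g; exact: psi_dgn. Qed.

Lemma psi_in n (g : loop X n) : cb_in B n (psi g).
Proof.
have [b nb] := ubnP n; elim: b n nb g => [//|b ih] [|n] nb g; first by rewrite psi0; exact: cb_in1.
have PN m a : cb_in B m a -> cb_in B m (- a).
  by move=> ha; rewrite -[- a]add0r; apply: cb_inB => //; exact: cb_in0.
have PD m a c : cb_in B m a -> cb_in B m c -> cb_in B m (a + c).
  by move=> ha hc; rewrite -[c]opprK; apply: cb_inB => //; exact: PN.
have hu q (y : Dec X q) : cb_in B q (unit_gn B y).
  by case: q y => [|q] y; [exact: cb_in1|exact: (@gn_in _ B q.+2 y)].
have hc x h : cb_in B n.+1 (psi_step psi (x : X n.+2) (h : loop X n.+1)).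
  apply: (AW_closed (P := cb_in B n.+1) (@PD _) (R := fun _ _ => True)) => // p q a z e _.
  case: eqP => q0; first exact: cb_in0.
  case: eqP => p0; first by apply: PN; rewrite -e p0; exact: hu.
  by rewrite -e; apply: cb_inM; [apply: ih; lia|apply: cb_inB; [apply: ih; lia|exact: hu]].
apply: (@loop_ind X n.+1 (fun g => cb_in B n.+1 (psi g))) => [|x h].
  by rewrite psi1; exact: cb_in0.
rewrite (psi_main B _).2 //; split=> [ph|ph]; first exact: PD.
by rewrite -[psi h](addrK (psi_step psi x h)); apply: cb_inB.
Qed.

End PsiMul.

(** * psi commutes with the differentials *)

Section PsiDiff.
Variables (X : sset) (B : cobar_algebra X).
Local Notation G := (loop_group X).
Local Notation psi := (psi B).
Local Notation bipsi := (@bipsi X B).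
Local Notation ugn := (@unit_gn X B).
Let axX := sset_ax X.
Let axG := sset_ax G.
Let axD := Dec_axioms axX.

Lemma cobdl_mul (U V : sset_data) (R : nzRingType) (F : forall n, U n -> R) (H : forall n, V n -> R)
    p q (a : U p) (b : V q) :
  cobdl (fun p q (a : U p) (b : V q) => F p a * H q b) a b = cobd F a * H q b.
Proof.
case: p a => [|p] a /=; first by rewrite mul0r.
by rewrite mulr_suml; apply: eq_bigr => i _; rewrite mulr_sgnr.
Qed.

Lemma cobdr_mul (U V : sset_data) (R : nzRingType) (F : forall n, U n -> R) (H : forall n, V n -> R)
    p q (a : U p) (b : V q) :
  cobdr (fun p q (a : U p) (b : V q) => F p a * H q b) a b = F p a * cobd H b.
Proof.
case: q b => [|q] b /=; first by rewrite mulr0.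
by rewrite mulr_sumr; apply: eq_bigr => i _; rewrite mulr_sgnl.
Qed.

Definition unit_bigen : bicochain (Dec X) X B := fun p r a b => sgn p (ugn a * gn B b).

(** As s^{-1} of an edge counts as 1, the face term - s^{-1} d_0 x becomes the summand of the
    quadratic part with an edge in front. *)
Lemma unit_gn_diff q (x : Dec X q) :
  cb_diff B (ugn x) = cobd ugn x - AW unit_bigen x (@sset_face X q ord0 x).
Proof.
case: q x => [|q] x.
  by rewrite /= cb_diff1 /unit_bigen (gn_low B (n := 0)) // mulr0 sgn0 subr0.
rewrite cb_diff_gn cobdS opprB.
have -> : cobd (Dec1 (@gn X B)) (x : Dec X q.+1) = cobd ugn x.
  case: q x => [|q] x //.
  rewrite /= !sum_sgn_recl !big_ord0 /Dec1 !(gn_low B (n := 1)) //=.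
  by rewrite !subr0 !subrr.
rewrite -addrA; congr (_ + _).
rewrite AWS (gn_low B (n := 0)) // mul0r sgn0 add0r.
rewrite (_ : AW unit_bigen x _ = AW (fun p r (a : Dec X p) (b : X r) =>
  (if p is 0 then gn B b else 0) - sgn p.+1 (gn B (a : X p.+1) * gn B b)) x (@sset_face X q.+1 ord0 x)).
  rewrite [in RHS]AWB.
  rewrite [X in - (X - _)](_ : _ = gn B (@sset_face X q.+1 ord0 x)); last exact: AW_degl0.
  by rewrite opprB [LHS]addrC.
apply: AW_ext => -[|p] r a b _; rewrite /unit_bigen /=.
  by rewrite mul1r (gn_low B (n := 1)) // mul0r sgn0 subr0.
by rewrite [in RHS]sgnS sub0r opprK.
Qed.

Definition psiu : bicochain G (Dec X) B := fun p q a y => psi a * ugn y.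

Lemma psiu_assoc n (g h : loop X n) (y : Dec X n) :
  AW psiu ((g * h)%g : G n) y
  = AW (fun p m (a : G p) (w : Prod G (Dec X) m) => psi a * AW psiu w.1 w.2) (g : G n)
      ((h, y) : Prod G (Dec X) n).
Proof.
transitivity (AW (fun m r (z : Prod G G m) (c : Dec X r) =>
    AW (fun p q (a : G p) (b : G q) => psi a * psi b * ugn c) z.1 z.2)
  ((g, h) : Prod G G n) y).
  apply: (AW_rel (R := fun m (a : G m) (z : Prod G G m) => a = ((z.1 : loop X m) * z.2)%g)
    (S := fun m (a b : Dec X m) => a = b)) => //.
  - by move=> m a z ->; rewrite loop_face_mul.
  - by move=> m a b ->.
  - by move=> p q a b z c e -> ->; rewrite AW_mulr /psiu psi_mul.
rewrite -(AW_coassoc (U := G) (V := G) (W := Dec X) axG axG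
  (fun p q r (a : G p) (b : G q) (c : Dec X r) => psi a * psi b * ugn c)).
apply: AW_ext => p m a z _; rewrite -AW_mull; apply: AW_ext => q r b c _.
by rewrite /psiu mulrA.
Qed.

(** Applied to d_0 x and d_1 x, it evaluates the twisted face d_0 tau x. Write tau x1 = tau x0 * z
    and expand the recursion for x1 by [psiu_assoc]; compare it with the recursion for x0. The
    summands with p > 0 agree by induction, since d_0 z is again such a ratio: the factors tau d_0
    x0 and tau d_0 x1 cancel. The summands with p = 0 give the claim. *)
Lemma psiu_ratio m (x0 x1 : X m.+1) : sset_face ord0 x0 = sset_face ord0 x1 ->
  AW psiu (((tau x0)^-1 * tau x1)%g : G m) (x1 : Dec X m) = ugn (x0 : Dec X m).
Proof.
have [b mb] := ubnP m; elim: b m mb x0 x1 => [//|b ih] m mb x0 x1 e0.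
set z := ((tau x0)^-1 * tau x1)%g.
have ez : tau x1 = (tau x0 * z)%g by rewrite /z mulgA mulgV mul1g.
have spl (g : G m) (y : Dec X m) : AW psiu g y
    = ugn y + AW (fun p q (a : G p) (y : Dec X q) => if p is 0 then 0 else psi a * ugn y) g y.
  by rewrite AW_split /psiu psi0 mul1r.
have := psi_gen B x1; rewrite -(psi_gen B x0) ez => e.
have := spl (tau x0) x0; rewrite -[LHS]e [LHS]psiu_assoc AW_split psi0 mul1r.
set S2 := (X in _ + X = _ -> _); set S3 := (X in _ = _ + X -> _).
suff -> : S2 = S3 by move=> h; exact: (addIr _ h).
apply/esym; apply: (AW_rel (R := fun m (a b : G m) => a = b)
  (S := fun m (y0 : Dec X m) (w : Prod G (Dec X) m) =>
     w.1 = ((tau (y0 : X m.+1))^-1 * tau (w.2 : X m.+1))%g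
     /\ @sset_face X m ord0 y0 = @sset_face X m ord0 w.2)) => //.
- by move=> k a c ->.
- move=> k y [w y1] [ew ey]; split.
    have -> : w = ((tau (y : X k.+2))^-1 * tau (y1 : X k.+2))%g by exact: ew.
    transitivity (@sset_face G k ord0 ((tau (y : X k.+2))^-1 * tau (y1 : X k.+2))%g) => //.
    rewrite loop_face_mul loop_face_inv !tau_face0.
    have <- : @sset_face X k.+1 ord0 y = @sset_face X k.+1 ord0 y1 by exact: ey.
    rewrite invgM invgK -!mulgA; congr (_ * _)%g.
    by rewrite mulgA mulgV mul1g.
  rewrite /= !face0_face //. congr (sset_face _ _). exact: ey.
move=> [|p] q a y a' [w y1] e' ea [/= ew ey] //.
by rewrite ea ew ih //; lia.
Qed.

Definition defect n (g : G n) : B := cb_diff B (psi g) - cobd psi g.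

Lemma defect0 (g : G 0) : defect g = 0.
Proof. by rewrite /defect psi0 cb_diff1 subr0. Qed.

(** With no defect in lower degrees, the Leibniz rule leaves only the bidegrees (n + 1, 0) and (0, n
    + 1). *)
Lemma defect_mul n (g h : loop X n.+1) : (forall m (g : G m), (m <= n)%N -> defect g = 0) ->
  defect ((g * h)%g : G n.+1) = defect (g : G n.+1) + defect (h : G n.+1).
Proof.
move=> d0.
have e : cobd psi ((g * h)%g : G n.+1) = AW (bicobd bipsi) (g : G n.+1) (h : G n.+1).
  rewrite AW_cobd //; apply: eq_bigr => i _.
  by rewrite loop_face_mul psi_mul.
rewrite /defect psi_mul -AW_raddf e -AWB.
rewrite (@AW_ext _ _ _ _ _ (fun p q (a b : G _) =>
  (if q is 0 then defect a else 0) + (if p is 0 then defect b else 0))).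
  by rewrite AWD AW_degr0 AW_degl0.
move=> p q a b epq; rewrite /bicobd cobdl_mul cobdr_mul /bipsi (cb_diffM (m := p)); last exact: psi_in.
rewrite opprD addrACA -mulrBl -sgnB -mulrBr -/(defect a) -/(defect b).
case: p a epq => [|p] a epq; case: q b epq => [|q] b epq; first by [].
- by rewrite defect0 mul0r !add0r psi0 mul1r.
- by rewrite defect0 mulr0 sgn0 psi0 mulr1.
- by rewrite !d0 ?mul0r ?mulr0 ?sgn0 //; lia.
Qed.

(** Differentiate [psi_gen]. The coboundary contributes s^{-1} d_0 x, through [psiu_ratio] ([E1]);
    the quadratic part of the differential contributes the same with opposite sign ([E3]); only the
    defect of tau x is left ([E2]). *)
Lemma defect_tau n (x : X n.+2) : (forall m (g : G m), (m <= n)%N -> defect g = 0) ->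
  defect (tau x : G n.+1) = 0.
Proof.
move=> d0.
have E1 : AW (bicobd psiu) (tau x : G n.+1) (x : Dec X n.+1) = gn B (sset_face ord0 x).
  rewrite AW_cobd // [LHS]sum_sgn_recl tau_face0 psiu_ratio; last by rewrite face0_face.
  rewrite (eq_bigr (fun i : 'I_n.+1 => sgn i (if n is 0 then 1 else 0))); last first.
    by move=> i _; rewrite tau_face psi_gen.
  case: n x d0 => [|n] x d0.
    by rewrite big_ord1 sgn_ord0 /= subrr gn_low.
  by rewrite big1 ?subr0 // => i _; rewrite sgn0.
have E2 : AW (fun p q (a : G p) (y : Dec X q) => defect a * ugn y) (tau x : G n.+1) (x : Dec X n.+1)
    = defect (tau x : G n.+1).
  rewrite (@AW_ext _ _ _ _ _ (fun p q (a : G p) (y : Dec X q) => if q is 0 then defect a else 0)).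
    by rewrite AW_degr0.
  move=> p [|q] a y e; first by rewrite mulr1.
  by rewrite d0 ?mul0r //; lia.
have E3 : AW (fun p q (a : G p) (y : Dec X q) =>
    sgn p (psi a * AW unit_bigen y (@sset_face X q ord0 y))) (tau x : G n.+1) (x : Dec X n.+1)
    = gn B (sset_face ord0 x).
  transitivity (AW (fun p q (a : G p) (w : Prod (Dec X) X q) =>
     AW (fun k r (y : Dec X k) (b : X r) => sgn p (psi a * sgn k (ugn y * gn B b))) w.1 w.2)
     (tau x : G n.+1) ((x, sset_face ord0 x) : Prod (Dec X) X n.+1)).
    apply: (AW_rel (R := fun m (a b : G m) => a = b)
      (S := fun m (y : Dec X m) (w : Prod (Dec X) X m) => w = (y, @sset_face X m ord0 y))) => //.
    - by move=> m a b ->.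
    - by move=> m y w -> /=; rewrite face0_face.
    - by move=> p q a y a' w _ -> -> /=; rewrite AW_sgn AW_mull.
  rewrite (AW_coassoc (U := G) (V := Dec X) (W := X) axG axD
    (fun p k r (a : G p) (y : Dec X k) (b : X r) => sgn p (psi a * sgn k (ugn y * gn B b)))).
  transitivity (AW (fun m r (y : Dec X m) (b : X r) => if m is 0 then gn B b else 0)
     (x : Dec X n.+1) (sset_face ord0 x)); last by rewrite AW_degl0.
  apply: (AW_rel (R := fun m (z : Prod G (Dec X) m) (y : Dec X m) => z = (tau (y : X m.+1), y))
    (S := fun m (a b : X m) => a = b)) => //.
  - by move=> m z y ->; rewrite -tau_face_max.
  - by move=> m a b ->.
  move=> m r z b y b' _ -> ->.
  rewrite (@AW_ext _ _ _ _ _ (fun p k (a : G p) (y : Dec X k) => sgn m (psi a * ugn y * gn B b'))).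
    rewrite AW_sgn AW_mulr psi_gen.
    by case: (m) => [|k]; rewrite ?mul1r // mul0r sgn0.
  by move=> p k a c <-; rewrite mulr_sgnl sgn_add mulrA.
have : cb_diff B (AW psiu (tau x : G n.+1) (x : Dec X n.+1)) = 0 by rewrite psi_gen raddf0.
rewrite -AW_raddf (@AW_ext _ _ _ _ _ (fun p q (a : G p) (y : Dec X q) =>
  bicobd psiu a y + defect a * ugn y
  - sgn p (psi a * AW unit_bigen y (@sset_face X q ord0 y)))); last first.
  move=> p q a y _; rewrite /psiu (cb_diffM (m := p)); last exact: psi_in.
  rewrite unit_gn_diff mulrBr sgnB addrA; congr (_ - _).
  rewrite /bicobd cobdl_mul cobdr_mul /defect mulrBl.
  set u := cb_diff B _ * _; set v := cobd psi a * _; set w := sgn p _; abel.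
by rewrite AWB AWD E1 E2 E3 addrAC subrr add0r.
Qed.

Lemma psi_diff n (g : loop X n) : cb_diff B (psi g) = cobd psi (g : G n).
Proof.
apply/eqP; rewrite -subr_eq0 -/(defect _); apply/eqP.
have [b nb] := ubnP n; elim: b n nb g => [//|b ih] [|n] nb g; first exact: defect0.
have d0 m (h : G m) : (m <= n)%N -> defect h = 0 by move=> mn; apply: ih; lia.
apply: (@loop_ind X n.+1 (fun g => defect (g : G n.+1) = 0)) => [|x h].
  have := defect_mul 1%g 1%g d0; rewrite mul1g => /eqP.
  by rewrite -subr_eq0 opprD addrA subrr sub0r oppr_eq0 => /eqP.
by rewrite (defect_mul _ _ d0) (defect_tau _ d0) add0r.
Qed.

(** The right ideal generated by the s^{-1}x with dim x <= q, as the intersection of all subgroups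
    that contain the products s^{-1}x * b. *)
Definition lead_le (q : nat) (b : B) : Prop := forall P : B -> Prop,
  P 0 -> (forall a b, P a -> P b -> P (a - b)) ->
  (forall n (x : X n) b, (n <= q)%N -> P (gn B x * b)) -> P b.

Lemma lead_le0 q : lead_le q 0. Proof. by move=> P. Qed.

Lemma lead_leB q a b : lead_le q a -> lead_le q b -> lead_le q (a - b).
Proof. by move=> ha hb P P0 PB Pg; apply: (PB); [exact: ha|exact: hb]. Qed.

Lemma lead_leN q a : lead_le q a -> lead_le q (- a).
Proof. by move=> ha; rewrite -[- a]add0r; apply: lead_leB. Qed.

Lemma lead_leD q a b : lead_le q a -> lead_le q b -> lead_le q (a + b).
Proof. by move=> ha hb; rewrite -[b]opprK; apply: lead_leB => //; exact: lead_leN. Qed.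

Lemma lead_leMr q a b : lead_le q a -> lead_le q (a * b).
Proof.
move=> ha P P0 PB Pg; apply: (ha (fun a => P (a * b))) => [|x y hx hy|n x c nq].
- by rewrite mul0r.
- by rewrite mulrBl; exact: PB.
- by rewrite -mulrA; exact: Pg.
Qed.

Lemma lead_leW p q a : (p <= q)%N -> lead_le p a -> lead_le q a.
Proof. by move=> pq ha P P0 PB Pg; apply: (ha P) => // n x b np; apply: Pg; lia. Qed.

Lemma lead_le_gn n (x : X n) : lead_le n (gn B x).
Proof. by move=> P P0 PB Pg; rewrite -[gn B x]mulr1; exact: Pg. Qed.

(** In [psi_gen] the summand with p = 0 is s^{-1}x; apart from psi(tau x), every other summand
    begins with psi(tau y) for a proper front face y of x. *)
Lemma psi_lead n (x : X n.+2) : lead_le n.+1 (psi (tau x : loop X n.+1) + gn B x).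
Proof.
have [b nb] := ubnP n; elim: b n nb x => [//|b ih] n nb x.
have := psi_gen B x; rewrite AW_split psi0 mul1r.
rewrite (@AW_ext _ _ _ _ _ (fun p q (a : G p) (y : Dec X q) =>
  (if q is 0 then psi a else 0) + (if (p == 0%N) || (q == 0%N) then 0 else psi a * ugn y))); last first.
  by move=> [|p] [|q] a y e //=; rewrite ?mulr1 ?addr0 ?add0r.
rewrite AWD AW_degr0 addrA [_ + psi _]addrC => /eqP; rewrite addr_eq0 => /eqP ->.
apply: lead_leN; apply: (AW_closed (@lead_leD _) (R := fun m (a : G m) => exists y : X m.+1, a = tau y)).
- by move=> m a [y ->]; exists (@sset_face (Dec X) m ord_max y); rewrite tau_face_max.
- move=> [|p] [|q] a y e [z ->] //=; try exact: lead_le0.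
  apply: lead_leMr; apply: (@lead_leW p.+2); first by lia.
  rewrite -[psi _](addrK (gn B z)); apply: lead_leB; last exact: lead_le_gn.
  by apply: (@lead_leW p.+1) => //; apply: ih; lia.
- by exists x.
Qed.

End PsiDiff.

Section PsiNatural.
Variables (X Y : sset) (f : sset_map X Y) (BX : cobar_algebra X) (BY : cobar_algebra Y).
Variable fB : {additive BX -> BY}.
Hypotheses (fB1 : fB 1 = 1) (fBM : {morph fB : a b / a * b}).
Hypothesis fBgn : forall n (x : X n), fB (gn BX x) = gn BY (f n x).

Lemma psi_natural n (g : loop X n) : fB (psi BX g) = psi BY (loop_map f n g).
Proof.
have [b nb] := ubnP n; elim: b n nb g => [//|b ih] [|n] nb g; first by rewrite !psi0.
have fu q (y : Dec X q) : fB (unit_gn BX y) = unit_gn BY (f q.+1 y : Dec Y q).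
  by case: q y => [|q] y /=.
apply: (@loop_ind X n.+1 (fun g => fB (psi BX g) = psi BY (loop_map f n.+1 g))) => [|x h].
  by rewrite psi1 raddf0 [loop_map f n.+1 _](morph1 (@loop_mapM X Y f n.+1)) psi1.
have -> : loop_map f n.+1 (tau x * h)%g = (tau (f n.+2 x) * loop_map f n.+1 h)%g.
  by rewrite /= loop_mapM loop_map_tau.
rewrite !(psi_main _ _).2 // raddfD.
have -> : fB (psi_step (psi BX) x h) = psi_step (psi BY) (f n.+2 x) (loop_map f n.+1 h).
  rewrite -AW_raddf; apply: (AW_rel
     (R := fun m (a : loop_group X m) (b : loop_group Y m) => b = loop_map f m a)
     (S := fun m (z : Prod (Dec X) (loop_group X) m) (w : Prod (Dec Y) (loop_group Y) m) =>
        w = (f m.+1 z.1, loop_map f m z.2))) => //.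
  - by move=> m a c ->; rewrite smap_face.
  - by move=> m z w -> /=; rewrite smap_face loop_map_face.
  - move=> p q a z a' w e -> -> /=.
    case: eqP => q0; first by rewrite raddf0.
    case: eqP => p0; first by rewrite raddfN fu.
    by rewrite fBM raddfB fu !ih //; lia.
  - by rewrite /= loop_map_tau.
by split=> [->//|/addIr].
Qed.

End PsiNatural.

(** * The contraction of the kernel of psi *)

(** The chains of a simplicial group are used through this interface only: [ce g] is the chain of g,
    and [ch_lin F] the linear extension of F. *)
Record chain_algebra (G : sgroup) := ChainAlgebra {
  ch :> nzRingType;
  ce : forall n, G n -> ch;
  ch_in : nat -> ch -> Prop;
  ch_bd : {additive ch -> ch};
  ch_lin : forall V : zmodType, (forall n, G n -> V) -> {additive ch -> V};
  ce_normalised : normalised ce;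
  ce_in : forall n (g : G n), ch_in n (ce g);
  ch_in0 : forall n, ch_in n 0;
  ch_inB : forall n a b, ch_in n a -> ch_in n b -> ch_in n (a - b);
  ch_inM : forall m n a b, ch_in m a -> ch_in n b -> ch_in (m + n) (a * b);
  ch_bd_ce : forall n (g : G n), ch_bd (ce g) = cobd ce g;
  ch_bdM : forall m a b, ch_in m a ->
    ch_bd (a * b) = ch_bd a * b + sgn m (a * ch_bd b);
  ce1 : ce (1%g : sgrp G 0) = 1;
  ceM : forall p q (g : G p) (h : G q),
    ce g * ce h = sh (fun n (u v : G n) => ce ((u : sgrp G n) * v)%g) g h;
  ch_lin_ce : forall (V : zmodType) (F : forall n, G n -> V) n (g : G n),
    normalised F -> ch_lin F (ce g) = F n g;
  ch_ind : forall (P : ch -> Prop) a, P 0 -> (forall a b, P a -> P b -> P (a - b)) ->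
    (forall n (g : G n), P (ce g)) -> P a;
  ch_in_ind : forall (P : ch -> Prop) n a, P 0 -> (forall a b, P a -> P b -> P (a - b)) ->
    (forall g : G n, P (ce g)) -> ch_in n a -> P a }.

Arguments ce {G} c {n} g.
Arguments ch_in {G} c n a.
Arguments ch_bd {G} c.
Arguments ch_lin {G} c {V} F.

Section ChainAlgebra.
Variables (G : sgroup) (A : chain_algebra G).
Let axG := sset_ax G.
Local Notation e := (ce A).
Local Notation bd := (ch_bd A).

Lemma ch_inN n (a : A) : ch_in A n a -> ch_in A n (- a).
Proof. by move=> ha; rewrite -[- a]add0r; apply: ch_inB => //; exact: ch_in0. Qed.

Lemma ch_inD n (a b : A) : ch_in A n a -> ch_in A n b -> ch_in A n (a + b).
Proof. by move=> ha hb; rewrite -[b]opprK; apply: ch_inB => //; exact: ch_inN. Qed.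

Lemma ch_in_sgn k n (a : A) : ch_in A n a -> ch_in A n (sgn k a).
Proof. by move=> ha; rewrite /sgn; case: odd => //; exact: ch_inN. Qed.

Lemma ch_in_sum n (I : Type) (r : seq I) (P : pred I) (f : I -> A) :
  (forall i, P i -> ch_in A n (f i)) -> ch_in A n (\sum_(i <- r | P i) f i).
Proof.
move=> h; elim/big_rec: _ => [|i c Pi hc]; first exact: ch_in0.
by apply: ch_inD => //; exact: h.
Qed.

Lemma bd_in n (a : A) : ch_in A n.+1 a -> ch_in A n (bd a).
Proof.
apply: (ch_in_ind (P := fun a => ch_in A n (bd a))) => [|x y hx hy|g].
- by rewrite raddf0; exact: ch_in0.
- by rewrite raddfB; exact: ch_inB.
- by rewrite ch_bd_ce; apply: ch_in_sum => i _; apply/ch_in_sgn/ce_in.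
Qed.

Lemma bd_in0 (a : A) : ch_in A 0 a -> bd a = 0.
Proof.
apply: (ch_in_ind (P := fun a => bd a = 0)) => [|x y hx hy|g].
- exact: raddf0.
- by rewrite raddfB hx hy subrr.
- by rewrite ch_bd_ce.
Qed.

Lemma ch_additive_eq (V : zmodType) (f g : {additive A -> V}) :
  (forall n (x : G n), f (e x) = g (e x)) -> f =1 g.
Proof.
move=> h a; apply: (ch_ind (P := fun a => f a = g a)) => [|x y hx hy|n x].
- by rewrite !raddf0.
- by rewrite !raddfB hx hy.
- exact: h.
Qed.

Lemma raddf_cobd (X : sset_data) (V W : zmodType) (f : {additive V -> W}) (F : forall n, X n -> V) n
    (x : X n) : f (cobd F x) = cobd (fun n (x : X n) => f (F n x)) x.
Proof.
case: n x => [|n] x; first exact: raddf0.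
by rewrite /= raddf_sum; apply: eq_bigr => i _; rewrite raddf_sgn.
Qed.

Lemma cobd_ext (X : sset_data) (V : zmodType) (F H : forall n, X n -> V) n (x : X n) :
  (forall n (x : X n), F n x = H n x) -> cobd F x = cobd H x.
Proof. by move=> h; case: n x => [//|n] x; apply: eq_bigr => i _; rewrite h. Qed.

Lemma bd_bd (a : A) : bd (bd a) = 0.
Proof.
apply: (ch_additive_eq (f := bd \o bd) (g := \0)) => n x /=.
rewrite ch_bd_ce raddf_cobd -[RHS](cobd_cobd axG (fun n (x : G n) => e x) x).
by apply: cobd_ext => m y; rewrite ch_bd_ce.
Qed.

Definition ch_pr n : {additive A -> A} := ch_lin A (fun m (g : G m) => if (m < n)%N then e g else 0).

Lemma ch_pr_ce n m (g : G m) : ch_pr n (e g) = if (m < n)%N then e g else 0.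
Proof.
rewrite /ch_pr ch_lin_ce // => k i x.
by case: ifP => // _; exact: ce_normalised.
Qed.

Lemma ch_pr_large (a : A) : exists n, ch_pr n a = a.
Proof.
suff [n h] : exists n, forall m, (n <= m)%N -> ch_pr m a = a by exists n; exact: h.
apply: (ch_ind (P := fun a => exists n, forall m, (n <= m)%N -> ch_pr m a = a))
  => [|x y [n hx] [k hy]|n g].
- by exists 0%N => m _; rewrite raddf0.
- by exists (maxn n k) => m; rewrite geq_max => /andP[nm km]; rewrite raddfB hx // hy.
- by exists n.+1 => m nm; rewrite ch_pr_ce nm.
Qed.

End ChainAlgebra.

(** * psi as a surjective homomorphism of differential graded algebras *)

Section PsiHat.
Variables (X : sset) (A : chain_algebra (loop_group X)) (B : cobar_algebra X).
Local Notation G := (loop_group X).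
Let axG := sset_ax G.
Local Notation e := (ce A).
Local Notation psi := (psi B).

Definition psih : {additive A -> B} := ch_lin A psi.

Lemma psih_ce n (g : G n) : psih (e g) = psi g.
Proof. by rewrite /psih ch_lin_ce //; exact: psi_normalised. Qed.

Lemma bipsi_binormalised : binormalised (@bipsi X B).
Proof. by split=> p q i u v; rewrite /bipsi psi_normalised ?mul0r ?mulr0. Qed.

(** By [psi_mul], psi of a product in GX is the Alexander-Whitney evaluation of [bipsi], and [sh_AW]
    undoes the shuffle map. *)
Lemma psih_mul (a b : A) : psih (a * b) = psih a * psih b.
Proof.
apply: (ch_ind (P := fun a => psih (a * b) = psih a * psih b)) => [|x y hx hy|p g].
- by rewrite mul0r !raddf0 mul0r.
- by rewrite mulrBl !raddfB mulrBl hx hy.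
apply: (ch_ind (P := fun b => psih (e g * b) = psih (e g) * psih b)) => [|x y hx hy|q h].
- by rewrite mulr0 !raddf0 mulr0.
- by rewrite mulrBr !raddfB mulrBr hx hy.
rewrite ceM -sh_raddf !psih_ce -[RHS](sh_AW axG axG _ _ bipsi_binormalised).
by apply: sh_ext => n u v _; rewrite psih_ce psi_mul.
Qed.

Lemma psih1 : psih 1 = 1.
Proof. by rewrite -(ce1 A) psih_ce psi0. Qed.

Lemma psih_bd (a : A) : psih (ch_bd A a) = cb_diff B (psih a).
Proof.
apply: (ch_additive_eq (f := psih \o ch_bd A) (g := cb_diff B \o psih)) => n g /=.
rewrite ch_bd_ce psih_ce psi_diff raddf_cobd; apply: cobd_ext => m x; exact: psih_ce.
Qed.

Lemma psih_in n (a : A) : ch_in A n a -> cb_in B n (psih a).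
Proof.
apply: (ch_in_ind (P := fun a => cb_in B n (psih a))) => [|x y hx hy|g].
- by rewrite raddf0; exact: cb_in0.
- by rewrite raddfB; exact: cb_inB.
- by rewrite psih_ce; exact: psi_in.
Qed.

Definition liftable n (b : B) : Prop := exists2 a, ch_in A n a & psih a = b.

Lemma liftable0 n : liftable n 0.
Proof. by exists 0; [exact: ch_in0|exact: raddf0]. Qed.

Lemma liftableB n a b : liftable n a -> liftable n b -> liftable n (a - b).
Proof.
by move=> [x hx <-] [y hy <-]; exists (x - y); [exact: ch_inB|rewrite raddfB].
Qed.

Lemma liftableM m n a b : liftable m a -> liftable n b -> liftable (m + n) (a * b).
Proof.
by move=> [x hx <-] [y hy <-]; exists (x * y); [exact: ch_inM|rewrite psih_mul].
Qed.

Lemma liftable_psi n (g : loop X n) : liftable n (psi g).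
Proof. by exists (e g); [exact: ce_in|exact: psih_ce]. Qed.

(** [psi_gen], solved for its summand s^{-1}x, expresses it through values of psi and generators of
    smaller dimension. *)
Lemma liftable_gn n (x : X n) : liftable n.-1 (gn B x).
Proof.
have [b nb] := ubnP n; elim: b n nb x => [//|b ih] [|[|n]] nb x; try by rewrite gn_low //; exact: liftable0.
have := psi_gen B x; rewrite AW_split psi0 mul1r => /eqP; rewrite addr_eq0 => /eqP h; rewrite (h : gn B x = _) -[- _]sub0r; apply: liftableB; first exact: liftable0.
apply: (AW_closed _ (R := fun m _ => True)) => //.
  move=> x1 x2 h1 h2; rewrite -[x2]opprK; apply: liftableB => //.
  by rewrite -[- x2]sub0r; apply: liftableB => //; exact: liftable0.
move=> [|p] q u y e' _; first exact: liftable0.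
rewrite -e'; apply: liftableM; first exact: liftable_psi.
case: q y e' => [|q] y e'; first by exists 1; [rewrite -(ce1 A); exact: ce_in|exact: psih1].
by apply: (ih q.+2); lia.
Qed.

Lemma psih_lift m (b : B) : cb_in B m b -> liftable m b.
Proof.
apply: (cb_in_ind liftable0 liftableB) => [|n x k c _ hc].
  by exists 1; [rewrite -(ce1 A); exact: ce_in|exact: psih1].
by apply: liftableM => //; exact: liftable_gn.
Qed.

Lemma psih_surj (b : B) : exists a, psih a = b.
Proof.
apply: (cb_ind (P := fun b => exists a, psih a = b)) => [|a c [x <-] [y <-]||n x c _ [y <-]].
- by exists 0; exact: raddf0.
- by exists (x - y); exact: raddfB.
- by exists 1; exact: psih1.
- by have [z _ <-] := liftable_gn x; exists (z * y); exact: psih_mul.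
Qed.

Lemma psih_pr n (a : A) : psih (ch_pr A n a) = \sum_(m < n) cb_pr B m (psih a).
Proof.
apply: (ch_ind (P := fun a => psih (ch_pr A n a) = \sum_(m < n) cb_pr B m (psih a)))
  => [|x y hx hy|k g].
- by rewrite !raddf0 big1 // => m _; rewrite raddf0.
- by rewrite !raddfB hx hy -sumrB; apply: eq_bigr => m _; rewrite !raddfB.
rewrite ch_pr_ce psih_ce; case: ltnP => kn.
  rewrite psih_ce (bigD1 (Ordinal kn)) //= (cb_prE _ (psi_in B g)) eqxx big1 ?addr0 // => m mk.
  rewrite (cb_prE _ (psi_in B g)); case: eqP => // km; case/eqP: mk; exact: val_inj.
rewrite raddf0 big1 // => m _; rewrite (cb_prE _ (psi_in B g)).
by case: eqP => // km; have := ltn_ord m; lia.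
Qed.

Definition kills (V : zmodType) (T : A -> V) (n : nat) : Prop :=
  forall m a, (m < n)%N -> ch_in A m a -> psih a = 0 -> T a = 0.

(** The kernel of psi is graded, by [psih_pr], so it is enough that T vanishes on its homogeneous
    elements. *)
Lemma kills_pr (V : zmodType) (T : {additive A -> V}) n a :
  kills T n -> psih a = 0 -> T (ch_pr A n a) = 0.
Proof.
elim: n => [|n ih] hT pa.
  by rewrite (_ : ch_pr A 0 a = 0) ?raddf0 //; apply: (ch_additive_eq (f := ch_pr A 0) (g := \0)) => k g; rewrite ch_pr_ce.
have hn : forall c, ch_in A n (ch_pr A n.+1 c - ch_pr A n c).
  move=> c; apply: (ch_ind (P := fun c => ch_in A n (ch_pr A n.+1 c - ch_pr A n c))) => [|x y hx hy|k g].
  - by rewrite !raddf0 addr0; exact: ch_in0.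
  - rewrite (raddfB (ch_pr A n.+1)) (raddfB (ch_pr A n)) (opprD (ch_pr A n x)) addrACA -opprD.
    exact: ch_inB.
  - rewrite !ch_pr_ce; case: (eqVneq k n) g => [-> g|kn g].
      by rewrite ltnSn ltnn subr0; exact: ce_in.
    rewrite ltnS leq_eqVlt (negbTE kn) /=; case: ifP => _; rewrite ?subrr ?subr0; exact: ch_in0.
rewrite -[ch_pr A n.+1 a](subrK (ch_pr A n a)) raddfD ih // ?addr0; last first.
  by move=> m c mn; apply: hT; lia.
apply: (hT n) => //; rewrite raddfB !psih_pr pa !big1 ?subrr // => m _; exact: raddf0.
Qed.

(** As psi is surjective, L is unique, and the choice of the preimages [s] leaves no trace in it.
    Naturality of [section] depends on this. *)
Lemma descend (V : zmodType) (T : {additive A -> V}) : (forall a, psih a = 0 -> T a = 0) ->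
  exists L : {additive B -> V}, forall a, L (psih a) = T a.
Proof.
move=> hT; pose s b := projT1 (cid (psih_surj b)).
have sK b : psih (s b) = b by rewrite /s; case: cid.
have TE a b : psih a = psih b -> T a = T b.
  by move=> h; apply/eqP; rewrite -subr_eq0 -raddfB hT // raddfB h subrr.
pose L b := T (s b).
have LB : zmod_morphism L.
  by move=> a b; rewrite /L -raddfB; apply: TE; rewrite raddfB !sK.
pose L' : {additive B -> V} := HB.pack L (GRing.isZmodMorphism.Build B V L LB).
by exists L' => a; apply: TE; rewrite sK.
Qed.

End PsiHat.

(** * The operator M and its defect Q *)

Section Comparison.
Variables (X : sset) (A : chain_algebra (loop_group X)) (B : cobar_algebra X).
Local Notation G := (loop_group X).
Let axG := sset_ax G.
Local Notation e := (ce A).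
Local Notation bd := (ch_bd A).
Local Notation psih := (psih A B).

Definition defect_of (h : {additive A -> A}) : {additive A -> A} :=
  idfun \- ((bd \o h) \+ (h \o bd)).

Lemma defect_ofE h a : defect_of h a = a - (bd (h a) + h (bd a)).
Proof. by []. Qed.

Lemma defect_of_bd h a : bd (defect_of h a) = defect_of h (bd a).
Proof.
by rewrite !defect_ofE raddfB raddfD !bd_bd raddf0 add0r addr0.
Qed.

Definition mulce : cochain2 G G A := fun n (u v : loop X n) => e ((u * v)%g : G n).

Lemma mulce_normalised : normalised2 mulce.
Proof.
by move=> n i u v; rewrite /mulce -loop_dgn_mul ce_normalised.
Qed.

Lemma mulce_cobd n (u v : G n) : cobd2 mulce u v = bd (mulce u v).
Proof.
rewrite ch_bd_ce; case: n u v => [//|n] u v.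
by apply: eq_bigr => i _; rewrite loop_face_mul.
Qed.

Variable h : {additive A -> A}.
Hypothesis h_in : forall n a, ch_in A n a -> ch_in A n.+1 (h a).
Hypothesis psih_h : forall a, psih (h a) = 0.
Local Notation E := (defect_of h).

Definition hcup : bicochain G G A := fun p q g1 g2 => sgn p (e g1 * h (e g2)).

Lemma hcup_binormalised : binormalised hcup.
Proof.
split=> p q i u v; rewrite /hcup ce_normalised ?mul0r ?sgn0 //.
by rewrite raddf0 mulr0 sgn0.
Qed.

(* The homotopy from (u, v) -> [uv] to the cup product of [u] and (1 - dh - hd)[v]. *)
Definition ell : cochain2 G G A := fun n u v => AW hcup u v - EZh mulce u v.

Lemma ell_normalised : normalised2 ell.
Proof.
move=> n i u v.
have := AW_normalised axG axG hcup_binormalised i u v.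
have := EZh_normalised axG axG mulce_normalised i u v.
by rewrite /ell => -> ->; rewrite subrr.
Qed.

Lemma cobd2B (U V : sset_data) (W : zmodType) (F H : cochain2 U V W) n (u : U n) (v : V n) :
  cobd2 (fun n u v => F n u v - H n u v) u v = cobd2 F u v - cobd2 H u v.
Proof.
case: n u v => [|n] u v /=; first by rewrite subrr.
by rewrite -sumrB; apply: eq_bigr => i _; rewrite sgnB.
Qed.

(** [EZh] deforms [u v] into the sum of the products of front faces of u and back faces of v; [hcup]
    then deforms each second factor from the identity to E. *)
Lemma ell_diff n (u v : loop X n) : bd (ell (u : G n) v) + cobd2 ell (u : G n) v
  = e ((u * v)%g : G n) - AW (fun p q (g1 : G p) (g2 : G q) => e g1 * E (e g2)) (u : G n) v.
Proof.
rewrite (cobd2B (fun n (u v : G n) => AW hcup u v)) /ell raddfB addrACA -opprD.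
have -> : bd (EZh mulce (u : G n) v) = EZh (cobd2 mulce) (u : G n) v.
  by rewrite -EZh_raddf; apply: EZh_ext => k a b _; rewrite mulce_cobd.
rewrite EZh_homotopy // -AW_cobd // -AW_raddf -AWD opprB addrC -addrA; congr (_ + _).
rewrite addrC -AWB -[RHS]AWN; apply: AW_ext => p q g1 g2 _.
rewrite /shc -ceM defect_ofE mulrBr opprB; congr (_ - _).
have -> : bd (hcup g1 g2) = sgn p (bd (e g1) * h (e g2)) + e g1 * bd (h (e g2)).
  rewrite /hcup (raddf_sgn bd) (ch_bdM (m := p)); last exact: ce_in.
  by rewrite (sgnD p (bd (e g1) * h (e g2))) sgnK.
have el : cobdl hcup g1 g2 = - sgn p (bd (e g1) * h (e g2)).
  rewrite ch_bd_ce; case: p g1 => [|p] g1; first by rewrite /= mul0r sgn0 oppr0.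
  rewrite sgnS opprK /= mulr_suml sgn_sum; apply: eq_bigr => i _.
  by rewrite /hcup mulr_sgnr sgnC.
have er : sgn p (cobdr hcup g1 g2) = e g1 * h (bd (e g2)).
  rewrite ch_bd_ce; case: q g2 {el} => [|q] g2; first by rewrite /= sgn0 raddf0 mulr0.
  rewrite /= sgn_sum raddf_sum mulr_sumr; apply: eq_bigr => i _.
  by rewrite /hcup sgnC sgnK (raddf_sgn h) mulr_sgnl.
rewrite /bicobd el er mulrDr.
by rewrite addrACA addrN add0r.
Qed.

(** psi h = 0 annihilates the cup part, and the side condition [EZh_AW] the other one. *)
Lemma ell_psih n (u v : loop X n) : psih (ell (u : G n) v) = 0.
Proof.
rewrite /ell raddfB -AW_raddf -EZh_raddf.
rewrite (@AW_ext _ _ _ _ _ (fun p q _ _ => 0)); last first.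
  by move=> p q a b _; rewrite /hcup (raddf_sgn psih) psih_mul psih_h mulr0 sgn0.
rewrite AW0 sub0r.
rewrite (@EZh_ext _ _ _ _ _ (fun n (a b : G n) => AW (@bipsi X B) a b)); last first.
  by move=> k a b _; rewrite /mulce psih_ce psi_mul.
by rewrite (EZh_AW axG axG _ _ (bipsi_binormalised B)) oppr0.
Qed.

Lemma ell_in n (u v : loop X n) : ch_in A n.+1 (ell (u : G n) v).
Proof.
apply: ch_inB.
  apply: (AW_closed (@ch_inD G A n.+1) (R := fun m _ => True)) => // p q a b epq _.
  apply: ch_in_sgn; rewrite -epq -addnS; apply: ch_inM; first exact: ce_in.
  exact/h_in/ce_in.
by apply: (EZh_closed (@ch_inB G A n.+1) (R := fun m _ => True)) => // k a b <- _; exact: ce_in.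
Qed.

(** Subtracting the value at (1, g) makes the increment 0 for x = s_0 y, where tau x = 1. *)
Definition htp_step n (x : X n.+1) (g : loop X n) : A := ell (tau x : G n) g - ell (1%g : G n) g.

Definition htp_basic : forall n, G n -> A := fun n => loop_integral (@htp_step n).

Lemma htp_step0 n (y : X n) (g : loop X n) : htp_step (dgn 0 y) g = 0.
Proof. by rewrite /htp_step tau_dgn0 subrr. Qed.

Lemma htp_basic1 n : htp_basic (1%g : G n) = 0.
Proof. exact: (loop_integral1 (@htp_step0 n)). Qed.

Lemma htp_basic_tau n (x : X n.+1) (g : loop X n) :
  htp_basic ((tau x * g)%g : G n) = htp_basic (g : G n) + (ell (tau x : G n) g - ell (1%g : G n) g).
Proof. exact: (loop_integral_tau (@htp_step0 n)). Qed.

Lemma htp_basic_normalised : normalised htp_basic.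
Proof.
move=> n i; apply: (@loop_ind X n (fun g => htp_basic (@sset_dgn G n i g) = 0)) => [|x g].
  by rewrite (@sgrp_dgn1 G) htp_basic1.
rewrite loop_dgn_mul tau_dgn htp_basic_tau -tau_dgn.
have := ell_normalised i (tau x : G n) (g : G n).
have := ell_normalised i (1%g : G n) (g : G n).
by rewrite (@sgrp_dgn1 G) => -> ->; rewrite subrr addr0.
Qed.

Lemma htp_basic_psih n (g : loop X n) : psih (htp_basic (g : G n)) = 0.
Proof.
apply: (@loop_ind X n (fun g => psih (htp_basic (g : G n)) = 0)) => [|x k].
  by rewrite htp_basic1 raddf0.
by rewrite htp_basic_tau raddfD raddfB !ell_psih subrr addr0.
Qed.

Lemma htp_basic_in n (g : loop X n) : ch_in A n.+1 (htp_basic (g : G n)).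
Proof.
apply: (@loop_ind X n (fun g => ch_in A n.+1 (htp_basic (g : G n)))) => [|x k].
  by rewrite htp_basic1; exact: ch_in0.
have hx := ch_inB (ell_in (tau x) k) (ell_in 1%g k).
rewrite htp_basic_tau; split=> hk; first exact: ch_inD.
by rewrite -[htp_basic _](addrK (ell (tau x : G n) k - ell (1%g : G n) k)); exact: ch_inB.
Qed.

Definition htp : {additive A -> A} := ch_lin A htp_basic.

Lemma htp_ce n (g : G n) : htp (e g) = htp_basic g.
Proof. by rewrite /htp ch_lin_ce //; exact: htp_basic_normalised. Qed.

Lemma htp_psih a : psih (htp a) = 0.
Proof.
apply: (ch_additive_eq (f := psih \o htp) (g := \0)) => n g /=.
by rewrite htp_ce htp_basic_psih.
Qed.

Lemma htp_in n a : ch_in A n a -> ch_in A n.+1 (htp a).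
Proof.
apply: (ch_in_ind (P := fun a => ch_in A n.+1 (htp a))) => [|x y hx hy|g].
- by rewrite raddf0; exact: ch_in0.
- by rewrite raddfB; exact: ch_inB.
- by rewrite htp_ce; exact: htp_basic_in.
Qed.

Definition loopdiff n (x : X n.+1) (g : loop X n) : A := e (g : G n) - e ((tau x * g)%g : G n).

Local Notation Q := (defect_of htp).

Definition ecup : bicochain G G A := fun p q g1 g2 => e g1 * E (e g2).

(** The faces d_i with i > 0 take tau x to a letter, so [ell_diff] accounts for them and leaves the
    cup products. The face d_0 takes it to a^{-1} b, which is not a letter; integrating through a z
    = b y0 instead leaves the two differences of [ell]. *)
Lemma defect_htp n (x : X n.+2) (y : loop X n.+1) :
  let a := tau (sset_face ord0 x) in
  let b := tau (sset_face (lift ord0 ord0) x) in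
  let y0 : loop X n := @sset_face G n ord0 y in
  let z := (a^-1 * b * y0)%g in
  Q (loopdiff x y) = AW ecup (1%g : G n.+1) (y : G n.+1) - AW ecup (tau x : G n.+1) (y : G n.+1)
    + (ell (b : G n) y0 - ell ((a^-1 * b)%g : G n) y0) + (ell (1%g : G n) z - ell (a : G n) z).
Proof.
move=> a b y0 z.
have hd : htp (loopdiff x y) = ell (1%g : G n.+1) y - ell (tau x : G n.+1) y.
  by rewrite /loopdiff raddfB !htp_ce htp_basic_tau opprD addrA subrr sub0r opprB.
have hbd : htp (bd (loopdiff x y)) = cobd2 ell (1%g : G n.+1) (y : G n.+1)
    - cobd2 ell (tau x : G n.+1) (y : G n.+1)
    - (ell (b : G n) y0 - ell ((a^-1 * b)%g : G n) y0) - (ell (1%g : G n) z - ell (a : G n) z).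
  have eb (w : G n.+1) : htp (bd (e w)) = htp_basic (@sset_face G n ord0 w)
      - \sum_(i < n.+1) sgn i (htp_basic (@sset_face G n (lift ord0 i) w)).
    rewrite ch_bd_ce (raddf_sum htp) -[RHS](sum_sgn_recl (fun i => htp_basic (@sset_face G n i w))).
    by apply: eq_bigr => i _; rewrite (raddf_sgn htp) htp_ce.
  have ec (w : G n.+1) : cobd2 ell w (y : G n.+1) = ell (@sset_face G n ord0 w) y0
      - \sum_(i < n.+1) sgn i (ell (@sset_face G n (lift ord0 i) w) (@sset_face G n (lift ord0 i) y)).
    exact: (sum_sgn_recl (fun i => ell (@sset_face G n i w) (@sset_face G n i y))).
  rewrite /loopdiff (raddfB bd) (raddfB htp) !eb !ec (@sgrp_face1 G) loop_face_mul tau_face0 -/a -/b -/y0 -/z.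
  have -> : \sum_(i < n.+1) sgn i (htp_basic (@sset_face G n (lift ord0 i) (tau x * y)%g))
     = \sum_(i < n.+1) sgn i (htp_basic (@sset_face G n (lift ord0 i) y))
     + (\sum_(i < n.+1) sgn i (ell (@sset_face G n (lift ord0 i) (tau x)) (@sset_face G n (lift ord0 i) y))
      - \sum_(i < n.+1) sgn i (ell (@sset_face G n (lift ord0 i) (1%g : G n.+1)) (@sset_face G n (lift ord0 i) y))).
    rewrite -sumrB -big_split; apply: eq_bigr => i _.
    by rewrite loop_face_mul (@sgrp_face1 G) tau_face htp_basic_tau sgnD sgnB.
  (* M at the element a z = b y0 is computed twice, from z along a and from y0 along b. *)
  have := htp_basic_tau (sset_face ord0 x) z.
  have -> : (tau (sset_face ord0 x) * z)%g = (b * y0)%g by rewrite /z -!mulgA mulVKg.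
  rewrite htp_basic_tau -/a -/b => ez.
  have -> : htp_basic (y0 : G n) = htp_basic (z : G n) + (ell (a : G n) z - ell (1%g : G n) z)
    - (ell (b : G n) y0 - ell (1%g : G n) y0) by rewrite -ez addrK.
  abel.
rewrite defect_ofE hbd hd raddfB.
have := ell_diff 1%g y; have := ell_diff (tau x) y => /(canRL (addrK _)) -> /(canRL (addrK _)) ->.
rewrite mul1g -/ecup /loopdiff.
set u1 := AW ecup (1%g : G n.+1) (y : G n.+1); set u2 := AW ecup (tau x : G n.+1) (y : G n.+1).
set u3 := cobd2 ell (1%g : G n.+1) (y : G n.+1); set u4 := cobd2 ell (tau x : G n.+1) (y : G n.+1).
set u5 := e _; set u6 := e _; set u7 := ell b y0 - _; set u8 := ell _ z - _.
abel.
Qed.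
End Comparison.

(** * Skeleta and the filtration of the chains *)

Inductive skel (X : sset_data) (p : nat) : forall n, X n -> Prop :=
| skel_low n (x : X n) : (n <= p)%N -> skel p x
| skel_dgn n i (x : X n) : skel p x -> skel p (sset_dgn i x).

Section Skeleton.
Variable X : sset.
Let axX := sset_ax X.

(** The match on n in the conclusion lets the induction on [skel] run without equations between
    dimensions. *)
Lemma skel_face_max p n (x : X n) : skel p x ->
  match n return X n -> Prop with
  | 0 => fun=> True
  | m.+1 => fun x => skel p (@sset_face X m ord_max x)
  end x.
Proof.
elim=> [[|m] {}x mp|m i {}x sx ih]; [by []|apply: skel_low; lia|].
rewrite -(faceE ord_max) -(dgnE i) /=.
have := ltn_ord i; rewrite ltnS leq_eqVlt => /orP[/eqP ->|im].
  by rewrite (face_dgn_eqS axX).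
case: m i x im sx ih => [//|m] i x im sx ih.
rewrite (face_dgn_gt axX) /= ?im ?ltnSn // /dgn; apply: skel_dgn.
by rewrite (faceE ord_max).
Qed.

(** This drop by one is what makes Q lower the filtration. For x = s_i y with i > 0, d_0 x is a
    degeneracy of d_0 y; for i = 0, tau x = 1. *)
Lemma skel_tau_or_face0 p n (x : X n) : skel p.+1 x ->
  match n return X n -> Prop with
  | m.+2 => fun x => tau x = 1%g \/ skel p (@sset_face X m.+1 ord0 x)
  | _ => fun=> True
  end x.
Proof.
suff h : skel p.+1 x -> match n return X n -> Prop with
  | m.+1 => fun x => tau x = 1%g \/ skel p (@sset_face X m ord0 x)
  | _ => fun=> True
  end x by move/h; case: n x {h} => [|[|n]].
elim=> [[|m] {}x mp|m i {}x sx ih]; [by []|by right; apply: skel_low|].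
case: (ord0P i) => [->|[j ej]]; first by left; rewrite -dgnE tau_dgn0.
case: m i x sx ih j ej => [|m] i x sx ih j ej; first by case: j ej.
case: ih => [tx|sx']; [left|right]; rewrite ej.
  have := tau_dgn j x; rewrite tx (@sgrp_dgn1 (loop_group X)) => h; exact: esym h.
by rewrite (face0_dgn axX); exact: skel_dgn.
Qed.

Lemma skel1_tau n (x : X n) : reduced 1 X -> skel 1 x ->
  match n return X n -> Prop with 0 => fun=> True | m.+1 => fun x => tau x = 1%g end x.
Proof.
move=> rX; elim=> [[|[|m]] {}x // _|m i {}x sx ih].
  have [c cE] := rX 0%N isT; have [d dE] := rX 1%N isT.
  by rewrite (dE x) -(dE (dgn 0 c)) tau_dgn0.
case: (ord0P i) => [->|[j ej]]; first by rewrite -dgnE tau_dgn0.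
case: m i x sx ih j ej => [|m] i x sx ih j ej; first by case: j ej.
have := tau_dgn j x; rewrite ih (@sgrp_dgn1 (loop_group X)) ej => h; exact: esym h.
Qed.

Lemma skel_degenerate p n (x : X n) : skel p x -> (p < n)%N ->
  match n return X n -> Prop with
  | 0 => fun=> False
  | m.+1 => fun x => exists i (y : X m), x = sset_dgn i y
  end x.
Proof. by elim=> [m {}x mp|m i {}x sx _] pm; [lia|exists i, x]. Qed.

Lemma reduced_loop0 (g : loop X 0) : reduced 1 X -> g = 1%g.
Proof.
move=> rX; apply: (@loop_ind X 0 (fun g => g = 1%g)) => // x h.
by rewrite (skel1_tau rX (@skel_low X 1 1 x isT)) mul1g.
Qed.

End Skeleton.

Section Filtration.
Variables (X : sset) (A : chain_algebra (loop_group X)).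
Local Notation G := (loop_group X).
Local Notation e := (ce A).
Local Notation mulce := (@mulce X A).

(* The span of the chains [y] - [tau x * y] with x in the p-skeleton. *)
Definition fil p n (a : A) : Prop := forall P : A -> Prop,
  P 0 -> (forall a b, P a -> P b -> P (a - b)) ->
  (forall (x : X n.+1) y, skel p x -> P (loopdiff A x y)) -> P a.

Lemma fil0 p n : fil p n 0. Proof. by move=> P. Qed.

Lemma filB p n a b : fil p n a -> fil p n b -> fil p n (a - b).
Proof. by move=> ha hb P P0 PB Pg; apply: (PB); [exact: ha|exact: hb]. Qed.

Lemma filN p n a : fil p n a -> fil p n (- a).
Proof. by move=> ha; rewrite -[- a]add0r; apply: filB => //; exact: fil0. Qed.

Lemma filD p n a b : fil p n a -> fil p n b -> fil p n (a + b).
Proof. by move=> ha hb; rewrite -[b]opprK; apply: filB => //; exact: filN. Qed.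

Lemma fil_sgn k p n a : fil p n a -> fil p n (sgn k a).
Proof. by rewrite /sgn; case: odd => //; exact: filN. Qed.

Lemma fil_gen p n (x : X n.+1) y : skel p x -> fil p n (loopdiff A x y).
Proof. by move=> sx P P0 PB Pg; exact: Pg. Qed.

(** In positive degree [1] is degenerate, hence 0, and the Cayley graph joins every g to 1. The
    simplices x involved have dimension n + 2. *)
Lemma fil_full n a : ch_in A n.+1 a -> fil n.+2 n.+1 a.
Proof.
apply: (ch_in_ind (P := fun a => fil n.+2 n.+1 a)); [exact: fil0|exact: filB|move=> g].
apply: (@loop_ind X n.+1 (fun g => fil n.+2 n.+1 (e (g : G n.+1)))) => [|x h].
  have -> : e (1%g : G n.+1) = 0 by rewrite -(@sgrp_dgn1 G _ ord0) ce_normalised.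
  exact: fil0.
have hx := @fil_gen n.+2 n.+1 x h (skel_low x (leqnn _)).
split=> hh; last by rewrite -[e _](subrK (e ((tau x * h)%g : G n.+1))); exact: filD.
by rewrite -[e _](subKr (e (h : G n.+1))); exact: filB.
Qed.

Lemma fil1 n a : reduced 1 X -> fil 1 n a -> a = 0.
Proof.
move=> rX ha; apply: (ha (fun a => a = 0)) => [//|u v -> ->|x y sx]; first by rewrite subrr.
by rewrite /loopdiff (skel1_tau rX sx) mul1g subrr.
Qed.

Local Notation XG := (Prod (Dec X) G).

Definition act n (w : XG n) : G n := (tau (w.1 : X n.+1) * (w.2 : loop X n))%g.

Lemma act_dgn n i (w : XG n) : act (sset_dgn i w) = sset_dgn i (act w).
Proof. by rewrite /act loop_dgn_mul tau_dgn. Qed.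

Lemma act_face_max n (w : XG n.+1) : act (sset_face ord_max w) = sset_face ord_max (act w).
Proof. by rewrite /act loop_face_mul tau_face_max. Qed.

Definition wskel p n (w : XG n) : Prop := skel p (w.1 : X n.+1).

Lemma wskel_dgn p n i (w : XG n) : wskel p w -> wskel p (sset_dgn i w).
Proof. by move=> sw; apply: (@skel_dgn X p n.+1 (lift ord0 i)). Qed.

Lemma wskel_face_max p n (w : XG n.+1) : wskel p w -> wskel p (sset_face ord_max w).
Proof. by move=> /skel_face_max; rewrite /wskel /= lift0_max. Qed.

(** Shuffles degenerate x, which keeps it in the p-skeleton, and right multiplication by h commutes
    with left multiplication by tau x. *)
Lemma fil_sh p k m n (x : X k.+1) (g : loop X k) (h : loop X m) : n = (k + m)%N ->
  skel p x -> fil p n (loopdiff A x g * e (h : G m)).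
Proof.
move=> -> sx; pose w : XG k := (x, g).
pose F : cochain2 XG G A := fun n w (v : G n) => e ((w.2 : loop X n) * v)%g - e (act w * v)%g.
have -> : loopdiff A x g * e (h : G m) = sh F w (h : G m).
  rewrite (_ : sh F w (h : G m) = sh (fun n (w : XG n) (v : G n) => mulce w.2 v) w (h : G m)
      - sh (fun n (w : XG n) (v : G n) => mulce (act w) v) w (h : G m)); last first.
    by rewrite -shN -shD.
  rewrite /loopdiff mulrBl !ceM; congr (_ - _).
    by rewrite (sh_nat (f := fun n (w : XG n) => w.2) (g := fun n => id) mulce).
  by rewrite (sh_nat (f := act) (g := fun n => id) mulce) // => *; exact: act_dgn.
apply: (sh_closed (@filB p (k + m)) (R := wskel p)) => //; first exact: wskel_dgn.
move=> j u v <- su; rewrite /F /act -mulgA; exact: fil_gen.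
Qed.

Lemma fil_mul p k m n a b : n = (k + m)%N -> fil p k a -> ch_in A m b -> fil p n (a * b).
Proof.
move=> en ha hb; apply: (ha (fun a => fil p n (a * b))) => [|x y hx hy|x y sx].
- by rewrite mul0r; exact: fil0.
- by rewrite mulrBl; exact: filB.
apply: (ch_in_ind (P := fun b => fil p n (loopdiff A x y * b)) _ _ _ hb) => [|a1 a2 h1 h2|h].
- by rewrite mulr0; exact: fil0.
- by rewrite mulrBr; exact: filB.
- exact: (fil_sh _ _ en).
Qed.

Variable h : {additive A -> A}.
Hypothesis h_in : forall n a, ch_in A n a -> ch_in A n.+1 (h a).

(** In its first argument [ell] uses only degeneracies, last faces and products, and all of these
    preserve the form [y] - [tau x * y]. The face d_0, which would twist tau, is applied to v
    alone. *)
Lemma fil_ell p n (x : X n.+1) (g v : loop X n) : skel p x ->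
  fil p n.+1 (ell h (g : G n) (v : G n) - ell h ((tau x * g)%g : G n) (v : G n)).
Proof.
move=> sx; pose w : XG n := (x, g).
pose F : cochain2 XG G A := fun n w (v : G n) => e ((w.2 : loop X n) * v)%g - e (act w * v)%g.
pose K : bicochain XG G A := fun p q w (v : G q) => sgn p (loopdiff A (w.1 : X p.+1) w.2 * h (e v)).
have -> : ell h (g : G n) (v : G n) - ell h ((tau x * g)%g : G n) (v : G n)
  = AW K w (v : G n) - EZh F w (v : G n).
  have swap (a b c d : A) : a - b - (c - d) = (a - c) - (b - d) by abel.
  rewrite /ell swap; congr (_ - _).
    rewrite -(@AW_nat _ _ XG G _ _ (fun n (w : XG n) => w.2) (fun n => id) (hcup h) w v) //.
    rewrite -(@AW_nat _ _ XG G _ _ act (fun n => id) (hcup h) w v) //; last exact: act_face_max.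
    rewrite -AWB; apply: AW_ext => k m w' v' _.
    by rewrite /hcup /K -sgnB -mulrBl.
  rewrite -(@EZh_nat _ _ XG G _ _ (fun n (w : XG n) => w.2) (fun n => id) mulce w v) //.
  rewrite -(@EZh_nat _ _ XG G _ _ act (fun n => id) mulce w v) //;
    [|exact: act_dgn|exact: act_face_max].
  by rewrite -EZhN -EZhD.
apply: filB.
  apply: (AW_closed (@filD p n.+1) (R := wskel p)) => //; first exact: wskel_face_max.
  move=> k m w' v' ekm sw; apply: fil_sgn; apply: (fil_mul (k := k) (m := m.+1)); first by lia.
    exact: fil_gen.
  exact/h_in/ce_in.
apply: (EZh_closed (@filB p n.+1) (R := wskel p)) => //; [exact: wskel_dgn|exact: wskel_face_max|].
move=> k w' v' <- sw; rewrite /F /act -mulgA; exact: fil_gen.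
Qed.

End Filtration.

(** * Nilpotence of Q on the kernel of psi *)

Section Contraction.
Variables (X : sset) (A : chain_algebra (loop_group X)) (B : cobar_algebra X).
Hypothesis rX : reduced 1 X.
Local Notation G := (loop_group X).
Local Notation e := (ce A).
Local Notation psi := (psi B).
Local Notation psih := (psih A B).

Lemma ce_one n : e (1%g : G n.+1) = 0.
Proof. by rewrite -(@sgrp_dgn1 G _ ord0) ce_normalised. Qed.

Variables (n : nat) (h : {additive A -> A}).
Hypothesis h_in : forall n a, ch_in A n a -> ch_in A n.+1 (h a).
Hypothesis psih_h : forall a, psih (h a) = 0.
Local Notation E := (defect_of h).
Local Notation Q := (defect_of (htp h)).
Hypothesis Ek : kills B E n.+1.

Lemma defect_of_in m a : ch_in A m a -> ch_in A m (E a).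
Proof.
move=> ha; rewrite defect_ofE; apply: ch_inB => //; apply: ch_inD; first exact/bd_in/h_in.
case: m ha => [|m] ha; first by rewrite bd_in0 // raddf0; exact: ch_in0.
exact/h_in/bd_in.
Qed.

(** E vanishes on the kernel of psi in degrees up to n. Cutting off the higher degrees gives an
    operator that vanishes on the whole kernel and descends. *)
Lemma low_factor : exists L : {additive B -> A},
  forall m (g : G m), (m <= n)%N -> L (psi g) = E (e g).
Proof.
have [a ha|L LE] := @descend X A B A (E \o ch_pr A n.+1); first exact: kills_pr Ek ha.
by exists L => m g mn; rewrite -(psih_ce A) LE /= ch_pr_ce ltnS mn.
Qed.

Section Symbol.
Variables (p : nat) (L : {additive B -> A}).
Hypothesis p0 : (0 < p)%N.
Hypothesis LE : forall m (g : G m), (m <= n)%N -> L (psi g) = E (e g).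

(** On the degenerate edges [tau x] = [1] is not 0; the value 0 in dimension 1 makes the function
    normalised. *)
Definition tau_chain m : X m -> A :=
  match m with 0 => fun=> 0 | k.+1 => fun x => if (0 < k)%N then e (tau x : G k) else 0 end.

Lemma tau_chain_dgn m i (x : X m) : tau_chain (sset_dgn i x) = 0.
Proof.
case: (ord0P i) => [->|[j ej]].
  by rewrite /= -dgnE tau_dgn0; case: m i x => [//|m] i x; exact: ce_one.
case: m i x j ej => [|m] i x j ej; first by case: j ej.
rewrite /= ej; have := tau_dgn j x => /= <-; exact: (@ce_normalised _ A).
Qed.

(* [symbol] maps s^{-1}x * b to - [tau x] * L b if dim x = p + 1, and to 0
   otherwise; the first component of the fold carries b along. *)
Definition symbol_step m (x : X m) (v : (B * A)%type) : (B * A)%type :=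
  (gn B x * v.1, if m == p.+1 then - (tau_chain x * L v.1) else 0).

Definition symbol (b : B) : A := (cb_fold B (V := (B * A)%type) (1, 0) symbol_step b).2.

Lemma symbol_fold m (x : X m) b :
  cb_fold B (V := (B * A)%type) (1, 0) symbol_step (gn B x * b)
  = symbol_step x (cb_fold B (V := (B * A)%type) (1, 0) symbol_step b).
Proof.
apply: cb_foldM => [k y [a1 b1] [a2 b2]|k i y v|k y v k1].
- rewrite /symbol_step /= mulrBr raddfB mulrBr opprB; congr pair.
  by case: ifP => _ /=; rewrite ?subr0 //= opprK addrC.
- rewrite /symbol_step gn_normalised mul0r tau_chain_dgn mul0r oppr0; congr pair.
  by case: ifP.
- rewrite /symbol_step gn_low // mul0r; congr pair; case: eqP => // ek.
  by exfalso; lia.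
Qed.

Lemma symbol_fold1 b : (cb_fold B (V := (B * A)%type) (1, 0) symbol_step b).1 = b.
Proof.
apply: (cb_ind (P := fun b => (cb_fold B (V := (B * A)%type) (1, 0) symbol_step b).1 = b)).
- by rewrite raddf0.
- by move=> x y hx hy; rewrite raddfB /= hx hy.
- by rewrite cb_fold1.
- by move=> m x y _ hy; rewrite symbol_fold /= hy.
Qed.

Lemma symbol_gn m (x : X m) b :
  symbol (gn B x * b) = if m == p.+1 then - (tau_chain x * L b) else 0.
Proof. by rewrite /symbol symbol_fold /= symbol_fold1. Qed.

Lemma symbolB a b : symbol (a - b) = symbol a - symbol b.
Proof. by rewrite /symbol raddfB. Qed.

Lemma symbol0 : symbol 0 = 0.
Proof. by rewrite /symbol raddf0. Qed.

Lemma symbolN a : symbol (- a) = - symbol a.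
Proof. by rewrite -[- a]sub0r symbolB symbol0 sub0r. Qed.

Lemma symbol_lead u b : lead_le p u -> symbol (u * b) = 0.
Proof.
move=> hu; apply: (hu (fun u => symbol (u * b) = 0)) => [|x y hx hy|m x c mp].
- by rewrite mul0r symbol0.
- by rewrite mulrBl symbolB hx hy subrr.
- by rewrite -mulrA symbol_gn; case: eqP => // em; lia.
Qed.

(** If dim w > p + 1, then w is degenerate and both terms are 0. If dim w = p + 1, the leading term
    - s^{-1}w of psi(tau w) makes them equal. If dim w <= p, the symbol is 0 and [tau w] = - ([1] -
    [tau w * 1]) lies in F_p. *)
Lemma symbol_tau k q (w : X k.+2) (y : loop X q) : (k.+1 + q = n.+1)%N -> skel p.+1 w ->
  fil p n.+1 (symbol (psi (tau w : loop X k.+1) * psi y) - e (tau w : G k.+1) * E (e (y : G q))).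
Proof.
move=> ekq sw; have [pk|kp] := ltnP p.+1 k.+2.
  have [i [v ev]] := skel_degenerate sw pk.
  have [-> ->] : psi (tau w : loop X k.+1) = 0 /\ e (tau w : G k.+1) = 0.
    case: (ord0P i) ev => [->|[j ->]] ->.
      by rewrite -dgnE tau_dgn0 psi1 ce_one.
    by have := tau_dgn j v => /= <-; rewrite psi_normalised (@ce_normalised _ A).
  by rewrite !mul0r symbol0 subr0; exact: fil0.
have lead := @psi_lead X B _ w.
have [ek|nek] := eqVneq k.+2 p.+1.
  rewrite -[psi (tau w)](addrK (gn B w)) mulrBl symbolB symbol_lead; last first.
    by rewrite (_ : p = k.+1); [exact: lead|lia].
  rewrite symbol_gn ifT; last exact/eqP.
  rewrite /= LE; last by lia.
  by rewrite sub0r opprK subrr; exact: fil0.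
rewrite symbol_lead; last first.
  rewrite -[psi (tau w)](addrK (gn B w)); apply: lead_leB.
    by apply: lead_leW lead; lia.
  by apply: lead_leW (@lead_le_gn X B _ w); lia.
have -> : e (tau w : G k.+1) = - loopdiff A w (1%g : loop X k.+1).
  by rewrite /loopdiff mulg1 ce_one sub0r opprK.
rewrite sub0r mulNr opprK; apply: (fil_mul (k := k.+1) (m := q)) => //.
  by apply: fil_gen; apply: skel_low; lia.
exact/defect_of_in/ce_in.
Qed.

(** The differences of [ell] in [defect_htp] lie in F_p, as d_0 x is in the p-skeleton; the cup
    products are matched with the symbol summand by summand. *)
Lemma htp_symbol (x : X n.+2) (y : loop X n.+1) : skel p.+1 x ->
  fil p n.+1 (Q (loopdiff A x y) - symbol (psih (loopdiff A x y))).
Proof.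
move=> sx.
have [tx|sx0] := skel_tau_or_face0 sx.
  by rewrite /loopdiff tx mul1g subrr !raddf0 symbol0 subr0; exact: fil0.
have e1 : psih (loopdiff A x y)
    = - AW (fun k q (a : G k) (b : G q) => if k is 0 then 0 else psi a * psi b) (tau x : G n.+1) (y : G n.+1).
  rewrite /loopdiff raddfB !psih_ce psi_tau AW_split /bipsi psi0 mul1r opprD addrA subrr.
  by rewrite sub0r.
have eS (K : bicochain G G B) (u v : G n.+1) :
    symbol (AW K u v) = AW (fun k q a b => symbol (K k q a b)) u v.
  pose S : {additive B -> A} := HB.pack symbol (GRing.isZmodMorphism.Build B A symbol symbolB).
  exact: esym (@AW_raddf _ _ S _ _ _ K u v).
have e2 : AW (ecup h) (1%g : G n.+1) (y : G n.+1) - AW (ecup h) (tau x : G n.+1) (y : G n.+1)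
    = - AW (fun k q (a : G k) (b : G q) => if k is 0 then 0 else ecup h a b) (tau x : G n.+1) (y : G n.+1).
  rewrite AW_one [X in X - _]AW_split AW_eq0; last first.
    by move=> [|k] q u v _ //; rewrite /ecup ce_one mul0r.
  rewrite addr0 [X in _ - X]AW_split opprD addrA.
  (* The group in degree 0 is trivial, so the two summands of bidegree (0, n + 1) coincide. *)
  by rewrite (reduced_loop0 (vertex0 (tau x : G n.+1)) rX) subrr sub0r.
rewrite defect_htp // e1 symbolN opprK eS e2.
set z := (_ * @sset_face G n ord0 y)%g.
set r1 := ell h _ _ - _; set r2 := ell h _ _ - _; set r3 := AW _ _ _; set r4 := AW _ _ _.
have -> : - r3 + r1 + r2 + r4 = (r4 - r3) + (r1 + r2) by abel.
apply: filD.
  rewrite /r3 /r4 -AWB.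
  apply: (AW_closed (@filD _ _ p n.+1) (R := fun m (a : G m) => exists2 w : X m.+1, a = tau w & skel p.+1 w)).
  - move=> m a [w -> sw]; exists (@sset_face X m.+1 ord_max w); last exact: (skel_face_max sw).
    by rewrite tau_face_max /= lift0_max.
  - move=> [|k] q a b ekq [w ew sw]; first by rewrite symbol0 subr0; exact: fil0.
    by rewrite ew; exact: symbol_tau.
  - by exists x.
apply: filD.
  rewrite /r1 -opprB; apply: filN.
  have := fil_ell h_in ((tau (sset_face ord0 x))^-1 * tau (sset_face (lift ord0 ord0) x))%g
    (@sset_face G n ord0 y : loop X n) sx0.
  by rewrite mulVKg.
by have := fil_ell h_in 1%g z sx0; rewrite mulg1.
Qed.

Lemma htp_fil c : fil p.+1 n.+1 c -> psih c = 0 -> fil p n.+1 (Q c).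
Proof.
move=> hc pc; have -> : Q c = Q c - symbol (psih c) by rewrite pc symbol0 subr0.
apply: (hc (fun c => fil p n.+1 (Q c - symbol (psih c)))) => [|a b ha hb|x y sx].
- by rewrite !raddf0 symbol0 subr0; exact: fil0.
- rewrite (raddfB Q) (raddfB psih) symbolB (opprD (symbol (psih a))) addrACA -opprD; exact: filB.
- exact: htp_symbol.
Qed.

End Symbol.

Lemma psih_defect c : psih (Q c) = psih c.
Proof.
by rewrite defect_ofE raddfB raddfD psih_bd !(htp_psih psih_h) raddf0 addr0 subr0.
Qed.

(** n + 1 steps lead from F_{n+2}, which is everything in degree n + 1, down to F_1 = 0. *)
Lemma htp_nilpotent c : ch_in A n.+1 c -> psih c = 0 -> iter n.+1 Q c = 0.
Proof.
have [L LE] := low_factor.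
have step k a : fil k.+1 n.+1 a -> psih a = 0 -> iter k Q a = 0.
  elim: k a => [|k ih] a ha pa; first exact: fil1 rX ha.
  rewrite iterSr; apply: ih; last by rewrite psih_defect.
  by apply: (htp_fil (L := L)).
by move=> hc; apply: step; exact: fil_full.
Qed.

End Contraction.

(** * The geometric series in Q, and the contraction *)

Section HomotopySum.
Variables (X : sset) (A : chain_algebra (loop_group X)) (B : cobar_algebra X).
Local Notation bd := (ch_bd A).
Local Notation psih := (psih A B).

Fixpoint htp_sum (h : {additive A -> A}) (n : nat) : {additive A -> A} :=
  match n with
  | 0 => \0
  | m.+1 => htp h \+ (htp_sum h m \o defect_of (htp h))
  end.

Lemma htp_sumS h n a :
  htp_sum h n.+1 a = htp h a + htp_sum h n (defect_of (htp h) a).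
Proof. by []. Qed.

(** Telescoping: dM + Md = 1 - Q, and Q commutes with d. *)
Lemma htp_sumE h n a : bd (htp_sum h n a) + htp_sum h n (bd a) = a - iter n (defect_of (htp h)) a.
Proof.
elim: n a => [|n ih] a; first by rewrite /= raddf0 addr0 subrr.
rewrite iterSr !htp_sumS raddfD addrACA -defect_of_bd ih defect_ofE.
by rewrite addrA; congr (_ - _); rewrite addrC subrK.
Qed.

Variable h : {additive A -> A}.
Hypothesis h_in : forall n a, ch_in A n a -> ch_in A n.+1 (h a).
Hypothesis psih_h : forall a, psih (h a) = 0.

Lemma htp_sum_psih n a : psih (htp_sum h n a) = 0.
Proof.
elim: n a => [|n ih] a; first exact: raddf0.
by rewrite htp_sumS raddfD ih (htp_psih psih_h) addr0.
Qed.

Lemma htp_sum_in n m a : ch_in A m a -> ch_in A m.+1 (htp_sum h n a).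
Proof.
elim: n a => [|n ih] a ha; first exact: ch_in0.
apply: ch_inD; first exact: htp_in.
by apply: ih; apply: defect_of_in => // *; exact: htp_in.
Qed.

End HomotopySum.

Section Homotopy.
Variables (X : sset) (A : chain_algebra (loop_group X)) (B : cobar_algebra X).
Hypothesis rX : reduced 1 X.
Local Notation G := (loop_group X).
Local Notation e := (ce A).
Local Notation bd := (ch_bd A).
Local Notation psih := (psih A B).

(** In degree n, n summands suffice by [htp_nilpotent]; in degree 0 the sum is empty and h = 0. The
    fixed point passes f cut off to degrees below n. *)
Definition contraction_step (f : forall n, G n -> A) n (g : G n) : A :=
  htp_sum (ch_lin A f) n (e g - ch_lin A f (bd (e g))).

Definition contraction_basic : forall n, G n -> A := causal_fix contraction_step.

Lemma contraction_basic_normalised : normalised contraction_basic.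
Proof.
move=> n i g; rewrite /contraction_basic causal_fixE /contraction_step ce_normalised.
by rewrite !raddf0 addr0 raddf0.
Qed.

Definition contraction : {additive A -> A} := ch_lin A contraction_basic.

Definition contraction_below n : {additive A -> A} := ch_lin A (truncate n contraction_basic).

Lemma truncate_normalised n (f : forall n, G n -> A) : normalised f -> normalised (truncate n f).
Proof. by move=> nf m i g; rewrite /truncate; case: ifP. Qed.

Lemma contraction_below_ce n m (g : G m) :
  contraction_below n (e g) = if (m < n)%N then contraction (e g) else 0.
Proof.
have nc := contraction_basic_normalised.
rewrite /contraction_below /contraction !ch_lin_ce //; exact: truncate_normalised.
Qed.

Lemma contraction_belowE n m a : ch_in A m a -> (m < n)%N -> contraction_below n a = contraction a.
Proof.
move=> ha mn; apply: (ch_in_ind (P := fun a => contraction_below n a = contraction a) _ _ _ ha).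
- by rewrite !raddf0.
- by move=> x y hx hy; rewrite !raddfB hx hy.
- by move=> g; rewrite contraction_below_ce mn.
Qed.

Lemma contractionE n a : ch_in A n a ->
  contraction a = htp_sum (contraction_below n) n (a - contraction_below n (bd a)).
Proof.
move=> ha; apply: (ch_in_ind (P := fun a => contraction a
  = htp_sum (contraction_below n) n (a - contraction_below n (bd a))) _ _ _ ha).
- by rewrite !raddf0 addr0 raddf0.
- move=> x y; rewrite (raddfB contraction) (raddfB bd) (raddfB (contraction_below n)) => -> ->.
  by rewrite -(raddfB (htp_sum _ _)) opprD addrACA -opprD.
- move=> g; rewrite [LHS]ch_lin_ce; last exact: contraction_basic_normalised.
  by rewrite /contraction_basic causal_fixE.
Qed.

Lemma contraction_in_psih n (g : G n) :
  ch_in A n.+1 (contraction (e g)) /\ psih (contraction (e g)) = 0.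
Proof.
have [b nb] := ubnP n; elim: b n nb g => [//|b ih] n nb g.
have pb a : psih (contraction_below n a) = 0.
  apply: (ch_additive_eq (f := psih \o contraction_below n) (g := \0)) => m x /=.
  rewrite contraction_below_ce; case: ltnP => mn; last exact: raddf0.
  by apply: (ih m _ x).2; lia.
have ib m a : ch_in A m a -> ch_in A m.+1 (contraction_below n a).
  apply: (ch_in_ind (P := fun a => ch_in A m.+1 (contraction_below n a))) => [|x y hx hy|x].
  - by rewrite raddf0; exact: ch_in0.
  - by rewrite raddfB; exact: ch_inB.
  rewrite contraction_below_ce; case: ltnP => mn; last exact: ch_in0.
  by apply: (ih m _ x).1; lia.
rewrite (contractionE (ce_in A g)); split; last exact: htp_sum_psih.
apply: htp_sum_in => //; apply: ch_inB; first exact: ce_in.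
case: n {nb pb} g ib => [|n] g ib; first by rewrite bd_in0 ?raddf0; [exact: ch_in0|exact: ce_in].
by apply: ib; apply: bd_in; exact: ce_in.
Qed.

Lemma psih_contraction a : psih (contraction a) = 0.
Proof.
apply: (ch_additive_eq (f := psih \o contraction) (g := \0)) => m x.
exact: (contraction_in_psih x).2.
Qed.

Lemma contraction_in n a : ch_in A n a -> ch_in A n.+1 (contraction a).
Proof.
apply: (ch_in_ind (P := fun a => ch_in A n.+1 (contraction a))) => [|x y hx hy|x].
- by rewrite raddf0; exact: ch_in0.
- by rewrite raddfB; exact: ch_inB.
- exact: (contraction_in_psih x).1.
Qed.

Lemma psih_contraction_below n a : psih (contraction_below n a) = 0.
Proof.
apply: (ch_additive_eq (f := psih \o contraction_below n) (g := \0)) => m x /=.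
by rewrite contraction_below_ce; case: ifP => _; rewrite ?psih_contraction // raddf0.
Qed.

Lemma contraction_below_in n m a : ch_in A m a -> ch_in A m.+1 (contraction_below n a).
Proof.
apply: (ch_in_ind (P := fun a => ch_in A m.+1 (contraction_below n a))) => [|x y hx hy|x].
- by rewrite raddf0; exact: ch_in0.
- by rewrite raddfB; exact: ch_inB.
rewrite contraction_below_ce; case: ifP => _; last exact: ch_in0.
exact/contraction_in/ce_in.
Qed.

Lemma psih_inj0 a : ch_in A 0 a -> psih a = 0 -> a = 0.
Proof.
(* Degree 0 is spanned by 1. The fold with initial value 1 and R = 0 recovers a multiple of 1 from
   its image under psi. *)
pose R m (x : X m) (v : A) : A := 0.
move=> ha pa; have -> : a = cb_fold B 1 R (psih a); last by rewrite pa raddf0.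
apply: (ch_in_ind (P := fun a => a = cb_fold B 1 R (psih a)) _ _ _ ha) => [|x y hx hy|g].
- by rewrite !raddf0.
- by rewrite !raddfB -hx -hy.
- by rewrite (reduced_loop0 g rX) ce1 psih1 cb_fold1.
Qed.

(** Put c = a - h d a. The contraction property for d a gives d c = 0, and psi c = 0. The series for
    c then ends by nilpotence and yields d N c = c, where N c = h a. *)
Lemma contraction_kills n a : ch_in A n a -> psih a = 0 -> defect_of contraction a = 0.
Proof.
have [b nb] := ubnP n; elim: b n nb a => [//|b ih] [|n] nb a ha pa.
  by rewrite (psih_inj0 ha pa) raddf0.
set H := contraction_below n.+1.
have HE m c : (m <= n)%N -> ch_in A m c -> defect_of H c = defect_of contraction c.
  move=> mn hc; rewrite !defect_ofE (contraction_belowE hc) ?ltnS //; congr (_ - (_ + _)).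
  case: m mn hc => [|m] mn hc; first by rewrite bd_in0 // !raddf0.
  by apply: (contraction_belowE (bd_in hc)); lia.
have k : kills B (defect_of H) n.+1.
  by move=> m c mn hc pc; rewrite (HE m) //; apply: (ih m) => //; lia.
have H_in := @contraction_below_in n.+1.
set c := a - H (bd a).
have hc : ch_in A n.+1 c by apply: ch_inB => //; apply: H_in; exact: bd_in.
have pc : psih c = 0 by rewrite /c raddfB pa psih_contraction_below subrr.
have dc : bd c = 0.
  have := k n (bd a) (ltnSn n) (bd_in ha).
  rewrite psih_bd pa raddf0 defect_ofE bd_bd raddf0 addr0 => /(_ erefl).
  by rewrite /c raddfB.
have := htp_sumE H n.+1 c.
rewrite (htp_nilpotent rX H_in (@psih_contraction_below n.+1) k hc pc) dc raddf0 addr0 subr0.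
rewrite -/H -(contractionE ha) => e1.
rewrite defect_ofE e1 /c (contraction_belowE (bd_in ha)) // subrK subrr.
by [].
Qed.

Lemma contraction_spec a : psih a = 0 -> defect_of contraction a = 0.
Proof.
move=> pa; have [n en] := ch_pr_large a; rewrite -en; apply: (kills_pr (B := B)) pa.
by move=> m c _; exact: contraction_kills.
Qed.

End Homotopy.

(** * The map phi *)

Section Retract.
Variables (X : sset) (A : chain_algebra (loop_group X)) (B : cobar_algebra X).
Hypothesis rX : reduced 1 X.
Local Notation bd := (ch_bd A).
Local Notation d := (cb_diff B).
Local Notation psih := (psih A B).
Local Notation h := (contraction A).

(** 1 - dh - hd vanishes on the kernel of psi and descends along psi. It differs from the identity
    by elements of the kernel, so the result is a section. *)
Definition section : {additive B -> A} := projT1 (cid (descend (@contraction_spec X A B rX))).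

Lemma sectionE a : section (psih a) = defect_of h a.
Proof. by rewrite /section; case: cid. Qed.

Lemma psih_section b : psih (section b) = b.
Proof.
have [a <-] := psih_surj A b.
rewrite sectionE defect_ofE raddfB raddfD psih_bd !psih_contraction //.
by rewrite raddf0 addr0 subr0.
Qed.

Lemma section_diff b : bd (section b) = section (d b).
Proof.
by have [a <-] := psih_surj A b; rewrite -psih_bd !sectionE defect_of_bd.
Qed.

Lemma section_in n b : cb_in B n b -> ch_in A n (section b).
Proof.
move=> /(psih_lift A) [a ha <-]; rewrite sectionE; apply: defect_of_in => //.
exact: (contraction_in B).
Qed.

(** Inherited from the chains on GX along the surjection psi. *)
Lemma cb_diff_diff b : d (d b) = 0.
Proof. by have [a <-] := psih_surj A b; rewrite -!psih_bd bd_bd raddf0. Qed.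

Lemma cb_diff_in n b : cb_in B n.+1 b -> cb_in B n (d b).
Proof. by move=> /(psih_lift A) [a ha <-]; rewrite -psih_bd; exact/psih_in/bd_in. Qed.

Definition word_map (F : forall n, X n -> A) : {additive B -> A} :=
  cb_fold B (1 : A) (fun n (x : X n) a => F n x * a).

Section WordMap.
Variable F : forall n, X n -> A.
Hypothesis nF : normalised F.
Hypothesis lF : forall n (x : X n), (n <= 1)%N -> F x = 0.

Lemma word_map1 : word_map F 1 = 1.
Proof. exact: cb_fold1. Qed.

Lemma word_map_cons n (x : X n) b : word_map F (gn B x * b) = F x * word_map F b.
Proof.
apply: cb_foldM => [m y u v|m i y v|m y v m1]; first exact: mulrBr.
- by rewrite nF mul0r.
- by rewrite lF // mul0r.
Qed.

Lemma word_map_mul a b : word_map F (a * b) = word_map F a * word_map F b.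
Proof.
apply: (cb_ind (P := fun a => word_map F (a * b) = word_map F a * word_map F b)).
- by rewrite mul0r !raddf0 mul0r.
- by move=> x y hx hy; rewrite mulrBl !raddfB mulrBl hx hy.
- by rewrite word_map1 !mul1r.
- by move=> n x c _ hc; rewrite -mulrA !word_map_cons hc mulrA.
Qed.

Lemma word_map_gn n (x : X n) : word_map F (gn B x) = F x.
Proof. by rewrite -[gn B x]mulr1 word_map_cons word_map1 mulr1. Qed.

Lemma word_map_diff n (x : X n) : word_map F (d (gn B x))
  = - cobd F x + AW (fun p q (a : X p) (b : X q) => sgn p (F a * F b)) x x.
Proof.
rewrite cb_diff_gn raddfD raddfN raddf_cobd -AW_raddf; congr (- _ + _).
  by apply: cobd_ext => m y; rewrite word_map_gn.
by apply: AW_ext => p q a b _; rewrite raddf_sgn word_map_mul !word_map_gn.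
Qed.

(** The letters of a word of degree n have dimension at most n + 1. *)
Lemma word_map_in n b : (forall m (x : X m), (m <= n.+1)%N -> ch_in A m.-1 (F x)) ->
  cb_in B n b -> ch_in A n (word_map F b).
Proof.
move=> hF hb; suff: (n <= n)%N -> ch_in A n (word_map F b) by exact.
move: hb; apply: (cb_in_ind (P := fun m b => (m <= n)%N -> ch_in A m (word_map F b))).
- by move=> m _; rewrite raddf0; exact: ch_in0.
- by move=> m x y hx hy mn; rewrite raddfB; apply: ch_inB; [exact: hx|exact: hy].
- by rewrite word_map1 -(ce1 A) => _; exact: ce_in.
- move=> m x k c m1 hc mkn; rewrite word_map_cons; apply: ch_inM; first by apply: hF; lia.
  by apply: hc; lia.
Qed.

(* The words of d (gn x) only involve simplices of smaller dimension than x. *)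
Lemma word_map_diff_ext n (x : X n) (F' : forall n, X n -> A) : normalised F' ->
  (forall n (x : X n), (n <= 1)%N -> F' n x = 0) ->
  (forall m (y : X m), (m < n)%N -> F y = F' m y) ->
  - cobd F' x + AW (fun p q (a : X p) (b : X q) => sgn p (F' p a * F' q b)) x x
  = word_map F (d (gn B x)).
Proof.
move=> nF' lF' e; rewrite word_map_diff; congr (- _ + _).
  case: n x e => [//|n] x e /=; by apply: eq_bigr => i _; rewrite e.
apply: AW_ext => p q a b epq.
case: (leqP p 1) => p1; first by rewrite lF // lF' // !mul0r.
case: (leqP q 1) => q1; first by rewrite [F b]lF // [F' q b]lF' // !mulr0.
by rewrite !e //; lia.
Qed.

(** [D] measures the failure of the word map to be a chain map. It is 0 on generators of dimension
    below n and, by the Leibniz rules, on their products; hence it is 0 on d s^{-1}x, and d d = 0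
    does the rest. *)
Lemma word_map_chain_step n (x : X n) :
  (forall m (y : X m), (m < n)%N -> bd (F y) = word_map F (d (gn B y))) ->
  (forall m (y : X m), (m < n)%N -> ch_in A m.-1 (F y)) ->
  bd (word_map F (d (gn B x))) = 0.
Proof.
move=> hF hin.
pose D : {additive B -> A} := (bd \o word_map F) \- (word_map F \o d).
have DE b : D b = bd (word_map F b) - word_map F (d b) by [].
have Dgn m (y : X m) : (m < n)%N -> D (gn B y) = 0.
  by move=> mn; rewrite DE word_map_gn hF // subrr.
suff : D (d (gn B x)) = 0 by rewrite DE cb_diff_diff raddf0 subr0.
rewrite cb_diff_gn raddfD raddfN raddf_cobd -AW_raddf.
have -> : cobd (fun m (y : X m) => D (gn B y)) x = 0.
  case: n x {hF hin} Dgn => [//|n] x Dgn.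
  by apply: big1 => i _; rewrite Dgn // sgn0.
rewrite oppr0 add0r -[RHS](@AW0 A n X X x x); apply: AW_ext => p q a b epq.
case: (leqP p 1) => p1; first by rewrite gn_low // mul0r sgn0 raddf0.
case: (leqP q 1) => q1; first by rewrite [gn B b]gn_low // mulr0 sgn0 raddf0.
have [pn qn] : (p < n)%N /\ (q < n)%N by lia.
rewrite raddf_sgn DE word_map_mul !word_map_gn (ch_bdM (m := p.-1)); last exact: hin.
rewrite (cb_diffM (m := p.-1)); last exact: gn_in.
by rewrite raddfD raddf_sgn !word_map_mul !word_map_gn !hF // subrr sgn0.
Qed.

End WordMap.

(** The discrepancy k = section(d s^{-1}x) - phi(d s^{-1}x) is a cycle in the kernel of psi, so d h
    k = k. Subtracting h k turns the boundary section(d s^{-1}x) into phi(d s^{-1}x), and psi h = 0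
    keeps psi phi = 1. *)
Definition phi_step (F : forall n, X n -> A) n (x : X n) : A :=
  section (gn B x) - h (section (d (gn B x)) - word_map F (d (gn B x))).

Definition phi_gen : forall n, X n -> A := causal_fix phi_step.

Lemma phi_genE n (x : X n) : phi_gen x = phi_step (truncate n phi_gen) x.
Proof. exact: causal_fixE. Qed.

Lemma phi_gen_zero n (x : X n) : gn B x = 0 -> phi_gen x = 0.
Proof. by move=> e; rewrite phi_genE /phi_step e !(raddf0, addr0). Qed.

Lemma phi_gen_normalised : normalised phi_gen.
Proof. by move=> n i x; apply: phi_gen_zero; exact: gn_normalised. Qed.

Lemma phi_gen_low n (x : X n) : (n <= 1)%N -> phi_gen x = 0.
Proof. by move=> n1; apply: phi_gen_zero; exact: gn_low. Qed.

Lemma truncate_phi_normalised n : normalised (truncate n phi_gen).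
Proof. by move=> m i x; rewrite /truncate phi_gen_normalised if_same. Qed.

Lemma truncate_phi_low n m (x : X m) : (m <= 1)%N -> truncate n phi_gen x = 0.
Proof. by move=> m1; rewrite /truncate phi_gen_low // if_same. Qed.

Definition phi : {additive B -> A} := word_map phi_gen.

Lemma phi_gen_rec n (x : X n) : phi_gen x
  = section (gn B x) - h (section (d (gn B x)) - phi (d (gn B x))).
Proof.
rewrite phi_genE /phi_step; congr (_ - h (_ - _)).
rewrite word_map_diff; [|exact: truncate_phi_normalised|exact: truncate_phi_low].
apply: (word_map_diff_ext phi_gen_normalised phi_gen_low);
  [exact: truncate_phi_normalised|exact: truncate_phi_low|].
by move=> m y mn; rewrite /truncate mn.
Qed.

Lemma phi_mul a b : phi (a * b) = phi a * phi b.
Proof. exact: (word_map_mul phi_gen_normalised phi_gen_low). Qed.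

Lemma phi1 : phi 1 = 1.
Proof. exact: word_map1. Qed.

Lemma phi_gn n (x : X n) : phi (gn B x) = phi_gen x.
Proof. exact: (word_map_gn phi_gen_normalised phi_gen_low). Qed.

Lemma psih_phi b : psih (phi b) = b.
Proof.
apply: (cb_ind (P := fun b => psih (phi b) = b)).
- by rewrite !raddf0.
- by move=> x y hx hy; rewrite !raddfB hx hy.
- by rewrite phi1 psih1.
move=> n x c _ hc; rewrite phi_mul psih_mul hc phi_gn phi_gen_rec raddfB psih_section.
by rewrite psih_contraction // subr0.
Qed.

Lemma phi_gen_in n (x : X n) : ch_in A n.-1 (phi_gen x).
Proof.
have [b nb] := ubnP n; elim: b n nb x => [//|b ih] [|[|n]] nb x;
  try by rewrite phi_gen_low //; exact: ch_in0.
rewrite phi_genE /phi_step; apply: ch_inB; first exact/section_in/gn_in.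
have dx : cb_in B n (d (gn B x)) by apply: cb_diff_in; exact: (gn_in B x).
apply: (contraction_in B); apply: ch_inB; first exact: section_in.
apply: word_map_in dx; [exact: truncate_phi_normalised|exact: truncate_phi_low|].
move=> m y mn; rewrite /truncate; case: ltnP => _; last exact: ch_in0.
by apply: ih; lia.
Qed.

Lemma phi_in n b : cb_in B n b -> ch_in A n (phi b).
Proof.
by apply: word_map_in => [||m x _]; [exact: phi_gen_normalised|exact: phi_gen_low|exact: phi_gen_in].
Qed.

Lemma phi_gen_diff n (x : X n) : bd (phi_gen x) = phi (d (gn B x)).
Proof.
have [b nb] := ubnP n; elim: b n nb x => [//|b ih] n nb x.
rewrite phi_gen_rec; set k := section (d (gn B x)) - phi (d (gn B x)).
have bk : bd k = 0.
  rewrite /k raddfB section_diff cb_diff_diff raddf0 sub0r.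
  rewrite (word_map_chain_step phi_gen_normalised phi_gen_low) ?oppr0 // => m y mn.
    by apply: ih; lia.
  exact: phi_gen_in.
have pk : psih k = 0 by rewrite /k raddfB psih_section psih_phi subrr.
have := contraction_spec rX pk; rewrite defect_ofE bk raddf0 addr0 => /eqP.
rewrite subr_eq0 => /eqP e; rewrite raddfB section_diff -e /k subKr.
by [].
Qed.

Lemma phi_diff b : bd (phi b) = phi (d b).
Proof.
apply: (cb_ind (P := fun b => bd (phi b) = phi (d b))).
- by rewrite !raddf0.
- by move=> x y hx hy; rewrite !raddfB hx hy.
- by rewrite phi1 cb_diff1 raddf0 -(ce1 A) bd_in0 //; exact: ce_in.
move=> n x c _ hc; rewrite phi_mul (ch_bdM (m := n.-1)); last by rewrite phi_gn; exact: phi_gen_in.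
rewrite (cb_diffM (m := n.-1)); last exact: gn_in.
by rewrite raddfD raddf_sgn !phi_mul hc !phi_gn phi_gen_diff.
Qed.

Definition Phi : {additive A -> A} := (h \o phi \o psih) \- h.

Lemma PhiE a : Phi a = h (phi (psih a)) - h a.
Proof. by []. Qed.

Lemma Phi_in n a : ch_in A n a -> ch_in A n.+1 (Phi a).
Proof.
move=> ha; rewrite PhiE; apply: ch_inB; apply: (contraction_in B) => //.
exact/phi_in/psih_in.
Qed.

(** phi psi a - a lies in the kernel of psi, where h is a contraction, and Phi a is h of this
    element. *)
Lemma Phi_htp a : bd (Phi a) + Phi (bd a) = phi (psih a) - a.
Proof.
set k := phi (psih a) - a.
have pk : psih k = 0 by rewrite /k raddfB psih_phi subrr.
have := contraction_spec rX pk; rewrite defect_ofE => /eqP; rewrite subr_eq0 => /eqP ->.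
rewrite !PhiE psih_bd -phi_diff -!raddfB /k.
by [].
Qed.

End Retract.

(** * Naturality of the constructions *)

Section Naturality.
Variables (X Y : sset) (f : sset_map X Y).
Variables (AX : chain_algebra (loop_group X)) (AY : chain_algebra (loop_group Y)).
Variables (BX : cobar_algebra X) (BY : cobar_algebra Y).
Hypotheses (rX : reduced 1 X) (rY : reduced 1 Y).
Local Notation GX := (loop_group X).
Local Notation GY := (loop_group Y).
Variables (fA : {additive AX -> AY}) (fB : {additive BX -> BY}).
Hypothesis fAe : forall n (g : GX n), fA (ce AX g) = ce AY (loop_map f n g : GY n).
Hypothesis fAM : {morph fA : a b / a * b}.
Hypotheses (fB1 : fB 1 = 1) (fBM : {morph fB : a b / a * b}).
Hypothesis fBgn : forall n (x : X n), fB (gn BX x) = gn BY (f n x).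

Lemma fA1 : fA 1 = 1.
Proof.
by rewrite -(ce1 AX) fAe [loop_map f 0%N _](morph1 (@loop_mapM X Y f 0)) ce1.
Qed.

Lemma loop_map_mul n (g h : loop X n) :
  loop_map f n (g * h)%g = (loop_map f n g * loop_map f n h)%g :> loop Y n.
Proof. exact: loop_mapM. Qed.

Lemma loop_map_1 n : loop_map f n (1%g : loop X n) = 1%g :> loop Y n.
Proof. exact: (morph1 (@loop_mapM X Y f n)). Qed.

Lemma loop_map_gen n (x : X n.+1) : loop_map f n (tau x : loop X n) = tau (f n.+1 x) :> loop Y n.
Proof. exact: loop_map_tau. Qed.

Lemma lin_natural (F : forall n, GX n -> AX) (F' : forall n, GY n -> AY) a :
  normalised F -> normalised F' ->
  (forall n (g : GX n), fA (F n g) = F' n (loop_map f n g)) ->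
  fA (ch_lin AX F a) = ch_lin AY F' (fA a).
Proof.
move=> nF nF' e; apply: (ch_additive_eq (f := fA \o ch_lin AX F) (g := ch_lin AY F' \o fA)) => n g.
by rewrite /= fAe !ch_lin_ce.
Qed.

Lemma fA_bd a : fA (ch_bd AX a) = ch_bd AY (fA a).
Proof.
apply: (ch_additive_eq (f := fA \o ch_bd AX) (g := ch_bd AY \o fA)) => n g.
rewrite /= fAe !ch_bd_ce raddf_cobd; case: n g => [//|n] g; apply: eq_bigr => i _.
by rewrite fAe smap_face.
Qed.

Lemma psih_natural a : fB (psih AX BX a) = psih AY BY (fA a).
Proof.
apply: (ch_additive_eq (f := fB \o psih AX BX) (g := psih AY BY \o fA)) => n g.
by rewrite /= fAe !psih_ce (psi_natural fB1 fBM fBgn).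
Qed.

Section Step.
Variables (hX : {additive AX -> AX}) (hY : {additive AY -> AY}).
Hypothesis hN : forall a, fA (hX a) = hY (fA a).

Lemma defect_natural a : fA (defect_of hX a) = defect_of hY (fA a).
Proof. by rewrite !defect_ofE raddfB raddfD fA_bd !hN fA_bd. Qed.

Lemma ell_natural n (u v : GX n) :
  fA (ell hX u v) = ell hY (loop_map f n u : GY n) (loop_map f n v : GY n).
Proof.
rewrite /ell raddfB; congr (_ - _).
  rewrite -AW_raddf -(@AW_nat _ _ GX GX GY GY (loop_map f) (loop_map f) (hcup hY) u v);
    [|by move=> *; rewrite smap_face|by move=> *; rewrite smap_face].
  by apply: AW_ext => p q a b _; rewrite /hcup raddf_sgn fAM hN !fAe.
rewrite -EZh_raddf -(@EZh_nat _ _ GX GX GY GY (loop_map f) (loop_map f) (@mulce Y AY) u v);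
  try by move=> *; rewrite ?smap_face ?smap_dgn.
by apply: EZh_ext => k a b _; rewrite /mulce fAe loop_map_mul.
Qed.

Lemma htp_natural a : fA (htp hX a) = htp hY (fA a).
Proof.
apply: lin_natural; [exact: htp_basic_normalised|exact: htp_basic_normalised|move=> n].
apply: (@loop_ind X n (fun g => fA (htp_basic hX (g : GX n)) = htp_basic hY (loop_map f n g : GY n))).
  by rewrite loop_map_1 !htp_basic1 raddf0.
move=> x g; rewrite loop_map_mul loop_map_gen !htp_basic_tau raddfD raddfB !ell_natural.
rewrite loop_map_1 loop_map_gen.
by split=> [->//|/addIr].
Qed.

Lemma htp_sum_natural n a : fA (htp_sum hX n a) = htp_sum hY n (fA a).
Proof.
elim: n a => [|n ih] a; first exact: raddf0.
rewrite !htp_sumS raddfD htp_natural ih; congr (_ + htp_sum hY n _).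
by rewrite !defect_ofE raddfB raddfD fA_bd !htp_natural fA_bd.
Qed.

End Step.

Lemma contraction_basic_natural n (g : GX n) :
  fA (contraction_basic AX g) = contraction_basic AY (loop_map f n g : GY n).
Proof.
have [b nb] := ubnP n; elim: b n nb g => [//|b ih] n nb g.
have e a : fA (contraction_below AX n a) = contraction_below AY n (fA a).
  apply: lin_natural; try (apply: truncate_normalised; exact: contraction_basic_normalised).
  move=> m x; rewrite /truncate; case: ltnP => mn; last exact: raddf0.
  by apply: ih; lia.
rewrite /contraction_basic !causal_fixE /contraction_step (htp_sum_natural e).
by rewrite raddfB e fA_bd fAe.
Qed.

Lemma contraction_natural a : fA (contraction AX a) = contraction AY (fA a).
Proof.
apply: lin_natural; [exact: contraction_basic_normalised..|].
exact: contraction_basic_natural.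
Qed.

(** On elements psi a the section is 1 - dh - hd, which is natural, and these are all elements. *)
Lemma section_natural b : fA (section AX BX rX b) = section AY BY rY (fB b).
Proof.
have [a <-] := psih_surj AX b.
by rewrite psih_natural !sectionE (defect_natural contraction_natural).
Qed.

(** Deduced from the chains on the loop groups, as psi is natural and surjective. *)
Lemma fB_diff b : fB (cb_diff BX b) = cb_diff BY (fB b).
Proof.
have [a <-] := psih_surj AX b.
by rewrite psih_natural -!psih_bd psih_natural fA_bd.
Qed.

Lemma word_map_natural (F : forall n, X n -> AX) (F' : forall n, Y n -> AY) b :
  normalised F -> (forall n (x : X n), (n <= 1)%N -> F n x = 0) ->
  normalised F' -> (forall n (x : Y n), (n <= 1)%N -> F' n x = 0) ->
  (forall n (x : X n), fA (F n x) = F' n (f n x)) ->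
  fA (word_map BX F b) = word_map BY F' (fB b).
Proof.
move=> nF lF nF' lF' e.
apply: (cb_ind (P := fun b => fA (word_map BX F b) = word_map BY F' (fB b))).
- by rewrite !raddf0.
- by move=> x y hx hy; rewrite !raddfB hx hy.
- by rewrite fB1 !word_map1 fA1.
- by move=> n x c _ hc; rewrite fBM fBgn !word_map_cons // fAM e hc.
Qed.

Lemma phi_gen_natural n (x : X n) : fA (phi_gen AX BX rX x) = phi_gen AY BY rY (f n x).
Proof.
have [b nb] := ubnP n; elim: b n nb x => [//|b ih] n nb x.
rewrite !phi_genE /phi_step raddfB section_natural fBgn contraction_natural raddfB.
rewrite section_natural fB_diff fBgn; congr (_ - contraction AY (_ - _)).
rewrite -fBgn -fB_diff; apply: word_map_natural;
  try exact: truncate_phi_normalised; try exact: truncate_phi_low.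
move=> m y; rewrite /truncate; case: ltnP => mn; last exact: raddf0.
by apply: ih; lia.
Qed.

Lemma phi_natural b : fA (phi AX BX rX b) = phi AY BY rY (fB b).
Proof.
apply: word_map_natural; try exact: phi_gen_normalised; try exact: phi_gen_low.
exact: phi_gen_natural.
Qed.

Lemma Phi_natural a : fA (Phi AX BX rX a) = Phi AY BY rY (fA a).
Proof. by rewrite !PhiE raddfB !contraction_natural phi_natural psih_natural. Qed.

End Naturality.

(** * The cobar construction and the chains on the loop group *)

Section ConcreteCobar.
Variable X : sset.

Definition word_deg (w : {fmonom cobar_gen X}) : nat := (\sum_(a <- (w : seq _)) cobar_gen_deg a)%N.

Lemma cobar_in_ind (P : nat -> cobar X -> Prop) m b : (forall n, P n 0) ->
  (forall n a b, P n a -> P n b -> P n (a - b)) -> P 0%N 1 ->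
  (forall n (x : X n) m b, (1 < n)%N -> P m b -> P (n.-1 + m)%N (gen x * b)) ->
  cobar_in m b -> P m b.
Proof.
move=> P0 PB P1 Pg hb; apply: cobar_mem => [||w wb]; [exact: P0|exact: PB|].
rewrite -(hb _ wb); elim: (w : seq _) => [|a v ih].
  by rewrite big_nil cobar_word0.
by rewrite big_cons cobar_word_cons; apply: Pg => //; case/andP: (valP a).
Qed.

Definition cobar_pr (n : nat) : {additive cobar X -> cobar X} :=
  linext (fun w : {fmonom cobar_gen X} => if word_deg w == n then cobar_word w else 0).

Lemma cobar_prE m n b : cobar_in m b -> cobar_pr n b = if m == n then b else 0.
Proof.
move=> hb; apply: (cobar_mem (P := fun b => cobar_pr n b = if m == n then b else 0) (b := b))
  => [|x y hx hy|w wb].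
- by rewrite raddf0 if_same.
- rewrite [LHS]raddfB [X in X - _ = _]hx [X in _ - X = _]hy.
  by case: ifP => _; rewrite ?subrr.
- have := hb _ wb; rewrite /cobar_pr /= /cobar_word linextU /word_deg => ->.
  by [].
Qed.

Section Fold.
Variables (V : zmodType) (v : V) (R : forall n, X n -> V -> V).

Definition cobar_fold : {additive cobar X -> V} :=
  linext (fun w : {fmonom cobar_gen X} =>
    foldr (fun a : cobar_gen X => R (tagged (val a) : X (tag (val a)))) v w).

Lemma cobar_fold_word w : cobar_fold (cobar_word w)
  = foldr (fun a : cobar_gen X => R (tagged (val a) : X (tag (val a)))) v w.
Proof. by rewrite /cobar_fold /= /cobar_word linextU. Qed.

Lemma cobar_fold1 : cobar_fold 1 = v.
Proof. by rewrite -cobar_word0 cobar_fold_word. Qed.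

Lemma cobar_fold_gen n (x : X n) b :
  (forall n x, zmod_morphism (@R n x)) ->
  (forall n i (x : X n) v, R (sset_dgn i x) v = 0) ->
  (forall n (x : X n) v, (n <= 1)%N -> R x v = 0) ->
  cobar_fold (gen x * b) = R x (cobar_fold b).
Proof.
move=> RB Rd Rl.
have R0 k (y : X k) : R y 0 = 0 by rewrite -[X in R y X](subrr 0) RB subrr.
apply: (cobar_mem (P := fun b => cobar_fold (gen x * b) = R x (cobar_fold b)) (b := b))
  => [|y z hy hz|w _].
- by rewrite mulr0 !raddf0 R0.
- by rewrite mulrBr [LHS]raddfB [X in X - _ = _]hy [X in _ - X = _]hz [in RHS]raddfB RB.
case: genP => [h|a e n1].
  rewrite mul0r raddf0; case: h => [n1|]; first by rewrite Rl.
  by case: n x => [//|n] x [i [y ->]]; rewrite Rd.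
rewrite -cobar_wordM !cobar_fold_word /= e.
by [].
Qed.

End Fold.

Definition cobar_ca : cobar_algebra X := @CobarAlgebra X (cobar X) (@gen X) (@cobar_in X)
  (@cobar_diff X) cobar_fold (@gen_normalised X) (@gen_low X) (@gen_in X)
  (@cobar_in0 X) (@cobar_inB X) (@cobar_in1 X) (@cobar_inM X) (@cobar_diffM X)
  (@cobar_diff1 X) (@cobar_diff_gen X) (@cobar_ind X) cobar_in_ind cobar_pr cobar_prE
  cobar_fold1 cobar_fold_gen.

End ConcreteCobar.

(** An alias of the chains that carries the shuffle product as ring multiplication. *)
Definition chain_ring (G : sgroup) : Type := chains G.

HB.instance Definition _ (G : sgroup) := GRing.Zmodule.copy (chain_ring G) (chains G).

Lemma chains_one_neq0 (G : sgroup) : chains_one G != 0.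
Proof.
(* The augmentation, which is normalised because degeneracies have positive degree. *)
pose F n (g : G n) : int := if n is 0 then 1 else 0.
have nF : normalised F by [].
apply/eqP => e; have := lin_chain (1%g : G 0) nF.
by rewrite -/(chains_one G) e raddf0.
Qed.

HB.instance Definition _ (G : sgroup) := GRing.Zmodule_isNzRing.Build (chain_ring G)
  (fun a b c => esym (@smulA G a b c)) (@smul1l G) (@smul1r G)
  (fun a b c => @smulDl G a b c) (fun a b c => @smulDr G b c a) (chains_one_neq0 G).

Section ConcreteChains.
Variable G : sgroup.

Lemma chain_ring_in_ind (P : chains G -> Prop) n a : P 0 ->
  (forall a b, P a -> P b -> P (a - b)) -> (forall g : G n, P (basic g)) -> chains_in n a -> P a.
Proof. by move=> P0 PB h ha; exact: (chains_mem ha P0 PB h). Qed.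

Lemma lin_basic (V : zmodType) (F : forall n, G n -> V) n (g : G n) :
  normalised F -> lin F (basic g) = F n g.
Proof. exact: lin_chain. Qed.

Definition chain_bd : {additive chains G -> chains G} := @boundary G.
Definition chain_lin (V : zmodType) (F : forall n, G n -> V) : {additive chains G -> V} := lin F.

Definition chains_ca : chain_algebra G := @ChainAlgebra G (chain_ring G) (@basic G) (@chains_in G)
  chain_bd chain_lin (@basic_normalised G) (@chains_in_chain G)
  (@chains_in0 G) (@chains_inB G) (@smul_in G) (@boundary_chain G)
  (@boundary_smul G) (erefl _) (@smul_chain G) lin_basic (@chains_ind G)
  chain_ring_in_ind.

End ConcreteChains.

(** * Induced maps of chains, and the assembly of the theorem *)

Section ChainsMap.
Variables (X Y : sset) (f : sset_map X Y).

HB.instance Definition _ := GRing.Additive.copy (chains_map f)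
  (linext (fun b : nondeg X => chain (smap_simplex f (val b)))).

Lemma chains_map_chain n (x : X n) : chains_map f (basic x) = basic (f n x).
Proof.
have nF : normalised (fun n (x : X n) => basic (f n x)).
  by move=> m i y; rewrite smap_dgn basic_normalised.
exact: (lin_chain x nF).
Qed.

End ChainsMap.

Lemma chains_map_smul (X Y : sset) (f : sset_map X Y) (a b : chains (loop_group X)) :
  chains_map (loop_map f) (shuffle_mul a b)
  = shuffle_mul (chains_map (loop_map f) a) (chains_map (loop_map f) b).
Proof.
pose F := loop_map f.
apply: (chains_ind (P := fun a => chains_map F (shuffle_mul a b)
    = shuffle_mul (chains_map F a) (chains_map F b))) => [|x y hx hy|p g].
- by rewrite smul0l [chains_map F 0]raddf0 smul0l.
- rewrite smulBl [LHS]raddfB [X in X - _ = _]hx [X in _ - X = _]hy.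
  by rewrite [chains_map F (x - y)]raddfB smulBl.
apply: (chains_ind (P := fun b => chains_map F (shuffle_mul (basic g) b)
    = shuffle_mul (chains_map F (basic g)) (chains_map F b))) => [|x y hx hy|q h].
- by rewrite smul0r [chains_map F 0]raddf0 smul0r.
- rewrite smulBr [LHS]raddfB [X in X - _ = _]hx [X in _ - X = _]hy.
  by rewrite [chains_map F (x - y)]raddfB smulBr.
rewrite [chains_map F (basic g)]chains_map_chain [chains_map F (chain _)]chains_map_chain.
rewrite [LHS](_ : _ = chains_map F (sh (@mulc _) g h)); last by rewrite -smul_chain.
rewrite [RHS]smul_chain -[LHS]sh_raddf.
rewrite -(sh_nat (f := F) (g := F) (@mulc (loop_group Y))) => [|n i x|n i x];
  try exact: smap_dgn.
apply: sh_ext => n u v _; rewrite /mulc -/(basic _) [LHS]chains_map_chain.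
by rewrite /F loop_map_mul.
Qed.

Theorem mainTheorem1 :
  exists (phi : forall X : sset, reduced 1 X ->
            {additive cobar X -> chains (loop_group X)})
         (psi : forall X : sset, reduced 1 X ->
            {additive chains (loop_group X) -> cobar X})
         (Phi : forall X : sset, reduced 1 X ->
            {additive chains (loop_group X) -> chains (loop_group X)}),
    (forall (X : sset) (hX : reduced 1 X),
      (* phi and psi are chain maps and Phi has degree +1 *)
      ((forall n c, cobar_in n c -> chains_in n (phi X hX c)) /\
       (forall c, boundary (phi X hX c) = phi X hX (cobar_diff c)) /\
       (forall n c, chains_in n c -> cobar_in n (psi X hX c)) /\
       (forall c, cobar_diff (psi X hX c) = psi X hX (boundary c)) /\
       (forall n c, chains_in n c -> chains_in n.+1 (Phi X hX c))) /\
      (* strong deformation retract *)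
      ((forall c, psi X hX (phi X hX c) = c) /\
       (forall c, boundary (Phi X hX c) + Phi X hX (boundary c)
                  = phi X hX (psi X hX c) - c)) /\
      (* phi and psi are unital and multiplicative *)
      (phi X hX 1 = chains_one (loop_group X) /\
       (forall a b, phi X hX (a * b)
                    = shuffle_mul (phi X hX a) (phi X hX b)) /\
       psi X hX (chains_one (loop_group X)) = 1 /\
       (forall a b, psi X hX (shuffle_mul a b)
                    = psi X hX a * psi X hX b))) /\
    (* naturality *)
    (forall (X Y : sset) (hX : reduced 1 X) (hY : reduced 1 Y)
            (f : sset_map X Y),
      (forall c, phi Y hY (cobar_map f c)
                 = chains_map (loop_map f) (phi X hX c)) /\
      (forall c, psi Y hY (chains_map (loop_map f) c)
                 = cobar_map f (psi X hX c)) /\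
      (forall c, Phi Y hY (chains_map (loop_map f) c)
                 = chains_map (loop_map f) (Phi X hX c))).

pose A X := chains_ca (loop_group X); pose B X := cobar_ca X.
exists (fun X hX => phi (A X) (B X) hX), (fun X hX => psih (A X) (B X)),
  (fun X hX => Phi (A X) (B X) hX); split.
  move=> X hX; split; [|split].
  - split; [|split; [|split; [|split]]].
    + exact: (@phi_in X (A X) (B X) hX).
    + exact: (@phi_diff X (A X) (B X) hX).
    + exact: (@psih_in X (A X) (B X)).
    + move=> c; exact/esym/(@psih_bd X (A X) (B X)).
    + exact: (@Phi_in X (A X) (B X) hX).
  - split; [exact: (@psih_phi X (A X) (B X) hX)|exact: (@Phi_htp X (A X) (B X) hX)].
  - split; [|split; [|split]].
    + exact: (@phi1 X (A X) (B X) hX).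
    + exact: (@phi_mul X (A X) (B X) hX).
    + exact: (@psih1 X (A X) (B X)).
    + exact: (@psih_mul X (A X) (B X)).
move=> X Y hX hY f.
pose fA : {additive A X -> A Y} := chains_map (loop_map f).
pose fB : {additive B X -> B Y} := cobar_map f.
have fAe n (g : loop_group X n) : fA (ce (A X) g) = ce (A Y) (loop_map f n g : loop_group Y n).
  exact: chains_map_chain.
have fAM : {morph fA : a b / a * b} by exact: chains_map_smul.
have fB1 : fB 1 = 1 by exact: cobar_map1.
have fBM : {morph fB : a b / a * b} by exact: cobar_mapM.
have fBgn n (x : X n) : fB (gn (B X) x) = gn (B Y) (f n x) by exact: cobar_map_gen.
split; [|split] => c; apply: esym.
- exact: (phi_natural hX hY fAe fAM fB1 fBM fBgn c).
- exact: (psih_natural fAe fB1 fBM fBgn c).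
- exact: (Phi_natural hX hY fAe fAM fB1 fBM fBgn c).
Qed.
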